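(* Let $q\geq 4$ be a prime power, $m\geq 2$, $0\leq t\leq m-2$ and $2\leq s\leq q-2$ be integers. Let $f\in R_q(t(q-1)+s,m)$ be a second weight codeword, i.e. $|f|=(q-s+1)(q-1)q^{m-t-2}$, and let $S$ be its support. Then $S$ is contained in an affine subspace $G$ of $\mathbb{F}_q^m$ of codimension $t$, and either $S$ is the union of $q-s+1$ parallel affine subspaces of codimension $t+1$ (contained in $G$) minus their intersection with an affine subspace of codimension $t+1$ which is not parallel to them, or $S$ is the union of $q-s+1$ affine subspaces of codimension $t+1$ (contained in $G$) which meet in a common affine subspace of codimension $t+2$, minus this common intersection.
   Context: $\mathbb{F}_q$ is the finite field with $q$ elements and $B_m^q$ is the $\mathbb{F}_q$-algebra of all functions $\mathbb{F}_q^m\to\mathbb{F}_q$. Every $f\in B_m^q$ is given by a unique polynomial in $\mathbb{F}_q[X_1,\ldots,X_m]$ of degree at most $q-1$ in each variable (its reduced form), and $\deg(f)$ is the total degree of this reduced form. For $0\leq r\leq m(q-1)$, $R_q(r,m)=\{f\in B_m^q:\deg(f)\leq r\}$ is the generalized Reed–Muller code. The support of $f$ is $\{x\in\mathbb{F}_q^m: f(x)\neq 0\}$ and $|f|$ denotes its cardinality (Hamming weight). Subspaces and hyperplanes are affine subspaces of $\mathbb{F}_q^m$ and codimensions are taken in $\mathbb{F}_q^m$. Under the hypotheses, $(q-s+1)(q-1)q^{m-t-2}$ is the second smallest nonzero weight of $R_q(t(q-1)+s,m)$; second weight codewords are the codewords of that weight. *)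

(* Defs.v *)
From HB Require Import structures.
From mathcomp Require Import all_boot all_order all_algebra.
From mathcomp Require Import mpoly.

Set Implicit Arguments.
Unset Strict Implicit.
Unset Printing Implicit Defensive.

Import GRing.Theory.
Local Open Scope ring_scope.

Section GeneralizedReedMuller.

Variables (F : finFieldType) (m : nat).

Definition reduced (p : {mpoly F[m]}) : Prop :=
  forall a : 'X_{1..m}, a \in msupp p -> forall i : 'I_m, (a i <= #|F| - 1)%N.

Definition reduced_form (f : {ffun 'rV[F]_m -> F}) (p : {mpoly F[m]}) : Prop :=
  reduced p /\ forall x : 'rV[F]_m, f x = p.@[fun i => x 0 i].

(* [msize p] is 1 + the total degree of p, and [msize 0 = 0]; the predecessor
   puts the zero function in every code. *)
Definition reed_muller (r : nat) (f : {ffun 'rV[F]_m -> F}) : Prop :=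
  exists2 p : {mpoly F[m]}, reduced_form f p & ((msize p).-1 <= r)%N.

Definition fsupport (f : {ffun 'rV[F]_m -> F}) : {set 'rV[F]_m} :=
  [set x | f x != 0].

Definition hamming_weight (f : {ffun 'rV[F]_m -> F}) : nat := #|fsupport f|.

Definition translate (a : 'rV[F]_m) (V : {vspace 'rV[F]_m}) : {set 'rV[F]_m} :=
  [set x | x - a \in V].

(* The codimension is taken in F^m; affine subspaces are nonempty. *)
Definition affine_codim (k : nat) (A : {set 'rV[F]_m}) : Prop :=
  exists (a : 'rV[F]_m) (V : {vspace 'rV[F]_m}),
    A = translate a V /\ (\dim V + k = m)%N.

(* Having the same direction: this is parallelism for affine subspaces of equal
   dimension. Equal subspaces are parallel. *)
Definition parallel (A B : {set 'rV[F]_m}) : Prop :=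
  exists (a b : 'rV[F]_m) (V : {vspace 'rV[F]_m}),
    A = translate a V /\ B = translate b V.

End GeneralizedReedMuller.

(* Main.v *)
Require Import Defs.
From mathcomp Require Import all_boot all_order all_algebra.
From mathcomp Require Import mpoly.
From mathcomp Require Import all_field ring zify.

(* Write q = #|F|, and let push h be the sum of h over the lines in a fixed
   direction.  It lowers the degree by q - 1 and does not enlarge the support; and
   as a support of size at most q^(m-1) meets some line in a single point, the
   direction can be chosen with push h nonzero.  By induction on t the support of
   push f lies in a flat.  For t > 1, multiply f by an affine form which is constant
   on that flat: the product would be too light if it were nonzero, so f vanishes
   outside a hyperplane and the induction hypothesis applies to its restriction.
   For t = 1 the support of f either projects bijectively, and is then the graph of
   an affine function, or push f is a minimum word; in that case the weights that
   are possible for f on the hyperplanes parallel to its zeros add up to too much.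

   For t = 0 a double count over all hyperplanes shows that f vanishes on one of
   them, so f = (l - c) g with deg g < deg f, and the number of zeros of g on
   {l = c} is that of a minimum word, that of a second word, or smaller.  The first
   two cases are settled by induction.  The third gives, in a plane, a curve with d
   points on every line y = b for b nonzero and none on y = 0; it is excluded by
   reducing x^q - x modulo the equation of the curve and differentiating. *)

Set Implicit Arguments.
Unset Strict Implicit.
Unset Printing Implicit Defensive.

Import GRing.Theory.
Local Open Scope ring_scope.

(** * Polynomial functions of bounded degree *)

Section PolynomialFunctions.

Variable F : finFieldType.
Local Notation q := #|F|.

(** Zeros are counted rather than nonzero values, because the factorizations turn zero sets into
    unions of hyperplanes. For t = 0, in n + 2 variables, the second weight comes from directions
    along which f has exact degree s. On the lines in such a direction the zeros are governed by the
    remainder of X^q - X modulo f. If its highest coefficient that is not identically zero is the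
    one of X^j, with j > 0, that coefficient has degree at most q - j, so it is nonzero on at least
    j q^n lines, and each of these has at most j zeros. Compared with s zeros on every line, the
    loss is at least (s - j) j q^n >= (s - 1) q^n. Equality leaves only j = 1 and j = s - 1 and
    makes the coefficient a minimum word, so the short lines fill parallel hyperplanes. If f
    vanished on no hyperplane, every hyperplane would contain such a direction; the zeros would then
    be equidistributed over the hyperplanes of every linear form outside a small special set, and
    this makes the double count conclusive. *)

Definition lin n (w : 'cV[F]_n) (x : 'rV[F]_n) : F := (x *m w) 0 0.

Definition pt n (t : F) (y : 'rV[F]_n) : 'rV[F]_(1 + n) := row_mx t%:M y.

Lemma linD n (w : 'cV[F]_n) x y : lin w (x + y) = lin w x + lin w y.
Proof. by rewrite /lin mulmxDl mxE. Qed.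

Lemma linB n (w : 'cV[F]_n) x y : lin w (x - y) = lin w x - lin w y.
Proof. by rewrite /lin mulmxBl !mxE. Qed.

Lemma linZ n (w : 'cV[F]_n) a x : lin w (a *: x) = a * lin w x.
Proof. by rewrite /lin -scalemxAl mxE. Qed.

Lemma linZl n (w : 'cV[F]_n) a x : lin (a *: w) x = a * lin w x.
Proof. by rewrite /lin -scalemxAr mxE. Qed.

Lemma linDl n (w w' : 'cV[F]_n) x : lin (w + w') x = lin w x + lin w' x.
Proof. by rewrite /lin mulmxDr mxE. Qed.

Lemma lin0 n (w : 'cV[F]_n) : lin w 0 = 0.
Proof. by rewrite /lin mul0mx mxE. Qed.

Lemma lin0l n (x : 'rV[F]_n) : lin 0 x = 0.
Proof. by rewrite /lin mulmx0 mxE. Qed.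

Lemma linM n k (M : 'M_(n, k)) (w : 'cV[F]_k) x : lin w (x *m M) = lin (M *m w) x.
Proof. by rewrite /lin mulmxA. Qed.

Lemma lin_pt n (w : 'cV[F]_(1 + n)) t (y : 'rV[F]_n) :
  lin w (pt t y) = usubmx w 0 0 * t + lin (dsubmx w) y.
Proof.
by rewrite /lin /pt -{1}[w]vsubmxK mul_row_col mxE mul_scalar_mx [in X in X + _]mxE mulrC.
Qed.

(* [pd k f]: [f] is a polynomial function of degree [< k]; the shift makes the
   truncated degrees [k - j] of the coefficients below meaningful. *)
Inductive pd n : nat -> ('rV[F]_n -> F) -> Prop :=
| pd_zero k f : f =1 (fun=> 0) -> pd k f
| pd_const k c f : f =1 (fun=> c) -> pd k.+1 f
| pd_affM k b w f g : pd k f -> g =1 (fun x => (b + lin w x) * f x) -> pd k.+1 g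
| pd_add k f g h : pd k f -> pd k g -> h =1 (fun x => f x + g x) -> pd k h.

Lemma pd_ext n k (f g : 'rV[F]_n -> F) : pd k f -> g =1 f -> pd k g.
Proof.
by move=> pf e; apply: (pd_add pf (pd_zero k (frefl _))) => x; rewrite e addr0.
Qed.

Lemma pd_0 n (f : 'rV[F]_n -> F) : pd 0 f -> f =1 (fun=> 0).
Proof.
suff H k : pd k f -> k = 0%N -> f =1 (fun=> 0) by move=> /H; apply.
elim=> // {f} {}k f1 f2 h _ IH1 _ IH2 e k0 x.
by rewrite e IH1 // IH2 // addr0.
Qed.

Lemma pd_le n k l (f : 'rV[F]_n -> F) : (k <= l)%N -> pd k f -> pd l f.
Proof.
move=> kl pf; elim: pf l kl => {k f}.
- by move=> k f e l _; apply: pd_zero.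
- by move=> k c f e [|l] // _; apply: pd_const e.
- by move=> k b w f g pf IH e [|l] // kl; apply: pd_affM e; apply: IH.
- by move=> k f g h _ IHf _ IHg e l kl; apply: pd_add e; [apply: IHf|apply: IHg].
Qed.

Lemma pd_scale n k c (f : 'rV[F]_n -> F) : pd k f -> pd k (fun x => c * f x).
Proof.
move=> pf; elim: pf => {k f}.
- by move=> k f e; apply: pd_zero => x; rewrite e mulr0.
- by move=> k d f e; apply: (pd_const k (c := c * d)) => x; rewrite e.
- by move=> k b w f g pf IH e; apply: (pd_affM (b := b) (w := w) IH) => x; rewrite e mulrCA.
- by move=> k f g h _ IHf _ IHg e; apply: (pd_add IHf IHg) => x; rewrite e mulrDr.
Qed.

Lemma pd_sum n k (I : Type) (r : seq I) (P : pred I) (f : I -> 'rV[F]_n -> F) :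
  (forall i, P i -> pd k (f i)) -> pd k (fun x => \sum_(i <- r | P i) f i x).
Proof.
move=> pf; elim: r => [|i r IH]; first by apply: pd_zero => x; rewrite big_nil.
case Pi: (P i).
  by apply: (pd_add (pf _ Pi) IH) => x; rewrite big_cons Pi.
by apply: (pd_ext IH) => x; rewrite big_cons Pi.
Qed.

(** Degrees at most k and less than l add up to less than k + l; one weak and one strict bound avoid
    a predecessor. *)
Lemma pd_mul n k l (f g : 'rV[F]_n -> F) :
  pd k.+1 f -> pd l g -> pd (k + l) (fun x => f x * g x).
Proof.
move=> pf pg.
suff H k' : pd k' f -> forall k, k' = k.+1 -> pd (k + l) (fun x => f x * g x).
  exact: H pf _ erefl.
elim=> {pf k k' f}.
- by move=> k' f e k _; apply: pd_zero => x; rewrite e mul0r.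
- move=> k' c f e k [_]; apply: pd_le (leq_addl k l) _.
  by apply: pd_ext (pd_scale c pg) _ => x; rewrite e.
- move=> k' b w f h pf IH e k [ek]; case: k' => [|k'] in ek pf IH *.
    by apply: pd_zero => x; rewrite e (pd_0 pf) mulr0 mul0r.
  by rewrite -ek addSn; apply: (pd_affM (IH k' erefl)) => x; rewrite e mulrA.
- move=> k' f1 f2 h _ IH1 _ IH2 e k ek.
  by apply: (pd_add (IH1 _ ek) (IH2 _ ek)) => x; rewrite e mulrDl.
Qed.

Lemma pd_comp n m k (f : 'rV[F]_m -> F) (p : 'rV[F]_m) (M : 'M[F]_(n, m)) :
  pd k f -> pd k (fun x => f (p + x *m M)).
Proof.
move=> pf; elim: pf => {k f}.
- by move=> k f e; apply: pd_zero => x; apply: e.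
- by move=> k c f e; apply: (pd_const k (c := c)) => x; apply: e.
- move=> k b w f g pf IH e; apply: (pd_affM (b := b + lin w p) (w := M *m w) IH) => x.
  by rewrite e linD linM addrA.
- by move=> k f g h _ IHf _ IHg e; apply: (pd_add IHf IHg) => x; apply: e.
Qed.

Lemma pd_prod n (I : Type) (r : seq I) (b : I -> F) (w : I -> 'cV[F]_n) :
  pd (size r).+1 (fun x => \prod_(i <- r) (b i + lin (w i) x)).
Proof.
elim: r => [|i r IH]; first by apply: (pd_const 0 (c := 1)) => x; rewrite big_nil.
by apply: (pd_affM IH) => x; rewrite big_cons.
Qed.

(** The expansion is not reduced modulo t^q - t, so for k > q the [a j] are not determined by [f];
    only their degrees matter. *)
Lemma pd_slice n k (f : 'rV[F]_(1 + n) -> F) : pd k f ->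
  exists a : nat -> 'rV[F]_n -> F, (forall j, pd (k - j) (a j)) /\
    forall t y, f (pt t y) = \sum_(j < k) a j y * t ^+ j.
Proof.
move=> pf; elim: pf => {k f}.
- move=> k f e; exists (fun _ _ => 0); split=> [j|t y]; first exact: pd_zero.
  by rewrite e big1 // => j _; rewrite mul0r.
- move=> k c f e; exists (fun j _ => if j == 0%N then c else 0); split=> [[|j]|t y].
  + by rewrite subn0; apply: (pd_const k (c := c)).
  + exact: pd_zero.
  + by rewrite e big_ord_recl big1 ?addr0 ?mulr1 // => j _; rewrite mul0r.
- move=> k b w f g pf [a [pa ea]] e.
  exists (fun j y => (b + lin (dsubmx w) y) * a j y +
            (if j is j'.+1 then usubmx w 0 0 * a j' y else 0)); split.
    move=> j; apply: (pd_add (f := fun y => (b + lin (dsubmx w) y) * a j y)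
       (g := fun y => if j is j'.+1 then usubmx w 0 0 * a j' y else 0)) => //.
      case: (leqP j k) => jk; first by rewrite subSn //; apply: (pd_affM (pa j)).
      have := pa j; rewrite (eqP (ltnW jk : k - j == 0)%N) => /pd_0 a0.
      by apply: pd_zero => y; rewrite a0 mulr0.
    case: j => [|j]; first exact: pd_zero.
    by rewrite subSS; apply: pd_scale.
  move=> t y; rewrite e ea lin_pt.
  have ak y' : a k y' = 0 by have := pa k; rewrite subnn => /pd_0.
  under [RHS]eq_bigr do rewrite mulrDl.
  rewrite big_split /= big_ord_recr /= ak mulr0 mul0r addr0.
  rewrite big_ord_recl /= mul0r add0r.
  rewrite addrCA mulrDl [LHS]addrC !mulr_sumr; congr (_ + _); last first.
    by apply: eq_bigr => j _; rewrite /bump /= add1n add0n exprS; ring.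
  by apply: eq_bigr => j _; rewrite mulrA.
- move=> k f g h _ [a [pa ea]] _ [a' [pa' ea']] e.
  exists (fun j y => a j y + a' j y); split=> [j|t y]; first exact: (pd_add (pa j) (pa' j)).
  by rewrite e ea ea' -big_split /=; apply: eq_bigr => j _; rewrite -mulrDl.
Qed.

End PolynomialFunctions.

(** * Sums over lines and leading forms *)

Section Lines.

Variable F : finFieldType.
Local Notation q := #|F|.

Lemma poly_fun_eq0 (P : {poly F}) : (size P <= q)%N -> (forall t, P.[t] = 0) -> P = 0.
Proof.
move=> sP P0; apply/eqP/negPn/negP => nz.
have := max_poly_roots (rs := enum F) nz.
rewrite -cardE enum_uniq => /(_ _ isT) H; move: sP; rewrite leqNgt H //.
by apply/allP => t _; rewrite rootE P0.
Qed.

(** If u^j <> 1, replacing t by u t multiplies the sum by u^j; such a nonzero u exists because X^j -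
    1 has at most j < q - 1 roots. *)
Lemma sum_expf (j : nat) : (j < q.-1)%N -> \sum_(t : F) t ^+ j = 0.
Proof.
case: j => [|j] jq.
  (* For j = 0 the sum is q times 1, and it vanishes because the shift by 1 leaves the sum of all t
     unchanged. *)
  have /eqP : \sum_(t : F) t = \sum_(t : F) (1 + t) by rewrite [LHS](reindex_inj (addrI 1)).
  rewrite big_split /= -subr_eq subrr eq_sym => /eqP H; rewrite -[RHS]H.
  by apply: eq_bigr => t _; rewrite expr0.
have [u /andP[u0 uj]] : exists u : F, (u != 0) && (u ^+ j.+1 != 1).
  case: (pickP (fun u : F => (u != 0) && (u ^+ j.+1 != 1))) => [u|H]; first by exists u.
  exfalso.
  have nz : ('X^(j.+1) - 1 : {poly F}) != 0.
    by rewrite -size_poly_eq0 size_XnsubC.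
  have := max_poly_roots (rs := rem 0 (enum F)) nz.
  rewrite rem_uniq ?enum_uniq // size_rem ?mem_enum // -cardE size_XnsubC //.
  move=> /(_ _ isT); rewrite ltnNge jq => H'; suff: false by []; apply: H'.
  apply/allP => t; rewrite mem_rem_uniq ?enum_uniq // !inE => /andP[t0 _].
  by have /negbT := H t; rewrite t0 /= negbK rootE !hornerE subr_eq0.
have /eqP : \sum_(t : F) t ^+ j.+1 = \sum_(t : F) u ^+ j.+1 * t ^+ j.+1.
  by rewrite [LHS](reindex_inj (mulfI u0)); apply: eq_bigr => t _; rewrite exprMn.
rewrite -mulr_sumr -subr_eq0 -[X in X - _]mul1r -mulrBl mulf_eq0 subr_eq0 eq_sym.
by rewrite (negPf uj) => /eqP.
Qed.

(** Summation over t kills t^j for j < q - 1, and the slices that remain have degree less than k -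
    (q - 1). *)
Lemma pd_push n k (f : 'rV[F]_(1 + n) -> F) :
  pd k f -> pd (k - q.-1) (fun y => \sum_t f (pt t y)).
Proof.
case/pd_slice=> a [pa ea].
apply: (@pd_ext _ _ _ (fun y => \sum_(j < k) (\sum_t t ^+ j) * a j y)); last first.
  move=> y; under eq_bigr do rewrite ea.
  rewrite exchange_big /=; apply: eq_bigr => j _.
  by rewrite mulr_suml; apply: eq_bigr => t _; rewrite mulrC.
apply: pd_sum => j _; case: (ltnP j q.-1) => jq.
  by rewrite sum_expf //; apply: pd_zero => y; rewrite mul0r.
by apply: pd_scale; apply: pd_le (pa j); apply: leq_sub2l.
Qed.

Lemma ptD n t u (y z : 'rV[F]_n) : pt t y + pt u z = pt (t + u) (y + z).
Proof. by rewrite /pt add_row_mx -raddfD. Qed.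

Lemma ptZ n a u (z : 'rV[F]_n) : a *: pt u z = pt (a * u) (a *: z).
Proof. by rewrite /pt scale_row_mx scale_scalar_mx. Qed.

(** [T v] is the value at [v] of the homogeneous part of degree k, which is why it does not depend
    on the base point [p]. *)
Lemma pd_line n k (f : 'rV[F]_n -> F) : pd k.+1 f ->
  exists T : 'rV[F]_n -> F, forall p v, exists2 P : {poly F},
    (size P <= k)%N & forall t, f (p + t *: v) = T v * t ^+ k + P.[t].
Proof.
move=> pf; suff H k' : pd k' f -> forall k, k' = k.+1 -> exists T : 'rV[F]_n -> F, forall p v,
   exists2 P : {poly F}, (size P <= k)%N & forall t, f (p + t *: v) = T v * t ^+ k + P.[t].
  exact: H pf _ erefl.
have triv0 g : g =1 (fun=> 0) -> exists T : 'rV[F]_n -> F, forall p v, exists2 P : {poly F},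
   (size P <= k)%N & forall t, g (p + t *: v) = T v * t ^+ k + P.[t].
  move=> g0; exists (fun _ => 0) => p v; exists 0; first by rewrite size_poly0.
  by move=> t; rewrite g0 mul0r add0r horner0.
elim=> {pf k' f}.
- move=> k' f e l _; exists (fun _ => 0) => p v; exists 0; first by rewrite size_poly0.
  by move=> t; rewrite e mul0r add0r horner0.
- move=> k' c f e [|l] _.
    exists (fun _ => c) => p v; exists 0; first by rewrite size_poly0.
    by move=> t; rewrite e horner0 mulr1 addr0.
  exists (fun _ => 0) => p v; exists c%:P; first by rewrite size_polyC; case: (c != 0).
  by move=> t; rewrite e hornerC mul0r add0r.
- move=> k' b w f g pf IH e l [<-]; case: k' pf IH => [|k'] pf IH.
    exists (fun _ => 0) => p v; exists 0; first by rewrite size_poly0.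
    by move=> t; rewrite e (pd_0 pf) mulr0 mul0r add0r horner0.
  case: (IH _ erefl) => T HT; exists (fun v => lin w v * T v) => p v.
  case: (HT p v) => P sP eP.
  exists (((b + lin w p)%:P + lin w v *: 'X) * P + (T v * (b + lin w p)) *: 'X^k').
    apply: leq_trans (size_polyD _ _) _; rewrite geq_max; apply/andP; split.
      apply: leq_trans (size_polyMleq _ _) _.
      rewrite -subn1 leq_subLR; apply: leq_trans (_ : 2 + k' <= _)%N => //.
      apply: leq_add => //; apply: leq_trans (size_polyD _ _) _.
      rewrite geq_max size_polyC; case: (_ != 0) => /=;
        by apply: leq_trans (size_scale_leq _ _) _; rewrite size_polyX.
    by apply: leq_trans (size_scale_leq _ _) _; rewrite size_polyXn.
  by move=> t; rewrite e eP !hornerE /= linD linZ exprS; ring.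
- move=> k' f g h _ IH1 _ IH2 e l ek.
  case: (IH1 _ ek) => T1 H1; case: (IH2 _ ek) => T2 H2.
  exists (fun v => T1 v + T2 v) => p v.
  case: (H1 p v) => P1 sP1 e1; case: (H2 p v) => P2 sP2 e2.
  exists (P1 + P2); first by apply: leq_trans (size_polyD _ _) _; rewrite geq_max sP1.
  by move=> t; rewrite e e1 e2 hornerD; ring.
Qed.

Definition low n k (f : 'rV[F]_n -> F) :=
  forall p v, exists2 P : {poly F}, (size P <= k)%N & forall t, f (p + t *: v) = P.[t].

Lemma pt_submx n (x : 'rV[F]_(1 + n)) : pt (lsubmx x 0 0) (rsubmx x) = x.
Proof. by rewrite /pt -mx11_scalar hsubmxK. Qed.

Lemma lsubmx_pt n t (y : 'rV[F]_n) : lsubmx (pt t y) 0 0 = t.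
Proof. by rewrite /pt row_mxKl mxE eqxx. Qed.

Lemma rsubmx_pt n t (y : 'rV[F]_n) : rsubmx (pt t y) = y.
Proof. by rewrite /pt row_mxKr. Qed.

Lemma pd_unslice n k (a : nat -> 'rV[F]_n -> F) : (forall j, pd (k - j) (a j)) ->
  pd k (fun x : 'rV[F]_(1 + n) => \sum_(j < k) a j (rsubmx x) * lsubmx x 0 0 ^+ j).
Proof.
move=> pa; apply: pd_sum => j _.
have pj : pd j.+1 (fun x : 'rV[F]_(1 + n) => (0 + lin (delta_mx 0 0) x) ^+ j).
  have := pd_prod (nseq j tt) (fun=> 0) (fun=> delta_mx 0 0 : 'cV[F]_(1 + n)).
  rewrite size_nseq => H; apply: (pd_ext H) => x.
  by rewrite big_const_seq count_predT size_nseq iter_mulr_1.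
have := pd_mul pj (pd_comp 0 (col_mx 0 1%:M) (pa j)).
rewrite subnKC; last exact: ltnW.
move/pd_ext; apply=> x /=; rewrite !add0r mulrC; congr (_ ^+ _ * a j _).
  by rewrite /lin -colE !mxE; congr (x _ _); apply: val_inj.
by rewrite -{2}[x]hsubmxK mul_row_col mulmx0 add0r mulmx1.
Qed.

(** The leading form vanishes as a function, hence as a polynomial because k < q. In the induction,
    its value at (xi, v) is a polynomial in xi of degree at most k whose coefficients are the
    leading forms [T i v] of the slices. *)
Lemma pd_low n k (f : 'rV[F]_n -> F) : (k < q)%N -> pd k.+1 f -> low k f -> pd k f.
Proof.
elim: n k f => [|n IH] k f kq pf lf.
  case: k kq pf lf => [|k] kq pf lf.
    apply: pd_zero => x; case: (lf x 0) => P; rewrite leqn0 size_poly_eq0 => /eqP-> /(_ 0).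
    by rewrite scaler0 addr0 horner0.
  by apply: (pd_const _ (c := f 0)) => x; rewrite [x]thinmx0.
rewrite -[n.+1]/(1 + n)%N in f pf lf *.
case: (pd_slice pf) => a [pa ea].
have pa' (j : 'I_k.+1) : pd (k - j).+1 (a j) by have := pa j; rewrite subSn ?leq_ord.
case: (fin_all_exists (fun j : 'I_k.+1 => pd_line (pa' j))) => T HT.
have T0 (j : 'I_k.+1) v : T j v = 0.
  have /polyP/(_ (j : nat)) : \poly_(i < k.+1) T (inord i) v = 0.
    apply: poly_fun_eq0; first exact: leq_trans (size_poly _ _) _.
    move=> xi; rewrite horner_poly.
    have HT0 (i : 'I_k.+1) : exists P : {poly F}, (size P <= k - i)%N /\
        forall t, a i (0 + t *: v) = T i v * t ^+ (k - i) + P.[t].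
      by case: (HT i 0 v) => P sP eP; exists P.
    case: (fin_all_exists HT0) => P HP.
    case: (lf 0 (pt xi v)) => Q sQ eQ.
    have sS : (size (\sum_(i < k.+1) P i * (xi ^+ i *: 'X^i))%R <= k)%N.
      apply: (leq_trans (size_sum _ _ _)); apply/bigmax_leqP => i _.
      apply: leq_trans (size_polyMleq _ _) _.
      have := leq_trans (size_scale_leq (xi ^+ i) 'X^i) (eq_leq (size_polyXn _ _)).
      have [sP _] := HP i; have := ltn_ord i; lia.
    have : (\sum_(i < k.+1) T i v * xi ^+ i) *: 'X^k
      + (\sum_(i < k.+1) P i * (xi ^+ i *: 'X^i)) - Q = 0.
      apply: poly_fun_eq0.
        apply: leq_trans kq; apply: leq_trans (size_polyD _ _) _; rewrite geq_max.
        rewrite size_polyN (leq_trans sQ) // andbT.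
        apply: leq_trans (size_polyD _ _) _; rewrite geq_max (leqW sS) andbT.
        by apply: leq_trans (size_scale_leq _ _) _; rewrite size_polyXn.
      move=> t; rewrite !hornerE -eQ add0r ptZ ea !horner_sum.
      apply/eqP; rewrite subr_eq0 eq_sym; apply/eqP.
      rewrite mulr_suml -big_split /=; apply: eq_bigr => i _.
      have [_ /(_ t)] := HP i; rewrite add0r => ->.
      rewrite !hornerE exprMn.
      have -> : t ^+ k = t ^+ (k - i) * t ^+ i by rewrite -exprD subnK ?leq_ord.
      by rewrite /=; ring.
    move/polyP/(_ k); rewrite coefB coefD coefZ coefXn eqxx mulr1 coef0.
    rewrite (nth_default _ sS) (nth_default _ sQ) subr0 addr0 => H.
    by rewrite -[RHS]H; apply: eq_bigr => i _; rewrite inord_val.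
  by rewrite coef_poly coef0 ltn_ord inord_val.
have pa2 (j : 'I_k.+1) : pd (k - j) (a j).
  apply: IH => //; first exact: leq_ltn_trans (leq_subr _ _) kq.
  by move=> p v; case: (HT j p v) => P sP eP; exists P => // t; rewrite eP T0 mul0r add0r.
have ak y : a k y = 0 by have := pa2 ord_max; rewrite subnn => /pd_0.
apply: pd_ext (pd_unslice (a := a) _) _; last by move=> x;
  rewrite -{1}[x]pt_submx ea big_ord_recr /= ak mul0r addr0.
move=> j; case: (ltnP j k.+1) => jk; first exact: (pa2 (Ordinal jk)).
have := pa j; have -> : (k.+1 - j = 0)%N by lia.
by move/pd_0; apply: pd_zero.
Qed.

End Lines.

(** * Changes of coordinates, counting, division by an affine form *)

Section Coordinates.

Variable F : finFieldType.
Local Notation q := #|F|.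

Lemma row0_unit n (v : 'rV[F]_(1 + n)) : v != 0 ->
  exists2 M : 'M[F]_(1 + n), M \in unitmx & pt 1 0 *m M = v.
Proof.
move=> v0; have := mulmx_ebase v; rewrite [col_ebase v]mx11_scalar mul_scalar_mx.
have rv : \rank v = 1%N by rewrite rank_rV v0.
have : col_ebase v \in unitmx := col_ebase_unit v.
rewrite [col_ebase v]mx11_scalar unitmxE det_scalar1; set a := (col_ebase v) 0 0 => ua e.
exists (a *: row_ebase v); first by rewrite unitmxZ // row_ebase_unit.
rewrite -[RHS]e -scalemxAl -scalemxAr rv mxE eqxx mulr1n; congr (_ *: (_ *m _)).
apply/matrixP => i j; rewrite !mxE !ord1.
by case: splitP => k /= ->; rewrite ?mxE ?ord1 ?eqxx // andbF.
Qed.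

Lemma col0_unit n (w : 'cV[F]_(1 + n)) : w != 0 ->
  exists2 M : 'M[F]_(1 + n), M \in unitmx & forall t y, lin w (pt t y *m M) = t.
Proof.
move=> w0; have : w^T != 0 by rewrite trmx_eq0.
case/row0_unit=> M uM eM; exists (invmx M^T); first by rewrite unitmx_inv unitmx_tr.
move=> t y; rewrite linM -[w]trmxK -eM trmx_mul mulKmx ?unitmx_tr //.
by rewrite lin_pt /pt tr_row_mx col_mxKu col_mxKd trmx0 lin0l addr0 mxE mxE mul1r.
Qed.

Lemma sum_pt n (phi : 'rV[F]_(1 + n) -> nat) :
  (\sum_x phi x = \sum_t \sum_y phi (pt t y))%N.
Proof.
rewrite pair_big_dep /= (reindex (fun p : F * 'rV[F]_n => pt p.1 p.2)) //=.
exists (fun x => (lsubmx x 0 0, rsubmx x)) => [[t y] _|x _] /=.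
  by rewrite lsubmx_pt rsubmx_pt.
exact: pt_submx.
Qed.

Lemma sum_aff n (p : 'rV[F]_n) (M : 'M[F]_n) (phi : 'rV[F]_n -> nat) :
  M \in unitmx -> (\sum_x phi (p + x *m M)%R = \sum_x phi x)%N.
Proof.
move=> uM; rewrite [RHS](reindex (fun x => p + x *m M)) //=.
exists (fun x => (x - p) *m invmx M) => x _ /=.
  by rewrite addrC addKr mulmxK.
by rewrite mulmxKV // addrC subrK.
Qed.

Lemma card_set (T : finType) (P : pred T) : #|[set x | P x]| = (\sum_x P x)%N.
Proof. by rewrite cardsE -sum1_card [LHS]big_mkcond. Qed.

Lemma card_pt n (P : pred 'rV[F]_(1 + n)) (M : 'M[F]_(1 + n)) : M \in unitmx ->
  #|[set x | P x]| = (\sum_t #|[set y : 'rV_n | P (pt t y *m M)]|)%N.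
Proof.
move=> uM; rewrite card_set -(sum_aff 0 _ uM) sum_pt; apply: eq_bigr => t _.
by rewrite card_set; apply: eq_bigr => y _; rewrite add0r.
Qed.

Lemma card_aff n (P : pred 'rV[F]_n) (p : 'rV[F]_n) (M : 'M[F]_n) : M \in unitmx ->
  #|[set x | P (p + x *m M)]| = #|[set x | P x]|.
Proof. by move=> uM; rewrite !card_set (sum_aff p (fun x => P x : nat) uM). Qed.

Lemma card_rV n : #|{: 'rV[F]_n}| = (q ^ n)%N.
Proof. by rewrite card_mx mul1n. Qed.

Lemma card_slice n (w : 'cV[F]_(1 + n)) (M : 'M[F]_(1 + n)) c (P : pred 'rV[F]_(1 + n)) :
  M \in unitmx -> (forall t y, lin w (pt t y *m M) = t) ->
  #|[set x | (lin w x == c) && P x]| = #|[set y : 'rV_n | P (pt c y *m M)]|.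
Proof.
move=> uM wM; rewrite (card_pt _ uM) (bigD1 c) //= big1 ?addn0.
  by apply: eq_card => y; rewrite !inE wM eqxx.
by move=> t tc; apply: eq_card0 => y; rewrite !inE wM (negPf tc).
Qed.

Lemma card_lin n (w : 'cV[F]_(1 + n)) c : w != 0 -> #|[set x | lin w x == c]| = (q ^ n)%N.
Proof.
case/col0_unit=> M uM wM; rewrite -card_rV -cardsT.
rewrite (_ : [set x | _] = [set x | (lin w x == c) && predT x]) ?(card_slice _ _ uM wM) //.
by apply/setP => x; rewrite !inE andbT.
Qed.

Lemma card_lin2 n (w w' : 'cV[F]_(1 + (1 + n))) c c' :
  w != 0 -> (forall a, w' != a *: w) ->
  #|[set x | (lin w x == c) && (lin w' x == c')]| = (q ^ n)%N.
Proof.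
move=> w0 indep; case: (col0_unit w0) => M uM wM.
rewrite (card_slice c (fun x => lin w' x == c') uM wM).
set u := M *m w'; have d0 : dsubmx u != 0.
  apply: contraNneq (indep (usubmx u 0 0)) => du; apply/eqP.
  suff : forall x, lin w' x = lin (usubmx u 0 0 *: w) x.
    move=> H; apply/colP => i; have := H (delta_mx 0 i).
    by rewrite /lin -!rowE !mxE.
  move=> x; rewrite -[x](mulmxKV uM) -[x *m _]pt_submx linM lin_pt du lin0l addr0.
  by rewrite linZl wM.
rewrite -(card_lin (c' - usubmx u 0 0 * c) d0); apply: eq_card => y.
by rewrite !inE linM lin_pt -/u [RHS]eq_sym subr_eq eq_sym addrC.
Qed.

Lemma sum_card_lin n (w : 'cV[F]_n) (P : pred 'rV[F]_n) :
  #|[set x | P x]| = (\sum_c #|[set x | (lin w x == c) && P x]|)%N.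
Proof.
rewrite card_set (partition_big (lin w) predT) //=; apply: eq_bigr => c _.
rewrite card_set [LHS]big_mkcond; apply: eq_bigr => x _.
by case: (lin w x == c).
Qed.

(** In coordinates where the affine form is the first one, vanishing on the hyperplane says that the
    slice of exponent 0 is zero, and t can be divided out of the others. *)
Lemma pd_factor n k (f : 'rV[F]_(1 + n) -> F) w c : w != 0 -> pd k.+1 f ->
  (forall x, lin w x = c -> f x = 0) ->
  exists2 g, pd k g & forall x, f x = (lin w x - c) * g x.
Proof.
move=> w0 pf f0; case: (col0_unit w0) => M uM wM.
have ph := pd_comp (pt c 0 *m M) M pf.
case: (pd_slice ph) => a [pa ea].
have a0 y : a 0%N y = 0.
  have := ea 0 y; rewrite -mulmxDl ptD f0 ?wM ?addr0 // big_ord_recl mulr1 big1 ?addr0 //.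
  by move=> i _; rewrite expr0n mulr0.
have pg := pd_unslice (fun j => pa j.+1 : pd (k - j) _).
exists (fun x => \sum_(j < k) a j.+1 (rsubmx ((x - pt c 0 *m M) *m invmx M)) *
     lsubmx ((x - pt c 0 *m M) *m invmx M) 0 0 ^+ j).
  apply: pd_ext (pd_comp (- (pt c 0)) (invmx M) pg) _ => x /=.
  by rewrite mulmxBl mulmxK // addrC.
move=> x; set z := (x - _) *m _.
have ex : x = pt c 0 *m M + z *m M by rewrite mulmxKV // addrC subrK.
rewrite {1}ex -[z in f (_ + z *m M)]pt_submx ea big_ord_recl a0 mul0r add0r.
have -> : lin w x - c = lsubmx z 0 0.
  by rewrite ex linD wM -[z in lin w (z *m M)]pt_submx wM addrC addKr.
by rewrite mulr_sumr; apply: eq_bigr => j _; rewrite /bump /= exprS; ring.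
Qed.

(** The restriction equals the sum over lines transversal to the hyperplane, since only one point of
    each can carry a nonzero value; hence the gain of q - 1 in the degree. *)
Lemma pd_supp n k (f : 'rV[F]_(1 + n) -> F) w c (M : 'M[F]_(1 + n)) :
  (forall t y, lin w (pt t y *m M) = t) -> pd k f ->
  (forall x, lin w x != c -> f x = 0) -> pd (k - q.-1) (fun y => f (pt c y *m M)).
Proof.
move=> wM pf f0; apply: pd_ext (pd_push (pd_comp 0 M pf)) _ => y.
rewrite (bigD1 c) //= big1 ?addr0 ?add0r // => t tc.
by rewrite add0r f0 ?wM.
Qed.

Lemma pd_restr n k (f : 'rV[F]_(1 + n) -> F) c (M : 'M[F]_(1 + n)) :
  pd k f -> pd k (fun y => f (pt c y *m M)).
Proof.
move=> pf; apply: pd_ext (pd_comp (pt c 0 *m M) (row_mx 0 1%:M *m M) pf) _ => y.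
by rewrite mulmxA mul_mx_row mulmx1 mulmx0 -mulmxDl /pt add_row_mx add0r addr0.
Qed.

End Coordinates.

(** * Weights and minimum distance *)

Section MinimumDistance.

Variable F : finFieldType.
Local Notation q := #|F|.

Definition zset n (f : 'rV[F]_n -> F) : {set 'rV[F]_n} := [set x | f x == 0].
Definition supp n (f : 'rV[F]_n -> F) : {set 'rV[F]_n} := [set x | f x != 0].

Lemma q_gt1 : (1 < q)%N.
Proof. by rewrite (cardD1 0) (cardD1 1) !inE oner_neq0. Qed.

Lemma card_zset_supp n (f : 'rV[F]_n -> F) : (#|zset f| + #|supp f| = q ^ n)%N.
Proof.
rewrite -card_rV -(cardC (mem (zset f))); congr (_ + _)%N.
by apply: eq_card => x; rewrite !inE.
Qed.

Lemma card_roots (P : {poly F}) : P != 0 -> (#|[set t | (P.[t] == 0)%R]| <= (size P).-1)%N.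
Proof.
move=> P0; have : (size (enum [set t | (P.[t] == 0)%R]) < size P)%N.
  apply: max_poly_roots P0 _ (enum_uniq _).
  by apply/allP => t; rewrite mem_enum inE rootE.
by rewrite -cardE; lia.
Qed.

Lemma card_pt_supp n (f : 'rV[F]_(1 + n) -> F) :
  #|supp f| = (\sum_(y : 'rV_n) #|[set t | (f (pt t y) != 0)%R]|)%N.
Proof.
rewrite card_set sum_pt exchange_big /=; apply: eq_bigr => y _.
by rewrite card_set.
Qed.

(** Let j be the largest index of a slice that is not identically zero. This slice has degree at
    most s - j, and where it is nonzero [f] has at most j zeros on the line above. The two bounds
    combine by (q - j)(q - s + j) = (q - s) q + j (s - j). *)
Lemma schwartz_zippel n s (f : 'rV[F]_n -> F) x0 : f x0 != 0 -> pd s.+1 f ->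
  ((q - s) * q ^ n <= q * #|supp f|)%N.
Proof.
elim: n s f x0 => [|n IH] s f x0 fx0 pf.
  rewrite expn0 muln1; apply: leq_trans (leq_subr _ _) _; rewrite leq_pmulr //.
  by apply/card_gt0P; exists x0; rewrite inE.
case: (leqP q s) => [/eqP->|sq]; first by rewrite mul0n.
rewrite -[n.+1]/(1 + n)%N in f x0 fx0 pf *.
case: (pd_slice pf) => a [pa ea].
pose nza j := [exists y, a j y != 0].
have bnd j : nza j -> (j <= s)%N.
  case/existsP=> y; rewrite leqNgt; apply: contra => sj.
  by have := pa j; rewrite (eqP (sj : s.+1 - j == 0)%N) => /pd_0->.
have ex : exists j, nza j.
  have [|] := boolP [exists j : 'I_s.+1, nza j]; first by case/existsP=> j; exists j.
  move/existsPn=> H; case/eqP: fx0; rewrite -[x0]pt_submx ea big1 // => j _.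
  by have := H j => /existsPn/(_ (rsubmx x0)); rewrite negbK => /eqP->; rewrite mul0r.
case: (ex_maxnP ex bnd) => j /[dup] /bnd js /existsP[y0 ay0] jmax.
have paj : pd (s - j).+1 (a j) by have := pa j; rewrite subSn.
have := IH _ _ _ ay0 paj => HA.
have HB : (#|supp (a j)| * (q - j) <= #|supp f|)%N.
  rewrite card_pt_supp -sum_nat_const big_mkcond /=; apply: leq_sum => y _.
  rewrite inE; case: ifP => // ay.
  pose P := \poly_(i < j.+1) a i y.
  have eP t : f (pt t y) = P.[t].
    rewrite ea horner_poly [RHS](big_ord_widen _ (fun i => a i y * t ^+ i) (_ : j.+1 <= s.+1)%N) //.
    rewrite [RHS]big_mkcond; apply: eq_bigr => i _ /=; case: ltnP => // ij.
    suff /eqP-> : a i y == 0 by rewrite mul0r.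
    by apply: contraLR ij => ai; rewrite -ltnNge ltnS jmax //; apply/existsP; exists y.
  have P0 : P != 0 by apply: contraNneq ay => /polyP/(_ j); rewrite coef_poly ltnSn coef0 => ->.
  have := card_roots P0; have : (size P <= j.+1)%N := size_poly _ _.
  have : (#|[set t | (P.[t] == 0)%R]| + #|~: [set t | (P.[t] == 0)%R]| = q)%N by rewrite cardsC.
  have -> : [set t | f (pt t y) != 0] = ~: [set t | P.[t] == 0].
    by apply/setP => t; rewrite !inE eP.
  move=> <- sP r; rewrite leq_subLR leq_add2r; apply: leq_trans r _.
  by case: (size P) sP.
rewrite expnS; set X := (q ^ n)%N in HA *; move: HA HB; set A := #|supp (a j)|.
set B := #|supp f| => HA HB.
have H1 : ((q - j) * ((q - (s - j)) * X) <= (q - j) * (q * A))%N by rewrite leq_mul2l HA orbT.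
have H2 : (q * (A * (q - j)) <= q * B)%N by rewrite leq_mul2l HB orbT.
have H3 : ((q - s) * q <= (q - j) * (q - (s - j)))%N.
  have [d ed] : exists d, s = (j + d)%N by exists (s - j)%N; rewrite subnKC.
  have [e ee] : exists e, q = (j + d + e)%N by exists (q - s)%N; rewrite -ed subnKC // ltnW.
  rewrite ed ee; have -> : (j + d + e - (j + d) = e)%N by lia.
  have -> : (j + d + e - j = d + e)%N by lia.
  have -> : (j + d + e - (j + d - j) = j + e)%N by lia.
  nia.
rewrite mulnA; apply: leq_trans (_ : (q - j) * (q - (s - j)) * X <= _)%N.
  by rewrite leq_mul2r H3 orbT.
rewrite -mulnA; apply: leq_trans H1 (leq_trans _ H2).
by rewrite mulnC -mulnA.
Qed.

Lemma zero_bound n s (f : 'rV[F]_n -> F) x0 : f x0 != 0 -> pd s.+1 f ->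
  (q * #|zset f| <= s * q ^ n)%N.
Proof.
move=> fx0 pf; have := schwartz_zippel fx0 pf; have := card_zset_supp f.
move=> <-; rewrite mulnBl; set A := #|zset f|; set B := #|supp f|.
by rewrite leq_subLR mulnDr leq_add2r.
Qed.

(** Otherwise every direction would be 0 or a multiple of some z - x with z in [S], but there are at
    most (q - 1)(q^n - 1) + 1 < q^(n+1) such vectors. *)
Lemma tangent n (S : {set 'rV[F]_(1 + n)}) x : x \in S -> (#|S| <= q ^ n)%N ->
  exists2 v, v != 0 & forall c, c != 0 -> x + c *: v \notin S.
Proof.
move=> xS cS.
pose B := [set p.1 *: (p.2 - x) | p in setX [set~ (0 : F)] (S :\ x)] :|: [set 0].
have cB : (#|B| < q ^ n.+1)%N.
  apply: leq_ltn_trans (leq_card_setU _ _) _; rewrite cards1.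
  have := leq_imset_card (fun p : F * 'rV[F]_(1 + n) => p.1 *: (p.2 - x)) (setX [set~ 0] (S :\ x)).
  rewrite cardsX cardsC1 => H; apply: leq_ltn_trans (leq_add H (leqnn 1)) _.
  have := cardsD1 x S; rewrite xS expnS; have := q_gt1; move: cS.
  move: #|_ :\ _| (q ^ n)%N => c X; case: #|F| => // k; nia.
have [v vB] : exists v, v \notin B.
  apply/existsP; rewrite -negb_forall; apply: contraL cB => /forallP H.
  rewrite -leqNgt -card_rV -cardsT; apply: subset_leq_card; apply/subsetP => v _; exact: H.
exists v; first by apply: contraNneq vB => ->; rewrite !inE eqxx orbT.
move=> c c0; apply: contra vB => xcv; rewrite inE; apply/orP.
have [->|v0] := eqVneq v 0; first by right; rewrite inE.
left; apply/imsetP; exists (c^-1, x + c *: v); last first.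
  by rewrite /= addrC addKr scalerA mulVf ?scale1r.
rewrite !inE /= invr_eq0 c0 xcv andbT -subr_eq0 addrC addKr.
by rewrite scaler_eq0 negb_or c0.
Qed.

Definition push n (h : 'rV[F]_(1 + n) -> F) (y : 'rV[F]_n) := \sum_t h (pt t y).

Lemma push_supp n (h : 'rV[F]_(1 + n) -> F) : (#|supp (push h)| <= #|supp h|)%N.
Proof.
rewrite card_pt_supp -sum1_card big_mkcond /=; apply: leq_sum => y _.
rewrite inE; case: ifP => // hy; rewrite card_gt0; apply: contraNneq hy => h0.
apply/eqP; apply: big1 => t _; apply/eqP; have : t \notin set0 by rewrite inE.
by rewrite -h0 inE negbK.
Qed.

Lemma card_supp_aff n (f : 'rV[F]_n -> F) p (M : 'M[F]_n) : M \in unitmx ->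
  #|supp (fun x => f (p + x *m M))| = #|supp f|.
Proof. exact: card_aff. Qed.

Lemma tangent_push n (f : 'rV[F]_(1 + n) -> F) x : f x != 0 -> (#|supp f| <= q ^ n)%N ->
  exists2 M : 'M[F]_(1 + n), M \in unitmx &
    push (fun z => f (x + z *m M)) 0 = f x.
Proof.
move=> fx cf; have xS : x \in supp f by rewrite inE.
case: (tangent xS cf) => v v0 vS; case: (row0_unit v0) => M uM eM; exists M => //.
rewrite /push (bigD1 0) //= big1 ?addr0 => [|t t0].
  by have -> : pt 0 0 = 0 :> 'rV[F]_(1 + n); rewrite ?mul0mx ?addr0 // /pt raddf0 row_mx0.
have := vS t t0; rewrite inE negbK -eM scalemxAl ptZ mulr1 scaler0 => /eqP; exact.
Qed.

(** The minimum weight (q - s) q^(k-1), multiplied by q. Summation along a tangent direction lowers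
    t by one and does not enlarge the support; where no tangent direction is guaranteed, the support
    is large enough anyway. *)
Lemma min_distance t k s (f : 'rV[F]_(t + k) -> F) x : f x != 0 ->
  pd (t * q.-1 + s).+1 f -> ((q - s) * q ^ k <= q * #|supp f|)%N.
Proof.
elim: t f x => [|t IH] f x fx pf; first exact: schwartz_zippel fx pf.
case: (leqP #|supp f| (q ^ (t + k))) => cf; last first.
  apply: leq_mul; first exact: leq_subr.
  apply: leq_trans (ltnW cf); rewrite leq_exp2l ?q_gt1 //; exact: leq_addl.
case: (tangent_push fx cf) => M uM e.
rewrite -(card_supp_aff f x uM); set h := fun z => f _ in e *.
apply: leq_trans (_ : q * #|supp (push h)| <= _)%N; last by rewrite leq_mul2l push_supp orbT.
apply: (IH _ 0); first by rewrite e.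
have := pd_push (pd_comp x M pf); apply: pd_le.
by rewrite mulSn -addnA -addnS addKn.
Qed.

End MinimumDistance.

(** * Minimum weight words for t = 0 *)

Section MinimumWeight.

Variable F : finFieldType.
Local Notation q := #|F|.

Lemma lin_surj n (w : 'cV[F]_n) c : w != 0 -> exists x, lin w x = c.
Proof.
case/cV0Pn=> i wi; exists ((c / w i 0) *: delta_mx 0 i).
by rewrite linZ /lin -rowE mxE divfK.
Qed.

Lemma lin_surj2 n (w w' : 'cV[F]_n) c c' : w != 0 -> (forall a, w' != a *: w) ->
  exists x, lin w x = c /\ lin w' x = c'.
Proof.
case: n w w' => [|n] w w' w0 indep.
  by move: w0; rewrite [w]flatmx0 eqxx.
rewrite -[n.+1]/(1 + n)%N in w w' w0 indep *.
case: (col0_unit w0) => M uM wM.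
set u := M *m w'; have d0 : dsubmx u != 0.
  apply: contraNneq (indep (usubmx u 0 0)) => du; apply/eqP.
  suff : forall x, lin w' x = lin (usubmx u 0 0 *: w) x.
    move=> H; apply/colP => i; have := H (delta_mx 0 i).
    by rewrite /lin -!rowE !mxE.
  move=> x; rewrite -[x](mulmxKV uM) -[x *m _]pt_submx linM lin_pt du lin0l addr0.
  by rewrite linZl wM.
case: (lin_surj (c' - usubmx u 0 0 * c) d0) => y ey.
exists (pt c y *m M); split; first exact: wM.
by rewrite linM lin_pt ey addrC subrK.
Qed.

Lemma card_lin_dual n (x : 'rV[F]_(1 + n)) : x != 0 ->
  #|[set w : 'cV_(1 + n) | lin w x == 0]| = (q ^ n)%N.
Proof.
rewrite -trmx_eq0 => x0; rewrite -(card_lin 0 x0) -(card_imset _ (@trmx_inj _ _ _)).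
apply: eq_card => y; rewrite inE; apply/imsetP/idP => [[w]|].
  by rewrite inE => /eqP e ->; rewrite /lin -trmx_mul mxE; apply/eqP.
move=> e; exists y^T; last by rewrite trmxK.
by rewrite inE; move: e; rewrite /lin -[x]trmxK -trmx_mul [X in _ -> X == _]mxE trmxK.
Qed.

(** A point x other than [a] is counted by the q^n forms that kill x - a, and [a] by all q^(n+1)
    forms. The zero form is included and counts all of [Z]. *)
Lemma sum_all_lin n (Z : {set 'rV[F]_(1 + n)}) a :
  (\sum_(w : 'cV[F]_(1 + n)) #|[set x | (lin w x == lin w a) && (x \in Z)]|
   = q ^ n * #|Z| + (q ^ n.+1 - q ^ n) * (a \in Z))%N.
Proof.
under eq_bigr do rewrite card_set.
rewrite exchange_big /= (eq_bigr (fun x => ((x \in Z) * q ^ n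
   + (x == a) * ((q ^ n.+1 - q ^ n) * (a \in Z)))%N)); last first.
  move=> x _; have [xZ|xZ] := boolP (x \in Z); last first.
    rewrite big1 => [|w _]; last by rewrite andbF.
    by case: eqP => // <-; rewrite (negPf xZ) muln0.
  under eq_bigr do rewrite andbT -subr_eq0 -linB.
  rewrite mul1n -card_set; have [ea|xa] := eqVneq x a.
    rewrite mul1n -ea xZ muln1 subnKC; last by rewrite leq_exp2l ?q_gt1.
    rewrite (_ : [set w | _] = setT) ?cardsT ?card_mx ?muln1 //.
    by apply/setP => w; rewrite !inE subrr lin0 eqxx.
  by rewrite addn0 card_lin_dual // subr_eq0.
rewrite big_split /= -!big_distrl /=; congr (_ + _)%N.
  by rewrite mulnC -card_set; congr (_ * _)%N; apply: eq_card => x; rewrite inE.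
by rewrite (bigD1 a) //= eqxx big1 ?mul1n // => x /negPf->.
Qed.

Lemma sum_eq_all (I : finType) (a b : I -> nat) : (forall i, a i <= b i)%N ->
  (\sum_i b i <= \sum_i a i)%N -> forall i, a i = b i.
Proof.
move=> ab s i; have := leqif_sum (fun i (_ : predT i) => leqif_eq (ab i)).
case=> le; rewrite eqn_leq le s => /esym/forallP/(_ i)/eqP //.
Qed.

Lemma section_zeros n s (f : 'rV[F]_(1 + n) -> F) w c x0 : w != 0 -> pd s.+1 f ->
  lin w x0 = c -> f x0 != 0 ->
  (q * #|[set x | (lin w x == c) && (f x == 0)%R]| <= s * q ^ n)%N.
Proof.
move=> w0 pf wx0 fx0; case: (col0_unit w0) => M uM wM.
rewrite (card_slice c (fun x => f x == 0) uM wM).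
apply: (@zero_bound _ n s _ (rsubmx (x0 *m invmx M))); last exact: pd_restr pf.
suff -> : pt c (rsubmx (x0 *m invmx M)) = x0 *m invmx M by rewrite mulmxKV.
rewrite -[RHS]pt_submx; congr pt.
by rewrite -wx0 -{1}[x0](mulmxKV uM) -{1}[x0 *m _]pt_submx wM.
Qed.

(** If no hyperplane consists of zeros, every section has at most, hence exactly, one q-th of the
    zeros. Counting over all hyperplanes through one zero then gives q^(n+1) zeros, against s <
    q. *)
Lemma min_word_hyperplane n s (f : 'rV[F]_(1 + n) -> F) : (0 < s < q)%N ->
  pd s.+1 f -> (#|zset f| = s * q ^ n)%N ->
  exists w c, w != 0 /\ forall x, lin w x = c -> f x = 0.
Proof.
case/andP=> s0 sq pf cZ.
have [/existsP[w /andP[w0 /existsP[c /forallP H]]]|] :=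
  boolP [exists w : 'cV[F]_(1 + n), (w != 0) && [exists c, forall x, (lin w x == c) ==> (f x ==
    0)]].
  by exists w, c; split=> // x /eqP e; apply/eqP; have := H x; rewrite e.
rewrite negb_exists => /forallP H; exfalso.
have sec w c : w != 0 -> (q * #|[set x | (lin w x == c) && (x \in zset f)]| <= #|zset f|)%N.
  move=> w0; have := H w; rewrite w0 /= => /existsPn/(_ c)/forallPn[x].
  rewrite negb_imply => /andP[/eqP wx fx].
  have := section_zeros w0 pf wx fx; rewrite cZ; congr (_ * _ <= _)%N.
  by apply: eq_card => y; rewrite !inE.
have sec' w : w != 0 -> forall c, (q * #|[set x | (lin w x == c) && (x \in zset f)]| = #|zset f|)%N.
  move=> w0; apply: sum_eq_all => [c|]; first exact: sec.
  rewrite -big_distrr /= -sum_card_lin sum_nat_const; apply/eq_leq; congr (_ * _)%N.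
  by apply: eq_card => x; rewrite !inE.
have /card_gt0P[a aZ] : (0 < #|zset f|)%N by rewrite cZ muln_gt0 s0 expn_gt0 (ltnW (q_gt1 F)).
have := sum_all_lin (zset f) a; rewrite aZ muln1 (bigD1 0) //= => E.
have : (q * (q ^ n * #|zset f| + (q ^ n.+1 - q ^ n)) = q * #|zset f| + (q ^ n.+1).-1 * #|zset f|)%N.
  rewrite -E mulnDr; congr (_ * _ + _)%N.
    by apply: eq_card => x; rewrite !inE !lin0l eqxx.
  rewrite big_distrr /= (eq_bigr (fun=> #|zset f|)) ?sum_nat_const; last by move=> w w0;
    apply: sec'.
  congr (_ * _)%N; rewrite cardC1 card_mx muln1; reflexivity.
have := q_gt1 F; rewrite cZ expnS; move: sq s0; move: (q ^ n)%N (expn_gt0 q n).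
case: #|F| => // k X; rewrite orTb => X0 sq s0 k0.
have -> : (k.+1 * X - X = k * X)%N by rewrite mulSn addKn.
have : ((k.+1 * X).-1 * (s * X) + s * X = k.+1 * X * (s * X))%N.
  by rewrite -mulSnr prednK // muln_gt0.
move: (_.-1 * _)%N => Y eY e.
have : (k.+1 * (k * X) = k * (s * X))%N by nia.
by rewrite mulnCA => /eqP; rewrite eqn_pmul2l // eqn_pmul2r //; lia.
Qed.

(** After division by a hyperplane of zeros the cofactor is again a minimum word and, by counting,
    has no zero on that hyperplane; so its own hyperplanes of zeros are parallel to it. *)
Lemma min_word n s (f : 'rV[F]_(1 + n) -> F) : (s < q)%N ->
  pd s.+1 f -> (#|zset f| = s * q ^ n)%N ->
  exists w (C : {set F}), [/\ w != 0, #|C| = s & forall x, (f x == 0) = (lin w x \in C)].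
Proof.
elim: s f => [|s IH] f sq pf cZ.
  exists (delta_mx 0 0), set0; split; rewrite ?cards0 //.
    by apply/cV0Pn; exists 0; rewrite !mxE !eqxx oner_neq0.
  move=> x; rewrite inE; apply/negbTE; have/eqP := cZ; rewrite mul0n cards_eq0 => /eqP Z0.
  by apply/negP => fx; have : x \in zset f by [rewrite inE]; rewrite Z0 inE.
case: (min_word_hyperplane (_ : 0 < s.+1 < q)%N pf cZ) => // w [c [w0 fH]].
case: (pd_factor w0 pf fH) => g pg fg.
have q0 : (0 < q)%N := ltnW (q_gt1 F).
have [x0 fx0] : exists x0, f x0 != 0.
  apply/existsP; rewrite -negb_forall; apply/negP => /forallP H.
  have /eqP : #|zset f| = (q ^ n.+1)%N.
    by rewrite -card_rV -cardsT; apply: eq_card => x; rewrite !inE H.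
  by rewrite cZ expnS eqn_pmul2r ?expn_gt0 ?q0 //; lia.
have gx0 : g x0 != 0 by apply: contraNneq fx0 => e; rewrite fg e mulr0.
have cg : (#|zset g| <= s * q ^ n)%N.
  by rewrite -(leq_pmul2l q0) mulnCA -expnS; apply: zero_bound gx0 pg.
have fZ x : (f x == 0) = (lin w x == c) || (g x == 0).
  by rewrite fg mulf_eq0 subr_eq0.
have eZ : zset f = [set x | lin w x == c] :|: (zset g).
  by apply/setP => x; rewrite !inE fZ.
have := cardsUI [set x | lin w x == c] (zset g).
rewrite -eZ cZ card_lin // mulSn -addnA => /addnI e.
have cg' : #|zset g| = (s * q ^ n)%N by apply/eqP; rewrite eqn_leq cg -e leq_addr.
have I0 : [set x | lin w x == c] :&: zset g = set0.
  by apply/eqP; rewrite -cards_eq0; apply/eqP; move: e; rewrite cg'; lia.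
case: (IH g (ltnW sq) pg cg') => w' [C [w'0 cC gC]].
(* For empty [C] the form [w'] is arbitrary, and [w] replaces it. *)
have [C0|/set0Pn[c' c'C]] := eqVneq C set0.
  exists w, [set c]; split=> //; first by rewrite cards1 -cC C0 cards0.
  by move=> x; rewrite fZ gC C0 !inE orbF.
have [a ea] : exists a, w' = a *: w.
  case: (pickP (fun a => w' == a *: w)) => [a /eqP|/(_ _)/negbT ind]; first by exists a.
  case: (lin_surj2 c c' w0 ind) => x [e1 e2].
  have : x \in [set x | lin w x == c] :&: zset g by rewrite !inE e1 eqxx gC e2.
  by rewrite I0 inE.
have a0 : a != 0 by apply: contraNneq w'0 => a0; rewrite ea a0 scale0r.
exists w, (c |: [set x | a * x \in C]); split=> //; last first.
  by move=> x; rewrite fZ gC ea linZl !inE.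
have -> : [set x | a * x \in C] = [set a^-1 * x | x in C].
  apply/setP => x; rewrite inE; apply/idP/imsetP => [H|[y yC ->]].
    by exists (a * x) => //; rewrite mulKf.
  by rewrite mulVKf.
rewrite cardsU1 card_imset ?cC; last by apply: mulfI; rewrite invr_eq0.
case: (lin_surj c w0) => x ex; suff -> : c \notin [set a^-1 * x0 | x0 in C] by [].
apply/negP => /imsetP[y yC ey]; have : x \in [set x | lin w x == c] :&: zset g.
  by rewrite !inE ex eqxx gC ea linZl ex ey mulVKf.
by rewrite I0 inE.
Qed.

End MinimumWeight.

(** * Zero hyperplanes of second weight words *)

Section SecondWeight.

Variable F : finFieldType.
Local Notation q := #|F|.

Lemma card_roots_split (P : {poly F}) s : size P = s.+1 -> P %| 'X^q - 'X ->
  #|[set t | P.[t] == 0]| = s.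
Proof.
move=> sP; rewrite finField_genPoly -big_enum /= => /dvdp_prod_XsubC[m eP].
have sm : size (mask m (enum F)) = s.
  by apply: succn_inj; rewrite -sP (eqp_size eP) size_prod_XsubC.
rewrite -sm -(card_uniqP _) ?mask_uniq ?enum_uniq //.
apply: eq_card => t; rewrite inE -rootE (eqp_root eP).
by rewrite root_prod_XsubC.
Qed.

(* The remainder of X^k modulo f(X, y) has total degree at most k. For k = q, the
   values y with s roots are those where it equals X, hence zeros of a fixed polynomial
   of known degree. *)
Lemma Xn_mod_monic n s (a : nat -> 'rV[F]_n -> F) (c : F) k : (0 < s)%N -> c != 0 ->
  (forall j, pd (s.+1 - j) (a j)) -> (forall y, a s y = c) ->
  exists r : nat -> 'rV[F]_n -> F, (forall j, pd (k.+1 - j) (r j)) /\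
    forall y, \poly_(j < s.+1) a j y %| 'X^k - \poly_(j < s) r j y.
Proof.
move=> s0 c0 pa ac; elim: k => [|k [r [pr dr]]].
  exists (fun j _ => (j == 0%N)%:R); split=> [[|j]|y].
  - exact: (pd_const 0 (c := 1)).
  - exact: pd_zero.
  suff -> : 'X^0 - \poly_(j < s) ((j == 0%N)%:R : F) = 0 by rewrite dvdp0.
  apply/polyP => j; rewrite coefB coef_poly expr0 coef1 coef0.
  by case: j => [|j]; rewrite ?s0 ?subrr //; case: ifP; rewrite subrr.
exists (fun j y => (if j is j'.+1 then r j' y else 0) + - c^-1 * (a j y * r s.-1 y)); split.
  move=> j; apply: (pd_add (f := fun y => if j is j'.+1 then r j' y else 0)
     (g := fun y => - c^-1 * (a j y * r s.-1 y))) => //.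
    by case: j => [|j]; [apply: pd_zero|rewrite subSS].
  apply: pd_scale; case: (leqP j s) => js; last first.
    have := pa j; rewrite (eqP (js : s.+1 - j == 0)%N) => /pd_0 a0.
    by apply: pd_zero => y; rewrite a0 mul0r.
  have ej : (s.+1 - j = (s - j).+1)%N by lia.
  have := pa j; rewrite ej => paj.
  have := pd_mul paj (pr s.-1).
  case: (leqP s k.+1) => sk; first by apply: pd_le; lia.
  have := pr s.-1; have -> : (k.+1 - s.-1 = 0)%N by lia.
  by move=> /pd_0 r0 _; apply: pd_zero => y; rewrite r0 mulr0.
move=> y; set P := \poly_(j < s.+1) _.
have -> : 'X^(k.+1) - \poly_(j < s)
    ((if j is j'.+1 then r j' y else 0) + - c^-1 * (a j y * r s.-1 y)) =
  'X * ('X^k - \poly_(j < s) r j y) + (c^-1 * r s.-1 y) *: P.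
  apply/polyP => j; rewrite coefB coefD coefZ coefXM coefB !coefXn !coef_poly.
  case: j => [|j] /=; first by rewrite s0 /=; ring.
  rewrite eqSS ltnS; case: (ltngtP j.+1 s) => js.
  - by ring.
  - by ring.
  - by rewrite js ac -js /=; field.
apply: dvdp_add; first by apply: dvdp_mull; apply: dr.
by rewrite -mul_polyC dvdp_mull.
Qed.

Section Monic.

Variables (n s : nat) (f : 'rV[F]_(1 + (1 + n)) -> F).
Variables (a : nat -> 'rV[F]_(1 + n) -> F) (c : F).
Hypotheses (s0 : (0 < s)%N) (sq : (s < q)%N) (c0 : c != 0).
Hypotheses (pa : forall j, pd (s.+1 - j) (a j)) (ac : forall y, a s y = c).
Hypothesis (ea : forall t y, f (pt t y) = \sum_(j < s.+1) a j y * t ^+ j).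

Let P y := \poly_(j < s.+1) a j y.
Let N y := #|[set t | f (pt t y) == 0]|.

Let NP y : N y = #|[set t | (P y).[t] == 0]|.
Proof. by apply: eq_card => t; rewrite !inE ea horner_poly. Qed.

Let sP y : size (P y) = s.+1.
Proof. by apply: size_poly_eq; rewrite ac. Qed.

Let Ns y : (N y <= s)%N.
Proof.
rewrite NP; apply: leq_trans (card_roots _) _; first by rewrite -size_poly_eq0 sP.
by rewrite sP.
Qed.

(** The first alternative is the case where every [P y] divides X^q - X. Otherwise the loss of zeros
    is measured on the highest coefficient [r j] of the remainder that is not identically zero. *)
Lemma monic_zeros :
  (forall y, N y = s) \/
  ((\sum_y N y + s.-1 * q ^ n <= s * q ^ n.+1)%N /\
   ((\sum_y N y + s.-1 * q ^ n = s * q ^ n.+1)%N -> (1 < s)%N ->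
    exists w (C : {set F}) j, [/\ w != 0, j = 1%N \/ j = s.-1, #|C| = j &
      forall y, N y = if lin w y \in C then j else s])).
Proof.
have q0 : (0 < q)%N := ltnW (q_gt1 F).
case: (Xn_mod_monic q s0 c0 pa ac) => r1 [pr1 dr1].
(* For s = 1 the monomial X is not reduced modulo [P y], so its remainder is needed too. *)
case: (Xn_mod_monic 1 s0 c0 pa ac) => r2 [pr2 dr2].
pose r j y := r1 j y - r2 j y.
have pr j : pd (q.+1 - j) (r j).
  apply: (pd_add (pr1 j) (pd_scale (-1) (pd_le _ (pr2 j)))) => [|y]; first lia.
  by rewrite mulN1r.
have dr y : P y %| ('X^q - 'X) - \poly_(j < s) r j y.
  have := dvdp_sub (dr1 y) (dr2 y); congr (_ %| _).
  apply/polyP => j; rewrite !(coefB, coef_poly, coefXn, coefX).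
  by case: ifP => _; rewrite /r ?subr0; ring.
pose nz j := (j < s)%N && [exists y, r j y != 0].
have r0N y : (forall j, (j < s)%N -> r j y = 0) -> N y = s.
  move=> r0; rewrite NP; apply: card_roots_split; first exact: sP.
  have := dr y; suff -> : \poly_(j < s) r j y = 0 by rewrite subr0.
  by apply/polyP => j; rewrite coef_poly coef0; case: ifP => // /r0.
case: (boolP [exists j : 'I_s, nz j]) => [|/existsPn H]; last first.
  left=> y; apply: r0N => j js; have := H (Ordinal js).
  by rewrite /nz js /= => /existsPn/(_ y); rewrite negbK => /eqP.
case/existsP=> j0 nzj0; right.
have bnd j : nz j -> (j <= s)%N by case/andP=> /ltnW.
case: (ex_maxnP (ex_intro _ (j0 : nat) nzj0) bnd) => j /andP[js /existsP[y0 ry0]] jmax.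
have rtop y i : (j < i < s)%N -> r i y = 0.
  case/andP=> ji is_; apply/eqP; apply: contraLR ji => ri; rewrite -leqNgt jmax //.
  by rewrite /nz is_; apply/existsP; exists y.
(* All elements of F are roots of X^q - X, so the roots of [P y] are roots of the remainder, which
   has degree j here. *)
have Nj y : r j y != 0 -> (N y <= j)%N.
  move=> ry; pose R := \poly_(i < j.+1) r i y.
  have eR : \poly_(i < s) r i y = R.
    apply/polyP => i; rewrite !coef_poly ltnS; case: (ltnP i s) => is_; case: (leqP i j) => ij //.
      by rewrite rtop ?ij.
    by have := leq_ltn_trans ij js; rewrite ltnNge is_.
  have R0 : R != 0 by apply: contraNneq ry => /polyP/(_ j); rewrite coef_poly ltnSn coef0 => ->.
  rewrite NP; apply: leq_trans (_ : #|[set t | (R.[t] == 0)%R]| <= _)%N.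
    apply: subset_leq_card; apply/subsetP => t; rewrite !inE => Pt.
    have := dr y; rewrite eR => /dvdpP[Q]/(congr1 (horner^~ t)).
    rewrite !hornerE (eqP Pt) mulr0 expf_card subrr sub0r => /eqP.
    by rewrite oppr_eq0.
  apply: leq_trans (card_roots R0) _; have : (size R <= j.+1)%N := size_poly _ _.
  by case: (size R).
have cD : (#|supp (r j)| <= q ^ n.+1)%N by rewrite -card_rV max_card.
have sumN : (\sum_y N y + (s - j) * #|supp (r j)| <= s * q ^ n.+1)%N.
  rewrite mulnC -sum_nat_const [X in (_ + X)%N]big_mkcond -big_split /= mulnC.
  rewrite -card_rV -sum_nat_const; apply: leq_sum => y _; rewrite inE.
  by case: ifP => [/Nj|_]; [lia|rewrite addn0].
(* For j = 0 the degree bound is q = (q - 1) + 1, out of reach of [schwartz_zippel]; [min_distance]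
   with t = s = 1 gives a strict inequality. *)
have [j00|jpos] := posnP j.
  have D1 : (q.-1 * q ^ n <= q * #|supp (r j)|)%N.
    rewrite -subn1; apply: (@min_distance _ 1 n 1 (r j) y0) => //.
    by have := pr j; rewrite j00; apply: pd_le; lia.
  have lt : (\sum_y N y + s.-1 * q ^ n < s * q ^ n.+1)%N.
    apply: leq_trans sumN; rewrite ltn_add2l j00 subn0 -(ltn_pmul2l q0).
    apply: leq_trans (_ : s * (q.-1 * q ^ n) <= _)%N; last first.
      by rewrite [leqRHS]mulnCA leq_mul2l; move: D1; rewrite j00 => ->; rewrite orbT.
    by rewrite !mulnA ltn_pmul2r ?expn_gt0 ?q0 //; nia.
  by split=> [|e]; [apply: ltnW|move: lt; rewrite e ltnn].
have D1 : (j * q ^ n <= #|supp (r j)|)%N.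
  rewrite -(leq_pmul2l q0) mulnCA -expnS.
  have : (q - (q - j) = j)%N by rewrite subKn // ltnW // (ltn_trans js).
  move=> {1}<-; apply: (schwartz_zippel ry0); apply: pd_le (pr j).
  by rewrite subSn // ltnW // (ltn_trans js).
have H1 : (s.-1 <= (s - j) * j)%N.
  have [d ed] : exists d, s = (j + d.+1)%N by exists (s - j).-1; lia.
  by rewrite ed (_ : j + d.+1 - j = d.+1)%N; [nia|lia].
have H2 : (s.-1 * q ^ n <= (s - j) * #|supp (r j)|)%N.
  apply: leq_trans (_ : (s - j) * (j * q ^ n) <= _)%N; last by rewrite leq_mul2l D1 orbT.
  by rewrite mulnA leq_mul2r H1 orbT.
split; first by apply: leq_trans sumN; rewrite leq_add2l.
move=> e s1.
have H3 : ((s - j) * #|supp (r j)| <= s.-1 * q ^ n)%N by rewrite -(leq_add2l (\sum_y N y)) e.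
have qn0 : (0 < q ^ n)%N by rewrite expn_gt0 q0.
have e1 : ((s - j) * j = s.-1)%N.
  apply/eqP; rewrite eqn_leq H1 andbT -(leq_pmul2r qn0); apply: leq_trans H3.
  by rewrite -mulnA leq_mul2l D1 orbT.
have ej : j = 1%N \/ j = s.-1.
  have [d ed] : exists d, s = (j + d.+1)%N by exists (s - j).-1; lia.
  move: e1; rewrite ed (_ : j + d.+1 - j = d.+1)%N; last lia.
  by case: (j) jpos => // j'; case: j' => [|j'] _; [left|case: d {ed} => [|d]; [right; lia|nia]].
have D2 : #|supp (r j)| = (j * q ^ n)%N.
  apply/eqP; rewrite eqn_leq D1 andbT -(leq_pmul2l (_ : 0 < s - j)%N) ?subn_gt0 //.
  by rewrite mulnA e1.
have Ne y : N y = if r j y == 0 then s else j.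
  have := @sum_eq_all _ (fun y => N y + (s - j) * (r j y != 0)%R)%N (fun=> s).
  move=> /(_ _ _ y) H; have {}H : (N y + (s - j) * (r j y != 0)%R = s)%N.
    apply: H => [z|].
      by case: (boolP (r j z == 0)) => [_|/Nj]; rewrite ?muln0 ?addn0 ?Ns //=; lia.
    rewrite sum_nat_const card_rV mulnC -e big_split /= leq_add2l -big_distrr /=.
    by rewrite -card_set; apply: leq_trans H2 _.
  by move: H; case: (r j y == 0) => /=; lia.
(* Having degree at most q - j, [r j] is a minimum word; the values of [w] on its nonzeros form the
   required set. *)
have cZ : #|zset (r j)| = ((q - j) * q ^ n)%N.
  have := card_zset_supp (r j); rewrite D2 expnS mulnBl => <-.
  by rewrite addnK.
have jq : (j < q)%N := ltn_trans js sq.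
have pr' : pd (q - j).+1 (r j) by have := pr j; rewrite subSn // ltnW.
case: (min_word (_ : q - j < q)%N pr' cZ); first lia.
move=> w [C [w0 cC rC]]; exists w, (~: C), j; split=> //.
  have : (#|C| + #|~: C| = q)%N by rewrite cardsC.
  by rewrite cC => /(canRL (addKn _)) ->; rewrite subKn // ltnW.
by move=> y; rewrite Ne rC inE; case: ifP.
Qed.

End Monic.

End SecondWeight.

(** * Directions of exact degree s and the second weight *)

Section Directions.

Variable F : finFieldType.
Local Notation q := #|F|.

(** The coefficient of t^s is the same on all parallel lines: with [v] as first axis, [f] is monic
    up to a constant. *)
Definition monic_dir n s (f : 'rV[F]_n -> F) v := exists2 c, c != 0 &
  forall p, exists2 P : {poly F}, (size P <= s)%N &
    forall t, f (p + t *: v) = c * t ^+ s + P.[t].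

Definition line_zeros n (f : 'rV[F]_n -> F) v x := #|[set t | f (x + t *: v) == 0]|.

Lemma pd_monic_dir n s (f : 'rV[F]_n -> F) : (s < q)%N -> pd s.+1 f ->
  (exists v, monic_dir s f v) \/ pd s f.
Proof.
move=> sq pf; case: (pd_line pf) => T HT.
case: (pickP (fun v => T v != 0)) => [v Tv|T0]; [left|right].
  by exists v, (T v).
apply: pd_low => // p v; case: (HT p v) => P sP eP; exists P => // t.
by rewrite eP (eqP (negbFE (T0 v))) mul0r add0r.
Qed.

Lemma pd_monic_dir_hyp n s (f : 'rV[F]_(1 + n) -> F) w (M : 'M[F]_(1 + n)) :
  (s < q)%N -> pd s.+1 f -> (forall t y, lin w (pt t y *m M) = t) ->
  (exists2 v, lin w v = 0 & monic_dir s f v) \/ forall c, pd s (fun y => f (pt c y *m M)).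
Proof.
move=> sq pf wM; case: (pd_line pf) => T HT.
case: (pickP (fun v => (lin w v == 0) && (T v != 0))) => [v /andP[/eqP wv Tv]|T0]; [left|right].
  by exists v => //; exists (T v).
move=> c; apply: pd_low => //; first exact: pd_restr.
move=> p v; case: (HT (pt c p *m M) (pt 0 v *m M)) => P sP eP; exists P => // t.
have := T0 (pt 0 v *m M); rewrite wM eqxx /= => /negbFE/eqP Tv.
have := eP t; rewrite Tv mul0r add0r => <-; congr f.
by rewrite scalemxAl -mulmxDl ptZ ptD mulr0 addr0.
Qed.

Lemma monic_dir_poly n s (f : 'rV[F]_n -> F) v p : monic_dir s f v ->
  exists2 P : {poly F}, size P = s.+1 & forall t, f (p + t *: v) = P.[t].
Proof.
case=> c c0 /(_ p)[P sP eP]; exists (c *: 'X^s + P); last by move=> t; rewrite !hornerE eP.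
rewrite size_polyDl size_scale // size_polyXn //.
Qed.

Lemma line_zeros_le n s (f : 'rV[F]_n -> F) v x : monic_dir s f v -> (line_zeros f v x <= s)%N.
Proof.
case/(monic_dir_poly x) => P sP eP; have P0 : P != 0 by rewrite -size_poly_eq0 sP.
have := card_roots P0; rewrite sP; apply: leq_trans; apply: eq_leq.
by apply: eq_card => t; rewrite !inE eP.
Qed.

(** With a zero coefficient of t^s, having s zeros would make the restriction vanish identically,
    and then it has q > s of them. *)
Lemma line_zeros_top n s (f : 'rV[F]_n -> F) T v x : (s < q)%N ->
  (forall p v, exists2 P : {poly F}, (size P <= s)%N &
     forall t, f (p + t *: v) = T v * t ^+ s + P.[t]) ->
  line_zeros f v x = s -> T v != 0.
Proof.
move=> sq HT e; case: (HT x v) => P sP eP; apply/negP => /eqP T0.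
have eN : line_zeros f v x = #|[set t | P.[t] == 0]|.
  by apply: eq_card => t; rewrite !inE eP T0 mul0r add0r.
have [P0|P0] := eqVneq P 0.
  move: sq; rewrite -e eN P0 (_ : [set t | _] = setT) ?cardsT ?ltnn //.
  by apply/setP => t; rewrite !inE horner0 eqxx.
have := card_roots P0; rewrite -eN e.
by move: P0; rewrite -size_poly_eq0; move: sP; case: (size P) => // k; lia.
Qed.

(** Each zero x is counted once for every t, from the base point x - t v. *)
Lemma sum_line_zeros n (f : 'rV[F]_n -> F) v (A : pred 'rV[F]_n) :
  (forall x t, A (x + t *: v) = A x) ->
  (q * #|[set x | A x && (f x == 0)%R]| = \sum_(x | A x) line_zeros f v x)%N.
Proof.
move=> Av; under eq_bigr do rewrite /line_zeros card_set.
rewrite exchange_big /= -sum_nat_const; apply: eq_bigr => t _.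
rewrite card_set (reindex_inj (addIr (t *: v))) /= [RHS]big_mkcond.
by apply: eq_bigr => x _; rewrite Av; case: (A x).
Qed.

Lemma sum_line_zeros_total n (f : 'rV[F]_n -> F) v :
  (q * #|zset f| = \sum_x line_zeros f v x)%N.
Proof.
rewrite -(sum_line_zeros f (A := predT)) //; congr (_ * _)%N.
Qed.

Lemma monic_dir_neq0 n s (f : 'rV[F]_n -> F) v : (0 < s < q)%N -> monic_dir s f v -> v != 0.
Proof.
case/andP=> s0 sq gv.
apply/negP => /eqP v0; have [P sP eP] := monic_dir_poly 0 gv.
have : P - (f 0)%:P = 0; first apply: poly_fun_eq0.
- apply: leq_trans (size_polyD _ _) _; rewrite geq_max sP size_polyN size_polyC.
  by rewrite sq; case: (_ != _) => //=; apply: ltnW (q_gt1 F).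
- by move=> t; rewrite !hornerE -eP v0 scaler0 addr0 subrr.
move/eqP; rewrite subr_eq0 => /eqP eP'; move: sP; rewrite eP' size_polyC.
by case: (_ != _) s0 => //= ; case: (s).
Qed.

(** The coordinate-free form of [monic_zeros]; the form found there lives on the quotient by [v],
    hence [lin w v = 0]. *)
Lemma monic_dir_zeros n s (f : 'rV[F]_(1 + (1 + n)) -> F) v : (0 < s < q)%N ->
  pd s.+1 f -> monic_dir s f v ->
  (forall x, line_zeros f v x = s) \/
  ((#|zset f| + s.-1 * q ^ n <= s * q ^ n.+1)%N /\
   ((#|zset f| + s.-1 * q ^ n = s * q ^ n.+1)%N -> (1 < s)%N ->
    exists w (C : {set F}) j, [/\ w != 0, lin w v = 0, j = 1%N \/ j = s.-1, #|C| = j &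
      forall x, line_zeros f v x = if lin w x \in C then j else s])).
Proof.
case/andP=> s0 sq pf [c c0 gv].
have v0 : v != 0 by apply: (@monic_dir_neq0 _ s f); [rewrite s0|exists c].
case: (row0_unit v0) => M uM eM; pose h x := f (0 + x *m M).
case: (pd_slice (pd_comp 0 M pf)) => a [pa ea].
have ept t y : pt t y *m M = pt 0 y *m M + t *: v.
  by rewrite -eM scalemxAl -mulmxDl ptZ ptD add0r mulr1 scaler0 addr0.
have ac y : a s y = c.
  case: (gv (pt 0 y *m M)) => P sP eP.
  have : \poly_(j < s.+1) a j y - (c *: 'X^s + P) = 0; first apply: poly_fun_eq0.
  - apply: leq_trans (size_polyD _ _) _; rewrite geq_max size_polyN.
    rewrite (leq_trans (size_poly _ _)) //= (leq_trans (size_polyD _ _)) // geq_max.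
    rewrite (leq_trans (size_scale_leq _ _)) ?size_polyXn //=.
    by apply: leq_trans sP _; apply: ltnW.
  - by move=> t; rewrite !hornerE -eP -ept horner_poly -ea add0r subrr.
  move/polyP/(_ s); rewrite coefB coefD coefZ coefXn coef_poly ltnSn eqxx mulr1 coef0.
  by rewrite (nth_default _ sP) addr0 => /eqP; rewrite subr_eq0 => /eqP.
have eN t y : line_zeros f v (pt t y *m M) = #|[set t | h (pt t y) == 0]|.
  rewrite -[RHS](card_imset _ (addIr (- t))); apply: eq_card => u; rewrite inE ept -addrA -scalerDl.
  apply/idP/imsetP => [H|[u']].
    exists (t + u); last by rewrite addrC addrA addNr add0r.
    by rewrite inE /h add0r ept.
  by rewrite inE /h add0r ept => H ->; rewrite addrCA subrr addr0.
have eZ : #|zset f| = (\sum_y #|[set t | (h (pt t y) == 0)%R]|)%N.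
  rewrite -(card_aff (fun x => f x == 0) 0 uM) card_set [LHS]sum_pt exchange_big /=.
  by apply: eq_bigr => y _; rewrite card_set.
have xE x : x = pt (lsubmx (x *m invmx M) 0 0) (rsubmx (x *m invmx M)) *m M.
  by rewrite pt_submx mulmxKV.
case: (monic_zeros (f := h) s0 sq c0 pa ac ea) => /= [H|]; last rewrite -eZ => -[H1 H2].
  by left=> x; rewrite {1}(xE x) eN H.
right; split=> // e s1; case: (H2 e s1) => w [C [j [w0 ej cC Nj]]].
pose w' := invmx M *m (col_mx 0 w : 'cV_(1 + (1 + n))).
have lw t y : lin w' (pt t y *m M) = lin w y.
  by rewrite linM mulKVmx // lin_pt col_mxKu col_mxKd mxE mul0r add0r.
exists w', C, j; split=> //.
- apply: contraNneq w0 => w'0; have : col_mx 0 w = (0 : 'cV_(1 + (1 + n))).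
    by rewrite -(mulKVmx uM (col_mx 0 w : 'cV_(1 + (1 + n)))) -/w' w'0 mulmx0.
  by rewrite -[0 in RHS]vsubmxK => /eq_col_mx[_ ->]; rewrite linear0.
- by rewrite -eM lw lin0.
by move=> x; rewrite {1 2}(xE x) eN lw Nj.
Qed.

(** Without a monic direction the degree drops to s - 1, and the bound (s - 1) q^(n+1) is already
    below the second value. *)
Lemma second_weight n s (f : 'rV[F]_(1 + (1 + n)) -> F) x0 : (0 < s < q)%N ->
  pd s.+1 f -> f x0 != 0 ->
  (#|zset f| = s * q ^ n.+1)%N \/ (#|zset f| + s.-1 * q ^ n <= s * q ^ n.+1)%N.
Proof.
move=> /andP[s0 sq] pf fx0; have q0 : (0 < q)%N := ltnW (q_gt1 F).
case: (pd_monic_dir sq pf) => [[v gv]|pf'].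
  case: (monic_dir_zeros (_ : 0 < s < q)%N pf gv) => [|H|[H _]]; [by rewrite s0| |by right].
  left; apply/eqP; rewrite -(eqn_pmul2l q0) (sum_line_zeros_total f v).
  under eq_bigr do rewrite H.
  by rewrite sum_nat_const card_rV mulnC mulnCA -expnS.
right; case: s s0 sq pf pf' => // s _ sq _ pf'.
have H : (#|zset f| <= s * q ^ n.+1)%N.
  by rewrite -(leq_pmul2l q0) mulnCA -expnS; apply: zero_bound fx0 pf'.
rewrite /= mulSn addnC leq_add // expnS leq_mul2r orbC.
by rewrite ltnW // ltnW.
Qed.

End Directions.

(** * Double count over all hyperplanes, for a word vanishing on none *)

Section FullHyperplane.

Import Order.TTheory Num.Theory.

Variable F : finFieldType.
Local Notation q := #|F|.

Variables (n s : nat) (f : 'rV[F]_(1 + (1 + n)) -> F).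
Hypotheses (s2 : (1 < s)%N) (sq2 : (s.+1 < q)%N) (pf : pd s.+1 f).
Hypothesis cZ : (#|zset f| + s.-1 * q ^ n = s * q ^ n.+1)%N.
Hypothesis nofull : forall w c, w != 0 -> exists2 x, lin w x = c & f x != 0.

Let x_ (w : 'cV[F]_(1 + (1 + n))) c := #|[set x | (lin w x == c) && (f x == 0)]|.

Let sq : (s < q)%N. Proof. exact: ltnW. Qed.
Let s0 : (0 < s)%N. Proof. exact: ltnW. Qed.
Let q0 : (0 < q)%N. Proof. exact: ltnW (q_gt1 F). Qed.
Let Q := (q ^ n)%N.
Let Q0 : (0 < Q)%N. Proof. by rewrite expn_gt0 q0. Qed.
Let cZQ : (#|zset f| + s.-1 * Q = s * (q * Q))%N. Proof. by rewrite cZ expnS. Qed.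

Let sum_x w : (\sum_c x_ w c = #|zset f|)%N.
Proof. by rewrite -sum_card_lin. Qed.

Let special_desc w := exists (C : {set F}) j, [/\ j = 1%N \/ j = s.-1, #|C| = j &
  forall c, x_ w c = (Q * (if c \in C then j else s))%N].

(* [w] is special when the zeros are not equidistributed over its hyperplanes. *)
Let spec w := (w != 0) && [exists c, (q * x_ w c)%N != #|zset f|].

(** Otherwise all sections by hyperplanes of [w] have degree at most s - 1, which allows only (s -
    1) q^(n+1) zeros in all, fewer than [cZ] requires. *)
Lemma monic_dir_in_hyperplane w : w != 0 -> exists2 v, lin w v = 0 & monic_dir s f v.
Proof.
move=> w0; case: (col0_unit w0) => M uM wM.
case: (pd_monic_dir_hyp sq pf wM) => // pc; exfalso.
have bnd c : (q * x_ w c <= s.-1 * q ^ n.+1)%N.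
  rewrite /x_ (card_slice c (fun x => f x == 0) uM wM).
  case: (nofull c w0) => x wx fx.
  apply: (@zero_bound _ _ _ _ (rsubmx (x *m invmx M))); last first.
    by have := pc c; rewrite -{1}(prednK s0).
  suff -> : pt c (rsubmx (x *m invmx M)) = x *m invmx M by rewrite mulmxKV.
  rewrite -[RHS]pt_submx; congr pt.
  by rewrite -wx -{1}[x](mulmxKV uM) -{1}[x *m _]pt_submx wM.
have : (\sum_c q * x_ w c <= \sum_(c : F) s.-1 * q ^ n.+1)%N by apply: leq_sum => c _.
rewrite -big_distrr /= sum_x sum_nat_const leq_pmul2l // expnS -/Q => H.
have : (q * Q <= s.-1 * Q)%N.
  have e : (s * (q * Q) = s.-1 * (q * Q) + q * Q)%N by rewrite -mulSnr prednK.
  move: cZQ H; rewrite e => E1 E2.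
  by rewrite -(leq_add2l (s.-1 * (q * Q))) -E1 leq_add2r.
by rewrite leq_pmul2r //; lia.
Qed.

Lemma monic_dir_desc v : monic_dir s f v -> exists w (C : {set F}) j,
  [/\ w != 0, lin w v = 0, j = 1%N \/ j = s.-1, #|C| = j &
     forall x, line_zeros f v x = if lin w x \in C then j else s].
Proof.
move=> gv; case: (monic_dir_zeros (_ : 0 < s < q)%N pf gv) => [|H|[_]]; first by rewrite s0.
  have : (q * #|zset f| = q * (s * q ^ n.+1))%N.
    rewrite (sum_line_zeros_total f v); under eq_bigr do rewrite H.
    by rewrite sum_nat_const card_rV mulnC mulnCA -expnS.
  move/eqP; rewrite eqn_pmul2l // => /eqP e; move: cZQ; rewrite e expnS -/Q => /eqP.
  by rewrite -[eqbRHS]addn0 eqn_add2l muln_eq0; lia.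
by apply.
Qed.

Lemma hyper_lines w v c : lin w v = 0 ->
  (q * x_ w c = \sum_(x | lin w x == c) line_zeros f v x)%N.
Proof.
move=> wv; apply: (@sum_line_zeros _ _ f v (fun x => lin w x == c)) => x t.
by rewrite linD linZ wv mulr0 addr0.
Qed.

(** Each hyperplane of [w] meets each hyperplane of [wv] in q^n points, so the right-hand side does
    not depend on [c]. *)
Lemma hyper_const w v wv (C : {set F}) j c :
  w != 0 -> lin w v = 0 -> wv != 0 -> (forall a, wv != a *: w) ->
  (forall x, line_zeros f v x = if lin wv x \in C then j else s) ->
  (q * x_ w c = Q * (\sum_c' if c' \in C then j else s))%N.
Proof.
move=> w0 wv0 wv_0 ind Nv; rewrite (hyper_lines _ wv0).
rewrite (partition_big (lin wv) predT) //= big_distrr /=; apply: eq_bigr => c' _.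
rewrite (eq_bigr (fun=> if c' \in C then j else s)); last first.
  by move=> x /andP[_ /eqP <-]; rewrite Nv.
rewrite sum_nat_const /Q -(card_lin2 c c' w0 ind); congr (_ * _)%N.
by apply: eq_card => x; rewrite !inE.
Qed.

Lemma hyper_special w v wv a (C : {set F}) j : w != 0 -> lin w v = 0 -> w = a *: wv ->
  (forall x, line_zeros f v x = if lin wv x \in C then j else s) ->
  forall c, x_ w c = (Q * (if c / a \in C then j else s))%N.
Proof.
move=> w0 wv0 ew Nv c; apply/eqP; rewrite -(eqn_pmul2l q0) (hyper_lines _ wv0); apply/eqP.
have a0 : a != 0 by apply: contraNneq w0 => a0; rewrite ew a0 scale0r.
rewrite (eq_bigr (fun=> if c / a \in C then j else s)); last first.
  by move=> x /eqP <-; rewrite Nv ew linZl mulrC mulKf.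
rewrite sum_nat_const mulnA -expnS -(card_lin c w0); congr (_ * _)%N.
by apply: eq_card => x; rewrite !inE.
Qed.

(** Were [wv] not proportional to [w], the zeros would be equidistributed over the hyperplanes of
    [w] by [hyper_const]. *)
Lemma spec_desc w v wv (C : {set F}) j : spec w -> lin w v = 0 -> wv != 0 ->
  j = 1%N \/ j = s.-1 -> #|C| = j ->
  (forall x, line_zeros f v x = if lin wv x \in C then j else s) ->
  special_desc w /\ exists2 a, a != 0 & w = a *: wv.
Proof.
case/andP=> w0 /existsP[c0 nc] wv0 wv_0 ej cC Nv.
case: (pickP (fun a => wv == a *: w)) => [a /eqP ea|/(_ _)/negbT ind]; last first.
  case/eqP: nc; have H c : (q * x_ w c = q * x_ w c0)%N.
    by rewrite !(hyper_const _ w0 wv0 wv_0 ind Nv).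
  have := sum_x w; rewrite (eq_bigr (fun=> x_ w c0)); last first.
    by move=> c _; apply/eqP; rewrite -(eqn_pmul2l q0) H.
  by rewrite sum_nat_const.
have a0 : a != 0 by apply: contraNneq wv_0 => a0; rewrite ea a0 scale0r.
have ew : w = a^-1 *: wv by rewrite ea scalerA mulVf ?scale1r.
split; last by exists a^-1; rewrite ?invr_eq0.
exists [set c | c / a^-1 \in C], j; split=> //; last first.
  by move=> c; rewrite inE; apply: hyper_special ew Nv c.
have ai : a^-1 != 0 by rewrite invr_eq0.
rewrite -cC -[RHS](card_imset (mem C) (mulIf ai)); apply: eq_card => c.
rewrite inE; apply/idP/imsetP => [cC'|[y yC ->]]; last by rewrite mulfK.
by exists (c / a^-1); rewrite // divfK.
Qed.

Lemma spec_special w : spec w -> special_desc w.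
Proof.
move=> sw; case/andP: (sw) => w0 _; case: (monic_dir_in_hyperplane w0) => v wv gv.
case: (monic_dir_desc gv) => wv' [C [j [wv0 wvv ej cC Nv]]].
by case: (spec_desc sw wv wv0 ej cC Nv).
Qed.

(** A section with s q^n zeros is a minimum word, so its zeros fill s parallel hyperplanes of the
    section. Each of the q^(n+1) - q^n directions transversal to them has a line with s zeros, so
    [T] is nonzero there. *)
Lemma spec_monic_dir_count T w :
  (forall p v, exists2 P : {poly F}, (size P <= s)%N &
     forall t, f (p + t *: v) = T v * t ^+ s + P.[t]) ->
  spec w -> (q.-1 * q ^ n <= #|[set v | (lin w v == 0)%R && (T v != 0)%R]|)%N.
Proof.
move=> HT sw; case/andP: (sw) => w0 _; case: (spec_special sw) => C [j [ej cC xC]].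
have [c cnC] : exists c, c \notin C.
  apply/existsP; rewrite -negb_forall; apply/negP => /forallP H.
  have : #|C| = q by apply: eq_card => c; rewrite H.
  by rewrite cC => e; move: ej sq; rewrite e; lia.
case: (col0_unit w0) => M uM wM.
have := xC c; rewrite (negPf cnC) /x_ (card_slice c (fun x => f x == 0) uM wM) mulnC => e.
case: (min_word sq (pd_restr c M pf) e) => w' [C' [w'0 cC' fC']].
rewrite (card_slice 0 (fun v => T v != 0) uM wM).
apply: leq_trans (_ : #|[set y | (lin w' y != 0)%R]| <= _)%N.
  have := card_zset_supp (lin w'); rewrite (card_lin 0 w'0 : #|zset (lin w')| = _).
  rewrite -[(1 + n)%N]/n.+1 expnS.
  have -> : (q * q ^ n = q ^ n + q.-1 * q ^ n)%N by rewrite -mulSn prednK.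
  move=> /eqP; rewrite eqn_add2l => /eqP <-.
  by apply: eq_leq; apply: eq_card => y; rewrite !inE.
apply: subset_leq_card; apply/subsetP => y; rewrite !inE => wy.
apply: (line_zeros_top (x := pt c 0 *m M) sq HT).
rewrite -cC' -(card_imset _ (mulfI (_ : (lin w' y)^-1 != 0))) ?invr_eq0 //.
apply: eq_card => t; rewrite inE scalemxAl -mulmxDl ptZ ptD mulr0 addr0 add0r.
rewrite fC' linZ; apply/idP/imsetP => [H|[u uC ->]]; last by rewrite mulrAC mulVf ?mul1r.
by exists (t * lin w' y); rewrite // mulrC mulfK.
Qed.

(** Pairs of a special form and a monic direction in its kernel are counted: a form has at least (q
    - 1) q^n such directions, and each of the q^(n+2) - 1 nonzero vectors serves at most q - 1
    forms, the multiples of its [wv]. *)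
Lemma card_spec : (#|[set w | spec w]| < q * q)%N.
Proof.
case: (pd_line pf) => T HT.
have T_neq0 v : T v != 0 -> v != 0.
  move=> Tv; apply: (@monic_dir_neq0 _ _ s f); first by rewrite s0.
  by exists (T v) => // p; apply: HT.
have : (\sum_(w in [set w | spec w]) q.-1 * q ^ n <= \sum_(v : 'rV[F]_(1 + (1 + n)) | (v != 0)%R)
  q.-1)%N.
  apply: leq_trans (_ : \sum_(w in [set w | spec w])
      #|[set v | (lin w v == 0)%R && (T v != 0)%R]| <= _)%N.
    by apply: leq_sum => w; rewrite inE => /(spec_monic_dir_count HT).
  under eq_bigr do rewrite card_set.
  rewrite exchange_big /= [leqRHS]big_mkcond; apply: leq_sum => v _.
  have [Tv|_] := boolP (T v != 0); last by rewrite big1 // => w _; rewrite andbF.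
  have gv : monic_dir s f v by exists (T v) => // p; apply: HT.
  rewrite T_neq0 //; case: (monic_dir_desc gv).
  move=> wv [C [j [wv0 wvv ej cC Nv]]].
  pose MW := [set a *: wv | a in [set~ (0 : F)]].
  apply: leq_trans (_ : #|MW| <= _)%N; last first.
    by apply: leq_trans (leq_imset_card _ _) _; rewrite cardsC1.
  rewrite -[leqRHS]sum1_card [leqLHS]big_mkcond [leqRHS]big_mkcond; apply: leq_sum => w _.
  rewrite inE andbT; case: ifP => // sw; case: eqP => // wv1.
  case: (spec_desc sw wv1 wv0 ej cC Nv) => _ [a a0 ea].
  rewrite (_ : w \in _) //; apply/imsetP; exists a => //; by rewrite !inE.
rewrite !sum_nat_const cardC1 card_rV mulnCA [leqRHS]mulnC leq_pmul2l; last by have := q_gt1 F; lia.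
rewrite -[(1 + (1 + n))%N]/(n.+2) !expnS -/Q => H.
rewrite -(ltn_pmul2r Q0); apply: leq_ltn_trans H _.
by rewrite -mulnA prednK // !muln_gt0 q0.
Qed.

Lemma sum_split_le (T : finType) (L M : {set T}) (d : T -> int) d0 B :
  M \subset L -> (forall x, x \in M -> d x = d0) -> (forall x, x \in L -> d x <= B) ->
  \sum_(x in L) d x <= d0 *+ #|M| + B *+ (#|L| - #|M|).
Proof.
move=> ML dM dL; rewrite (big_setID M) /= (setIidPr ML); apply: lerD.
  by rewrite (eq_bigr (fun=> d0)) // sumr_const.
rewrite -(cardsDS ML) -sumr_const; apply: ler_sum => x /setDP[xL _]; exact: dL.
Qed.

(* Over all [w] the deviations sum to a constant depending only on whether [f a = 0];
   only the special [w], of which there are fewer than q^2, contribute. *)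
Let dev a w : int := (q * x_ w (lin w a))%:Z - #|zset f|%:Z.

(** In [sum_all_lin] the other nonzero forms contribute no deviation, and the zero form contributes
    q - 1 times the number of zeros. *)
Lemma sum_dev a : \sum_(w in [set w | spec w]) dev a w =
  q.-1%:Z * ((q * q * Q * (a \in zset f))%:Z - #|zset f|%:Z).
Proof.
have S : \sum_w (q * x_ w (lin w a))%:Z =
    (q * (q * Q * #|zset f| + (q * (q * Q) - q * Q) * (a \in zset f)))%:Z.
  rewrite -!expnS -(sum_all_lin (zset f) a) big_distrr /= (big_morph Posz PoszD (erefl _)).
  apply: eq_bigr => w _; congr (Posz (_ * _)); apply: eq_card => x; rewrite !inE //.
have : \sum_w dev a w = \sum_(w in [set w | spec w]) dev a w + q.-1%:Z * #|zset f|%:Z.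
  rewrite (bigID (mem [set w | spec w])) /=; congr (_ + _).
  rewrite (bigD1 0) /=; last by rewrite inE /spec eqxx.
  rewrite big1 => [|w].
    rewrite addr0 /dev (_ : x_ 0 _ = #|zset f|); last first.
      by apply: eq_card => x; rewrite !inE !lin0l eqxx.
    by rewrite -[in (q * _)%N](prednK q0) mulSn PoszD addrC addrA addNr add0r.
  rewrite inE /spec => /andP[+ w0]; rewrite w0 negb_exists => /forallP/(_ (lin w a)).
  by rewrite negbK => /eqP e; rewrite /dev e subrr.
rewrite big_split /= S sumr_const card_mx muln1 => /eqP; rewrite -subr_eq => /eqP <-.
rewrite -[(1 + (1 + n))%N]/n.+2 !expnS -/Q mulNrn -mulr_natr natz.
have -> : (q * (q * Q) - q * Q = q.-1 * (q * Q))%N.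
  by rewrite -[X in (_ - X)%N]mul1n -mulnBl subn1.
have eq1 : q%:Z = 1 + q.-1%:Z by rewrite -intS prednK.
by rewrite !PoszM !PoszD !PoszM eq1; case: (a \in _); rewrite ?mulr0 ?mulr1; ring.
Qed.

Lemma spec_multiples w : spec w -> exists M : {set 'cV[F]_(1 + (1 + n))},
  [/\ M \subset [set u | spec u], #|M| = q.-1 &
    forall u a, u \in M -> x_ u (lin u a) = x_ w (lin w a)].
Proof.
case/andP=> w0 /existsP[c0 c0P].
pose M := [set b *: w | b in [set~ (0 : F)]].
have xM b c' : b != 0 -> x_ (b *: w) (b * c') = x_ w c'.
  move=> b0; apply: eq_card => x; rewrite !inE linZl.
  by rewrite (inj_eq (mulfI b0)).
exists M; split.
- apply/subsetP => u /imsetP[b]; rewrite [b \in _]inE inE => b0 ->.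
  rewrite inE /spec scaler_eq0 negb_or b0 w0.
  by apply/existsP; exists (b * c0); rewrite xM.
- rewrite card_imset ?cardsC1 // => b b' /eqP;
  rewrite -subr_eq0 -scalerBl scaler_eq0 (negPf w0) orbF.
  by rewrite subr_eq0 => /eqP.
- by move=> u a /imsetP[b]; rewrite [b \in _]inE inE => b0 ->; rewrite linZl xM.
Qed.

(** The point [a] is a zero on a section with j q^n zeros. The q - 1 multiples of [w] have the small
    deviation of that section, and the other special forms, at most q (q - 1) of them, deviate by at
    most (s - 1) q^n. Comparison with [sum_dev] gives q <= j + s - 1. *)
Lemma spec_bound w (C : {set F}) j : spec w -> #|C| = j -> j = 1%N \/ j = s.-1 ->
  (forall c, x_ w c = (Q * (if c \in C then j else s))%N) -> (q < j + s)%N.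
Proof.
move=> sw cC ej xC.
have dev_le a u : u \in [set w | spec w] -> dev a u <= (Q * s.-1)%:Z.
  rewrite inE => /spec_special[C' [j' [ej' _ xC']]]; rewrite /dev xC'.
  have : (q * (Q * (if lin u a \in C' then j' else s)) <= q * (Q * s))%N.
    by rewrite !leq_mul2l; case: ifP => _; rewrite ?leqnn ?orbT //; lia.
  move: (if _ then _ else _) cZQ => y e H.
  rewrite lerBlDr -PoszD lez_nat; apply: leq_trans H _.
  by rewrite (mulnC Q s.-1) addnC e mulnA mulnC.
have [c cC'] : exists c, c \in C by apply/card_gt0P; rewrite cC; lia.
have [a] : exists a, a \in [set x | (lin w x == c) && (f x == 0)].
  by apply/card_gt0P; rewrite -/(x_ w c) xC cC' muln_gt0 Q0; lia.
rewrite !inE => /andP[/eqP wa fa].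
case: (spec_multiples sw) => M [ML cM xM].
have dM u : u \in M -> dev a u = (q * (Q * j))%:Z - #|zset f|%:Z.
  by move=> uM; rewrite /dev xM // wa xC cC'.
have := sum_split_le ML dM (dev_le a); rewrite sum_dev inE fa muln1 cM.
have := card_spec; have := subset_leq_card ML; rewrite cM; move: #|[set w | spec w]| => L L1 L2.
move=> H; have {}H : (q.-1 * (q * q * Q) <= q.-1 * (q * (Q * j)) + Q * s.-1 * (q.-1 * q))%N.
  have Lk : (L - q.-1 <= q.-1 * q)%N.
    by rewrite leq_subLR; move: L2; case: #|F| q0 => //= k _; nia.
  have := leq_mul (leqnn (Q * s.-1)) Lk; move: H.
  have E (z : int) (m : nat) : z *+ m = z * m%:Z by rewrite -mulr_natr natz.
  rewrite !E; move: (q * q * Q)%N (q * (Q * j))%N (Q * s.-1)%N (L - q.-1)%N #|zset f| (q.-1 *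
    q)%N q.-1.
  by move=> A B D u Z v k H1 H2; lia.
have : (q.-1 * (q * Q) * q <= q.-1 * (q * Q) * (j + s.-1))%N.
  move: H; rewrite mulnDr !mulnA; move: q.-1 => k; congr (_ <= _ + _)%N; ring.
rewrite leq_pmul2l; last by have := q_gt1 F; rewrite !muln_gt0 q0 Q0 !andbT; lia.
by move: s0; case: (s) => // k _ /=; lia.
Qed.

(** By [spec_bound] and s + 1 < q every special form has j = s - 1, so q < 2s - 1. The same count at
    a nonzero of [f] on a section with s q^n zeros gives 2s - 1 <= q. *)
Lemma full_hyperplane_aux : False.
Proof.
have Zpos : (0 < #|zset f|)%N.
  rewrite -(ltn_add2r (s.-1 * Q)) add0n cZQ mulnCA.
  apply: leq_trans (_ : s * Q <= _)%N; first by rewrite ltn_pmul2r // prednK.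
  by rewrite leq_pmull.
have Zle : (s.-1 * (q * Q) <= #|zset f|)%N.
  have e : (s * (q * Q) = s.-1 * (q * Q) + q * Q)%N by rewrite -mulSnr prednK.
  rewrite -(leq_add2r (s.-1 * Q)) cZQ e leq_add2l.
  by rewrite leq_pmul2r //; apply: leq_trans (leq_pred s) (ltnW sq).
(* Without special forms, [sum_dev] at a zero would give q^(n+2) zeros. *)
case: (pickP spec) => [w sw|nospec]; last first.
  have /card_gt0P[a aZ] := Zpos.
  have := sum_dev a; rewrite aZ muln1 big_pred0 => [|w]; last by rewrite inE nospec.
  move/esym/eqP; rewrite mulf_eq0 subr_eq0 !eqz_nat => /orP[|/eqP e].
    by move: (q_gt1 F); lia.
  move: cZQ; rewrite -e -mulnA => /eqP; rewrite -[eqbRHS]addn0 eqn_leq => /andP[+ _].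
  rewrite leqNgt => /negP; apply; rewrite addn0; apply: leq_trans (leq_addr _ _).
  by rewrite ltn_pmul2r // muln_gt0 q0.
have := sw => /spec_special[C [j [ej cC xC]]].
have := spec_bound sw cC ej xC => qj.
have ej1 : j = s.-1 by case: ej qj => // ->; lia.
have [c cnC] : exists c, c \notin C.
  apply/existsP; rewrite -negb_forall; apply/negP => /forallP H.
  have : #|C| = q by apply: eq_card => c; rewrite H.
  by rewrite cC ej1; move: sq; lia.
case: (nofull c (proj1 (andP sw))) => a wa fa.
case: (spec_multiples sw) => M [ML cM xM].
have dM u : u \in M -> - dev a u = #|zset f|%:Z - (q * (Q * s))%:Z.
  by move=> uM; rewrite /dev xM // wa xC (negPf cnC) opprB.
have dev_ge u : u \in [set w | spec w] -> - dev a u <= #|zset f|%:Z - (q * (Q * s.-1))%:Z.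
  rewrite inE => su; have := su => /spec_special[C' [j' [ej' cC' xC']]].
  have := spec_bound su cC' ej' xC' => qj'.
  have ej1' : j' = s.-1 by case: ej' qj' => // ->; lia.
  rewrite /dev xC' opprB lerD2l lerN2 lez_nat !leq_mul2l ej1'.
  by case: ifP => _; rewrite ?leqnn ?leq_pred ?orbT.
have := sum_split_le ML dM dev_ge; rewrite sumrN sum_dev inE (negPf fa) muln0 cM.
have := card_spec; have := subset_leq_card ML; rewrite cM; move: #|[set w | spec w]| => L L1 L2.
have Lk : (L - q.-1 <= q.-1 * q)%N.
  by rewrite leq_subLR; move: L2; case: #|F| q0 => //= k _; nia.
have [D eD] : exists D, #|zset f| = (s.-1 * (q * Q) + D)%N.
  by exists (#|zset f| - s.-1 * (q * Q))%N; rewrite subnKC.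
have eB : #|zset f|%:Z - (q * (Q * s.-1))%:Z = D.
  have -> : (q * (Q * s.-1) = s.-1 * (q * Q))%N by rewrite mulnA mulnC.
  by rewrite eD PoszD addrC addKr.
have E (z : int) (m : nat) : z *+ m = z * m%:Z by rewrite -mulr_natr natz.
rewrite eB !E => H; have {}H : (q.-1 * (q * (Q * s)) <= D * (q.-1 * q))%N.
  have := leq_mul (leqnn D) Lk; move: H.
  move: (q * (Q * s))%N (L - q.-1)%N #|zset f| (q.-1 * q)%N q.-1.
  by move=> A u Z v k H1 H2; lia.
have {}H : (Q * s <= D)%N.
  move: H; rewrite (mulnC D) mulnA leq_pmul2l //.
  by have := q_gt1 F; rewrite !muln_gt0 q0 andbT; lia.
move: cZQ; rewrite eD => /eqP.
have -> : (s * (q * Q) = s.-1 * (q * Q) + q * Q)%N by rewrite -mulSnr prednK.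
rewrite -addnA eqn_add2l => /eqP eq2.
have : (Q * s + s.-1 * Q <= q * Q)%N by rewrite -eq2 leq_add2r.
by rewrite mulnC -mulnDl leq_pmul2r //; move: qj; rewrite ej1; lia.
Qed.

End FullHyperplane.

Lemma second_word_hyperplane (F : finFieldType) n s (f : 'rV[F]_(1 + (1 + n)) -> F) :
  (1 < s)%N -> (s.+1 < #|F|)%N -> pd s.+1 f ->
  (#|zset f| + s.-1 * #|F| ^ n = s * #|F| ^ n.+1)%N ->
  exists w c, w != 0 /\ forall x, lin w x = c -> f x = 0.
Proof.
move=> s1 sq pf cZ.
have [/existsP[w /existsP[c /andP[w0 /forallP H]]]|] :=
  boolP [exists w : 'cV[F]_(1 + (1 + n)), [exists c, (w != 0) && [forall x, (lin w x == c) ==> (f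
    x == 0)]]].
  by exists w, c; split=> // x /eqP e; apply/eqP; have := H x; rewrite e.
rewrite negb_exists => /forallP H; exfalso.
apply: (full_hyperplane_aux s1 sq pf cZ) => w c w0.
have := H w => /existsPn/(_ c); rewrite w0 /= => /forallPn[x].
by rewrite negb_imply => /andP[/eqP wx fx]; exists x.
Qed.

(** * Hyperplane sections with few zeros *)

Section PlaneCurve.

Variable F : finFieldType.
Local Notation q := #|F|.

(* Total degree [< k], in the two variables of {poly {poly F}}. *)
Definition tdeg k (p : {poly {poly F}}) := forall i, (size (p`_i)%R <= k - i)%N.

Lemma tdegD k p p' : tdeg k p -> tdeg k p' -> tdeg k (p + p').
Proof.
move=> hp hp' i; rewrite coefD; apply: leq_trans (size_polyD _ _) _.
by rewrite geq_max hp hp'.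
Qed.

Lemma tdegN k p : tdeg k p -> tdeg k (- p).
Proof. by move=> hp i; rewrite coefN size_polyN. Qed.

Lemma tdegM k l p p' : tdeg k.+1 p -> tdeg l p' -> tdeg (k + l) (p * p').
Proof.
move=> hp hp' i; rewrite coefM; apply: leq_trans (size_sum _ _ _) _.
apply/bigmax_leqP => j _; have hj := hp j; have hj' := hp' (i - j)%N.
have [->|p0] := eqVneq p`_j 0; first by rewrite mul0r size_poly0.
have [->|p0'] := eqVneq p'`_(i - j) 0; first by rewrite mulr0 size_poly0.
apply: leq_trans (size_polyMleq _ _) _.
move: p0 p0'; rewrite -!size_poly_gt0; have := ltn_ord j.
move: hj hj'; move: (size _) (size _) => u v; lia.
Qed.

Lemma tdeg_divide k d (G p : {poly {poly F}}) : G \is monic -> size G = d.+1 ->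
  tdeg d.+1 G -> tdeg k p ->
  exists Q R, [/\ p = Q * G + R, (size R <= d)%N & tdeg k R].
Proof.
move=> mG sG tG; have [N] := ubnP (size p); elim: N p => // N IH p sN tp.
case: (leqP (size p) d) => sp; first by exists 0, p; rewrite mul0r add0r.
have [e ee] : exists e, size p = (e + d).+1.
  by exists ((size p).-1 - d)%N; move: sp; move: (size p) => z; lia.
pose T := (lead_coef p)%:P * ('X^e * G).
have sX : size ('X^e * G) = (e + d).+1.
  rewrite mulrC size_Mmonic ?monicXn ?size_polyXn ?sG -?size_poly_gt0 ?sG //.
  by rewrite addnS /= addSn addnC.
have sT : (size T <= (e + d).+1)%N.
  apply: leq_trans (size_polyMleq _ _) _; rewrite sX size_polyC.
  by case: (_ != 0) => /=; lia.
have cT : T`_(e + d) = lead_coef p.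
  rewrite coefCM coefXnM ltnNge leq_addr /= addKn.
  by have /monicP := mG; rewrite /lead_coef sG /= => ->; rewrite mulr1.
have sp' : (size (p - T)%R < N)%N.
  apply: leq_ltn_trans (_ : e + d < N)%N; last by rewrite -ltnS -ee.
  apply/leq_sizeP => j; rewrite leq_eqVlt => /orP[/eqP <-|lt]; rewrite coefB.
    by rewrite cT /lead_coef ee subrr.
  by rewrite !nth_default ?subrr // ?ee // (leq_trans sT).
have tT : tdeg k T.
  move=> i; rewrite coefCM coefXnM; case: ltnP => ei; first by rewrite mulr0 size_poly0.
  have [->|G0] := eqVneq G`_(i - e) 0; first by rewrite mulr0 size_poly0.
  apply: leq_trans (size_polyMleq _ _) _.
  have := tp (e + d)%N; have := tG (i - e)%N; move: G0.
  rewrite -size_poly_gt0 /lead_coef ee /=.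
  have : (0 < size (p`_(e + d))%R)%N.
    have : lead_coef p != 0 by rewrite lead_coef_eq0 -size_poly_gt0 ee.
    by rewrite /lead_coef ee /= -size_poly_gt0.
  move: (size (p`_(e + d))) (size (G`_(i - e))) => u v.
  by move: ei; clear; lia.
case: (IH (p - T)) => //; first by apply: tdegD => //; apply: tdegN.
move=> Q [R [e1 sR tR]]; exists (Q + (lead_coef p)%:P * 'X^e), R; split=> //.
by rewrite mulrDl -addrA [X in _ + X]addrC addrA -e1 -mulrA subrK.
Qed.

(** The derivative in the inner variable Y; [deriv] itself is the one in the outer variable X. *)
Definition dY (p : {poly {poly F}}) := map_poly (@deriv F) p.

Lemma coef_dY p i : (dY p)`_i = (p`_i)^`().
Proof. by rewrite /dY coef_map_id0 // deriv0. Qed.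

Lemma dYD p p' : dY (p + p') = dY p + dY p'.
Proof. by apply/polyP => i; rewrite !(coef_dY, coefD) derivD. Qed.

Lemma dYM p p' : dY (p * p') = dY p * p' + p * dY p'.
Proof.
apply/polyP => i; rewrite coefD coef_dY !coefM linear_sum /= -big_split /=.
by apply: eq_bigr => j _; rewrite derivM !coef_dY.
Qed.

Lemma dYC c : dY c%:P = c^`()%:P.
Proof. by apply/polyP => i; rewrite coef_dY !coefC; case: eqP => // _; rewrite deriv0. Qed.

Lemma size_roots_dvd (P : {poly F}) d : size P = d.+1 ->
  #|[set t | P.[t] == 0]| = d -> P %| 'X^q - 'X.
Proof.
move=> sP cP; have e := @all_roots_prod_XsubC _ P (enum [set t | P.[t] == 0]).
rewrite e ?uniq_rootsE ?enum_uniq //; last first.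
- by apply/allP => t; rewrite mem_enum inE rootE.
- by rewrite -cardE cP.
rewrite dvdpZl ?lead_coef_eq0 -?size_poly_gt0 ?sP //.
apply: uniq_roots_dvdp; last by rewrite uniq_rootsE enum_uniq.
by apply/allP => t _; rewrite rootE !hornerE expf_card subrr.
Qed.

Lemma vanish_nonzero (P : {poly F}) : (forall y, y != 0 -> P.[y] = 0) ->
  exists c : {poly F}, P = c * ('X^(q.-1) - 1).
Proof.
move=> P0; have : \prod_(z <- enum F) ('X - z%:P) %| 'X * P.
  apply: uniq_roots_dvdp; last by rewrite uniq_rootsE enum_uniq.
  apply/allP => t _; rewrite rootE !hornerE; have [->|/P0->] := eqVneq t 0.
    by rewrite mul0r.
  by rewrite mulr0.
have e : 'X^q - 'X = 'X * ('X^(q.-1) - 1) :> {poly F}.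
  by rewrite mulrBr mulr1 -exprS prednK // (ltnW (q_gt1 F)).
rewrite big_enum -finField_genPoly e => /dvdpP[c]; rewrite mulrCA => e'; exists c.
by apply: (mulfI _ e'); rewrite polyX_eq0.
Qed.

Lemma vanish_nonzero_small (P : {poly F}) : (forall y, y != 0 -> P.[y] = 0) ->
  (size P < q)%N -> P = 0.
Proof.
case/vanish_nonzero=> c -> sP; have [->|c0] := eqVneq c 0; first by rewrite mul0r.
have q1 : (0 < q.-1)%N by have := q_gt1 F; lia.
move: sP; rewrite size_Mmonic ?monicXnsubC // size_XnsubC //.
move: c0; rewrite -size_poly_gt0; move: (size c) => z.
by case: #|F| q1 => // k k0; rewrite /= addnS /=; lia.
Qed.

Lemma frobenius_translate (v : F) : ('X + v%:P) ^+ q = 'X^q + v%:P.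
Proof.
apply/eqP; rewrite -subr_eq0; apply/eqP/poly_fun_eq0; last first.
  by move=> t; rewrite !hornerE !expf_card subrr.
have e : 'X + v%:P = 'X - (- v)%:P by rewrite polyCN opprK.
have m1 : ('X + v%:P) ^+ q \is monic by rewrite e monic_exp // monicXsubC.
have s1 : size (('X + v%:P) ^+ q) = q.+1 by rewrite e size_exp_XsubC.
apply/leq_sizeP => j; rewrite leq_eqVlt => /orP[/eqP <-|lt].
  rewrite coefB coefD coefXn eqxx coefC; move: (ltnW (q_gt1 F)); rewrite lt0n => /negPf->.
  by move/monicP: m1; rewrite /lead_coef s1 /= => ->; rewrite addr0 subrr.
rewrite nth_default // (leq_trans (size_polyD _ _)) // geq_max s1 size_polyN lt.
by rewrite (leq_trans (size_polyD _ _)) // geq_max size_polyXn lt size_polyC;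
  case: (v != 0) => //=; lia.
Qed.

Lemma card_natr0 : (q%:R : F) = 0.
Proof.
have := @sum_expf F 0; rewrite (eq_bigr (fun=> 1)) => [|t _]; last by rewrite expr0.
by rewrite sumr_const; apply; have := q_gt1 F; lia.
Qed.

Section Gap.

Variables (d : nat) (a : nat -> {poly F}).
Hypotheses (d0 : (0 < d)%N) (dq : (d.+1 < q)%N).
Hypotheses (sa : forall j, (size (a j) <= d.+1 - j)%N) (ad : a d = 1).
Hypothesis roots_d : forall y, y != 0 ->
  #|[set t | \sum_(j < d.+1) (a j).[y] * t ^+ j == 0]| = d.
Hypothesis roots_0 : forall t, \sum_(j < d.+1) (a j).[0] * t ^+ j != 0.

(* [X^q - X = Q G + (Y^(q-1) - 1) L] with [L = c0 + k X]. Differentiating in X and in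
   Y at a point of the curve gives [Y G_Y + L G_X = 0] there; [H] below subtracts the
   multiple of G which kills the top coefficient, so [H = 0]. At [Y = 0] this is a
   differential equation for the rootless polynomial [G(X, 0)]. *)
Let G := \poly_(j < d.+1) a j.
Let ev (y : F) (p : {poly {poly F}}) := map_poly (horner_eval y) p.

Let sG : size G = d.+1. Proof. by apply: size_poly_eq; rewrite ad oner_neq0. Qed.
Let mG : G \is monic. Proof. by rewrite monicE /lead_coef sG /= coef_poly ltnSn ad. Qed.
Let tG : tdeg d.+1 G.
Proof. by move=> i; rewrite coef_poly; case: ifP => // _; rewrite size_poly0. Qed.

Let coef_ev y p i : (ev y p)`_i = (p`_i).[y].
Proof. by rewrite /ev coef_map /= /horner_eval. Qed.

Let ev_horner y p t : (ev y p).[t] = (p.[t%:P]).[y].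
Proof.
by have := horner_map (horner_eval y) p t%:P; rewrite /= /horner_eval hornerC.
Qed.

Let ev_G y t : (ev y G).[t] = \sum_(j < d.+1) (a j).[y] * t ^+ j.
Proof.
have -> : ev y G = \poly_(j < d.+1) (a j).[y].
  by apply/polyP => i; rewrite coef_ev !coef_poly; case: ifP => //; rewrite horner0.
by rewrite horner_poly.
Qed.

Let size_ev_G y : size (ev y G) = d.+1.
Proof.
apply/eqP; rewrite eqn_leq (leq_trans (size_poly _ _)) ?sG //=.
rewrite ltnNge; apply/negP => /leq_sizeP/(_ d (leqnn d)).
by rewrite coef_ev coef_poly ltnSn ad hornerC => /eqP; rewrite oner_eq0.
Qed.

Lemma plane_gap : False.
Proof.
have q1 := q_gt1 F; have q0 := ltnW q1.
have tX : tdeg q.+1 ('X^q - 'X).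
  move=> i; rewrite coefB coefXn coefX.
  have [->|iq] := eqVneq i q.
    rewrite (_ : q == 1%N = false) ?subr0 ?size_poly1; lia.
  have [->|_] := eqVneq i 1%N; first by rewrite sub0r size_polyN size_poly1; lia.
  by rewrite subrr size_poly0.
case: (tdeg_divide mG sG tG tX) => Q [R [eI sR tR]].
have evI y : 'X^q - 'X = ev y Q * ev y G + ev y R.
  by rewrite -rmorphM -rmorphD -eI /ev rmorphB /= map_polyXn map_polyX.
(* For y <> 0 the section of [G] has d distinct roots in F, so it divides X^q - X, and the
   remainder, of smaller degree, vanishes. *)
have evR0 y : y != 0 -> ev y R = 0.
  move=> y0; have dG : ev y G %| 'X^q - 'X.
    apply: (size_roots_dvd (size_ev_G y)); rewrite -[RHS](roots_d y0).
    by apply: eq_card => t; rewrite !inE ev_G.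
  have : ev y G %| ev y R by rewrite -(dvdp_addr _ (dvdp_mull (ev y Q) (dvdpp _))) -evI.
  have [//|R0] := eqVneq (ev y R) 0 => /(dvdp_leq R0).
  by rewrite size_ev_G ltnNge (leq_trans (size_poly _ _)).
(* Each coefficient vanishes at all y <> 0, so it is a multiple of Y^(q-1) - 1; the total degree
   leaves a cofactor of degree at most 1 - i, whence the shape of [L]. *)
have cR i : exists c : {poly F}, R`_i = c * ('X^(q.-1) - 1) /\ (size c <= 2 - i)%N.
  case: (@vanish_nonzero R`_i) => [y y0|c ec]; first by rewrite -coef_ev evR0 ?coef0.
  exists c; split=> //; have := tR i; rewrite ec; have [->|c0] := eqVneq c 0.
    by rewrite size_poly0.
  have qq : (0 < q.-1)%N by lia.
  rewrite size_Mmonic ?monicXnsubC // size_XnsubC //.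
  by move: (size c) => z; move: q1; clear; case: #|F| => // k; rewrite /= addnS /=; lia.
case: (cR 0%N) => c0 [e0 s0]; case: (cR 1%N) => c1 [e1 s1].
have [k ek] : exists k, c1 = k%:P by exists c1`_0; apply: size1_polyC.
have [L eL] : exists L, L = c0%:P + c1%:P * 'X by eexists.
have [U eU] : exists U : {poly F}, U = 'X^(q.-1) - 1 by eexists.
have eR : R = U%:P * L.
  apply/polyP => i; rewrite eU eL coefCM coefD coefC coefCM coefX.
  case: i => [|[|i]] /=; first by rewrite e0 mulr0 addr0 mulrC.
    by rewrite e1 mulr1 add0r mulrC.
  have [c [-> ]] := cR i.+2; have -> : (2 - i.+2 = 0)%N by lia.
  rewrite leqn0 size_poly_eq0 => /eqP->.
  by rewrite mul0r mulr0 add0r mulr0.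
pose e2 (p : {poly {poly F}}) t y := (p.[t%:P]).[y].
have pq0 : (q%:R : {poly F}) = 0 by rewrite -polyC_natr card_natr0.
have pq1 : (q.-1%:R : F) = - 1.
  by apply/eqP; rewrite -addr_eq0 natr1 prednK // card_natr0.
have eI' : 'X^q - 'X = Q * G + U%:P * L by rewrite -eR.
have Uy y : y != 0 -> U.[y] = 0.
  move=> y0; rewrite eU !hornerE; apply/eqP; rewrite subr_eq0; apply/eqP.
  by apply: (mulfI y0); rewrite -exprS prednK // expf_card mulr1.
(* Derivative in X: q is zero in F, and [G] and [U] both vanish at the point. *)
have GX t y : y != 0 -> e2 G t y = 0 -> e2 Q t y * e2 G^`() t y = - 1.
  move=> y0; rewrite /e2 => Gty; have := congr1 (fun p => e2 p^`() t y) eI'.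
  rewrite /e2 derivB derivXn derivX derivD !derivM derivC mul0r add0r.
  have -> : 'X^(q.-1) *+ q = 0 :> {poly {poly F}} by rewrite -mulr_natr -polyC_natr pq0 mulr0.
  by rewrite sub0r !(hornerN, hornerD, hornerM, hornerC) Gty Uy // mulr0 mul0r add0r addr0 => <-.
(* Derivative in Y: that of [U] is -Y^(q-2), and the factor y turns y^(q-1) into 1. *)
have GY t y : y != 0 -> e2 G t y = 0 -> y * (e2 Q t y * e2 (dY G) t y) = e2 L t y.
  move=> y0; rewrite /e2 => Gty; have := congr1 (fun p => e2 (dY p) t y) eI'.
  have -> : dY ('X^q - 'X) = 0.
    apply/polyP => i; rewrite coef_dY coefB coefXn coefX coef0.
    by case: eqP; case: eqP => _ _;
      rewrite ?derivB ?derivC ?subrr ?subr0 ?sub0r ?derivN ?derivC ?oppr0.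
  rewrite dYD !dYM dYC /e2 ?horner0 !(hornerD, hornerM, hornerC) ?horner0 Gty Uy // mulr0 mul0r
    add0r addr0.
  have -> : (U^`()).[y] = - y ^+ q.-2.
    by rewrite eU derivB derivC subr0 derivXn hornerMn hornerXn -mulr_natl pq1 mulN1r.
  rewrite mulNr => /eqP; rewrite eq_sym subr_eq0 => /eqP->.
  rewrite mulrA -exprS; have -> : q.-2.+1 = q.-1 by lia.
  by have := Uy y y0; rewrite eU !hornerE => /eqP; rewrite subr_eq0 => /eqP->; rewrite mul1r.
(* The constant k d is the coefficient of X^d in L G_X; G_Y has none since [G] is monic. *)
pose H := 'X%:P * dY G + L * G^`() - (k *+ d)%:P%:P * G.
have tL : tdeg 2 L.
  move=> i; rewrite eL coefD coefC coefCM coefX; case: i => [|[|i]] /=.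
  - by rewrite mulr0 addr0.
  - by rewrite mulr1 add0r.
  - by rewrite mulr0 addr0 size_poly0.
have tG' : tdeg d G^`().
  move=> i; rewrite coef_deriv; rewrite -scaler_nat; apply: leq_trans (size_scale_leq _ _) _.
  by have := tG i.+1; rewrite subSS.
have tH : tdeg d.+1 H.
  apply: tdegD; last apply: tdegN.
    apply: tdegD; last exact: (tdegM tL tG').
    move=> i; rewrite coefCM coef_dY; have [->|Gi] := eqVneq G`_i 0.
      by rewrite deriv0 mulr0 size_poly0.
    apply: leq_trans (size_polyMleq _ _) _; rewrite size_polyX /=.
    apply: leq_trans (lt_size_deriv Gi) _; exact: tG.
  have tC : tdeg 1 (k *+ d)%:P%:P.
    by move=> [|i]; rewrite coefC /= ?size_poly0 // size_polyC; case: (_ != _).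
  exact: (tdegM tC tG).
have H_d : H`_d = 0.
  rewrite coefB coefD !coefCM coef_dY coef_poly ltnSn ad derivC mulr0 add0r mulr1.
  rewrite eL mulrDl coefD coefCM coef_deriv coef_poly ltnn mul0rn mulr0 add0r.
  rewrite -mulrA coefCM coefXM -(prednK d0) coef_deriv coef_poly /= prednK // ltnSn ad.
  by rewrite ek polyCMn mulr_natr subrr.
(* At a zero of [G] the identities [GX] and [GY] give Q H = L - L = 0 with Q nonzero; so on the line
   H has d roots and degree less than d. *)
have evH y : y != 0 -> ev y H = 0.
  move=> y0; have HR t : e2 G t y = 0 -> e2 H t y = 0.
    move=> Gty; have Qt : e2 Q t y != 0.
      apply/eqP => Q0; have := GX t y y0 Gty; rewrite Q0 mul0r => /eqP.
      by rewrite eq_sym oppr_eq0 oner_eq0.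
    apply: (mulfI Qt); rewrite mulr0.
    have -> : e2 H t y = y * e2 (dY G) t y + e2 L t y * e2 G^`() t y - (k *+ d) * e2 G t y.
      by rewrite /e2 /H !(hornerD, hornerN, hornerM, hornerC, hornerX).
    rewrite Gty mulr0 subr0 mulrDr mulrCA GY // mulrCA GX // mulrN1 subrr //.
  have sH : (size (ev y H) <= d)%N.
    apply/leq_sizeP => j dj; rewrite coef_ev; move: dj; rewrite leq_eqVlt => /orP[/eqP <-|dj].
      by rewrite H_d horner0.
    have := tH j; have -> : (d.+1 - j = 0)%N by lia.
    by rewrite leqn0 size_poly_eq0 => /eqP->; rewrite horner0.
  apply/eqP; apply/negPn/negP => H0; have := card_roots H0.
  have : (d <= #|[set t | ((ev y H).[t] == 0)%R]|)%N.
    rewrite -[X in (X <= _)%N](roots_d y0); apply: subset_leq_card; apply/subsetP => t.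
    by rewrite !inE -ev_G !ev_horner => /eqP/HR /eqP.
  by move: H0 sH; rewrite -size_poly_gt0; lia.
(* The coefficients have degree at most d < q - 1 in Y and vanish at the q - 1 nonzero values. *)
have H0 : H = 0.
  apply/polyP => i; rewrite coef0; apply: vanish_nonzero_small.
    by move=> y y0; rewrite -coef_ev evH ?coef0.
  apply: leq_ltn_trans (tH i) _; apply: leq_ltn_trans dq; exact: leq_subr.
pose g := ev 0 G; pose l := ev 0 L.
have sg : size g = d.+1 := size_ev_G 0.
have gN t : g.[t] != 0 by rewrite ev_G.
have el : l = (c0.[0])%:P + k *: 'X.
  apply/polyP => i; rewrite coef_ev eL ek !(coefD, coefC, coefCM, coefZ, coefX).
  by rewrite hornerD hornerM; case: i => [|[|i]] /=; rewrite !hornerE.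
have eg : l * g^`() = (k *+ d) *: g.
  have := congr1 (ev 0) H0; rewrite /ev /H rmorph0 rmorphB rmorphD !rmorphM /=.
  rewrite -deriv_map -[map_poly _ L]/l -[map_poly _ G]/g !map_polyC /= /horner_eval.
  rewrite hornerX hornerC polyC0 mul0r add0r mul_polyC => /eqP.
  by rewrite subr_eq0 => /eqP.
have evI0 : 'X^q - 'X = ev 0 Q * g - l.
  rewrite (evI 0); congr (_ + _).
  rewrite eR /ev rmorphM /= -[map_poly _ L]/l map_polyC /= /horner_eval eU !hornerE.
  by rewrite expr0n; have -> : (q.-1 == 0)%N = false; [lia|rewrite sub0r polyCN mulN1r].
(* For k <> 0 the form [l] has a root, and there [eg] forces k d = 0, since [g] is not zero. *)
have kd : k *+ d = 0.
  have [->|k0] := eqVneq k 0; first by rewrite mul0rn.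
  have lt0 : l.[- c0.[0] / k] = 0 by rewrite el !hornerE /=; field.
  have := congr1 (horner^~ (- c0.[0] / k)) eg; rewrite hornerM lt0 mul0r hornerZ => /esym/eqP.
  by rewrite mulf_eq0 (negPf (gN _)) orbF => /eqP.
(* If l = 0, then [g] divides X^q - X and has roots. If g' = 0, differentiating [evI0] shows that k
   = 1, so [g] divides X^q + c0(0) = (X + c0(0))^q and has the root -c0(0). *)
move: eg; rewrite kd scale0r => /eqP; rewrite mulf_eq0 => /orP[/eqP l0|/eqP g'0].
  have dg : g %| 'X^q - 'X by rewrite evI0 l0 subr0 dvdp_mull.
  have := card_roots_split sg dg; rewrite (_ : [set t | _] = set0) ?cards0; first by lia.
  by apply/setP => t; rewrite !inE; apply/negbTE.
have := congr1 (@deriv F) evI0.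
rewrite derivB derivXn derivX derivB derivM g'0 mulr0 addr0 -mulr_natr pq0 mulr0 sub0r.
rewrite el derivD derivC derivZ derivX add0r alg_polyC => e.
have {}e : (ev 0 Q)^`() * g = (k - 1)%:P.
  by move/eqP: e; rewrite eq_sym subr_eq => /eqP->; rewrite polyCB addrC.
have Q'0 : (ev 0 Q)^`() = 0.
  apply/eqP/negPn/negP => Q0; have g0 : g != 0 by rewrite -size_poly_gt0 sg.
  have := size_mul Q0 g0; rewrite e sg size_polyC addnS /=.
  by move: Q0; rewrite -size_poly_gt0; case: (k - 1 != 0); move: (size _) d0 => z; lia.
have k1 : k = 1.
  by move/eqP: e; rewrite Q'0 mul0r eq_sym polyC_eq0 subr_eq0 => /eqP.
have : g %| ('X - (- c0.[0])%:P) ^+ q.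
  rewrite polyCN opprK frobenius_translate.
  apply/dvdpP; exists (ev 0 Q); have := evI0; rewrite el k1 scale1r => e0'.
  by rewrite -[RHS](subrK (c0.[0]%:P + 'X)) -e0' addrCA subrK addrC.
case/dvdp_exp_XsubCP=> [[|i] iq gi].
  by have := eqp_size gi; rewrite sg expr0 size_poly1; lia.
have := gN (- c0.[0]); rewrite -rootE (eqp_root gi) rootE horner_exp !hornerE subrr.
by rewrite expr0n eqxx.
Qed.

End Gap.

End PlaneCurve.

(** * Reduction of the case of few zeros to a plane *)

Section Gap.

Variable F : finFieldType.
Local Notation q := #|F|.

Lemma pd1_const n (f : 'rV[F]_n -> F) : pd 1 f -> exists c, f =1 (fun=> c).
Proof.
move=> pf; suff H k : pd k f -> k = 1%N -> exists c, f =1 (fun=> c) by move/H: pf; apply.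
elim=> {pf f k}.
- by move=> k f e _; exists 0.
- by move=> k c f e _; exists c.
- by move=> k b w f g pf _ e [k0]; exists 0 => x; rewrite e; move: pf; rewrite k0 => /pd_0->;
  rewrite mulr0.
- move=> k f g h _ IHf _ IHg e k1; case: (IHf k1) => c ec; case: (IHg k1) => c' ec'.
  by exists (c + c') => x; rewrite e ec ec'.
Qed.

Lemma pd2_affine n (f : 'rV[F]_n -> F) : pd 2 f -> exists b w, f =1 (fun x => b + lin w x).
Proof.
move=> pf; suff H k : pd k f -> k = 2%N -> exists b w, f =1 (fun x => b + lin w x) by move/H: pf;
  apply.
elim=> {pf f k}.
- by move=> k f e _; exists 0, 0 => x; rewrite e lin0l addr0.
- by move=> k c f e _; exists c, 0 => x; rewrite e lin0l addr0.
- move=> k b w f g pf _ e [k0]; move: pf; rewrite k0 => /pd1_const[c ec].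
  by exists (c * b), (c *: w) => x; rewrite e ec linZl -mulrDr mulrC.
- move=> k f g h _ IHf _ IHg e k1; case: (IHf k1) => b [w ec]; case: (IHg k1) => b' [w' ec'].
  by exists (b + b'), (w + w') => x; rewrite e ec ec' linDl addrACA.
Qed.

Lemma full_parallels_factor n k (g : 'rV[F]_(1 + n) -> F) w (s : seq F) : w != 0 -> uniq s ->
  pd (size s + k) g -> (forall c x, c \in s -> lin w x = c -> g x = 0) ->
  exists2 h, pd k h & forall x, g x = (\prod_(c <- s) (lin w x - c)) * h x.
Proof.
move=> w0; elim: s g => [|c s IH] g; first by move=> _ pg _; exists g => // x;
  rewrite big_nil mul1r.
move=> /andP[cs us] pg gs; case: (pd_factor (c := c) w0 pg) => [x wx|g' pg' eg].
  by apply: (gs c); rewrite ?inE ?eqxx.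
case: (IH g' us pg') => [c' x c's wx|h ph eh].
  have := eg x; rewrite (gs c' x) ?inE ?c's ?orbT // => /esym/eqP.
  rewrite mulf_eq0 subr_eq0 wx => /orP[/eqP e|/eqP //].
  by move: cs; rewrite -e c's.
by exists h => // x; rewrite eg eh big_cons mulrA.
Qed.

Lemma prod_neq0 (s : seq F) (t : F) : t \notin s -> \prod_(c <- s) (t - c) != 0.
Proof.
move=> ts; rewrite prodf_seq_neq0; apply/allP => c cs /=; rewrite subr_eq0.
by apply: contraNneq ts => ->.
Qed.

Lemma poly_of_slice d (h : 'rV[F]_(1 + 1) -> F) : pd d.+1 h ->
  exists a : nat -> {poly F}, (forall j, (size (a j) <= d.+1 - j)%N) /\
    forall t y, h (pt t (pt y 0)) = \sum_(j < d.+1) (a j).[y] * t ^+ j.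
Proof.
case/pd_slice=> a [pa ea].
have H (j : 'I_d.+1) : exists P : {poly F}, (size P <= d.+1 - j)%N /\
    forall y, a j (pt y (0 : 'rV_0)) = P.[y].
  case: (pd_slice (pa j : pd _ (a j : 'rV_(1 + 0) -> F))) => b [pb eb].
  exists (\poly_(i < d.+1 - j) b i 0); split; first exact: size_poly.
  by move=> y; rewrite eb horner_poly.
case: (fin_all_exists H) => P HP.
exists (fun j => if (j < d.+1)%N then P (inord j) else 0); split=> [j|t y].
  case: ltnP => jd; last by rewrite size_poly0.
  by case: (HP (inord j)) => + _; rewrite inordK.
rewrite ea; apply: eq_bigr => j _; rewrite ltn_ord inord_val.
by case: (HP j) => _ ->.
Qed.

Variables (n d : nat) (g : 'rV[F]_(1 + (1 + n)) -> F) (w : 'cV[F]_(1 + (1 + n))) (c : F).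
Hypotheses (d0 : (0 < d)%N) (dq : (d.+1 < q)%N) (w0 : w != 0) (pg : pd d.+1 g).
Let E := #|[set x | (lin w x == c) && (g x == 0)]|.
Hypotheses (Elt : (E < q ^ n)%N).
(** The count for the cofactor [g] of a second weight word (lin w - c) g of degree d + 1. *)
Hypothesis cZ : (#|zset g| + d * q ^ n = d * q ^ n.+1 + E)%N.

Let x_ c' := #|[set x | (lin w x == c') && (g x == 0)]|.
Let q0 : (0 < q)%N. Proof. exact: ltnW (q_gt1 F). Qed.
Let qn0 : (0 < q ^ n)%N. Proof. by rewrite expn_gt0 q0. Qed.

Let sum_x : (\sum_(c' | c' != c) x_ c' + d * q ^ n = d * q ^ n.+1)%N.
Proof.
have := sum_card_lin w (fun x => g x == 0); rewrite (bigD1 c) //= -/E => e.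
by apply/eqP; rewrite -(eqn_add2r E) -cZ (e : #|zset g| = _) addnC addnA.
Qed.

Let full c' := [forall x, (lin w x == c') ==> (g x == 0)].

Let c_notfull : ~~ full c.
Proof.
apply/negP => /forallP fc; move: Elt; rewrite ltnNge; case/negP.
apply: leq_trans (_ : q ^ n.+1 <= _)%N; first by rewrite leq_exp2l ?q_gt1.
rewrite -(card_lin c w0); apply: subset_leq_card; apply/subsetP => x.
by rewrite !inE => wx; rewrite wx; have := fc x; rewrite wx.
Qed.

(** If y > 0 parallels are full, dividing by them leaves degree d - y, so the other sections have at
    most (d - y) q^n zeros, and the total forces d = y + 1. The cofactor is then affine: if its form
    is independent of [w], the section at [c] has q^n zeros, against [Elt]; if not, the sections
    that are not full have no zeros and d = q. *)
Lemma gap_no_full c' : ~~ full c'.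
Proof.
apply/negP => fc'.
pose Y := [set c' | full c']; pose y := #|Y|.
have cY : c \notin Y by rewrite inE.
have y0 : (0 < y)%N by apply/card_gt0P; exists c'; rewrite inE.
have fY c1 x : c1 \in Y -> lin w x = c1 -> g x = 0.
  by rewrite inE => /forallP/(_ x) + /eqP wx; rewrite wx => /eqP.
have sumY : (y * q ^ n.+1 + \sum_(c' | (c' != c) && (c' \notin Y)) x_ c' + d * q ^ n = d * q ^
  n.+1)%N.
  rewrite -[RHS]sum_x; congr (_ + _)%N; rewrite [RHS](bigID (mem Y)) /=; congr (_ + _)%N.
  rewrite -sum_nat_const; apply: eq_big => [c1|c1 c1Y].
    by have [->|] := eqVneq c1 c; rewrite ?(negPf cY) ?andbT.
  rewrite -(card_lin c1 w0); apply: eq_card => x; rewrite !inE.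
  by case: eqP => // wx; rewrite (fY _ _ c1Y wx) eqxx.
have yd : (y <= d)%N.
  rewrite leqNgt; apply/negP => dy.
  have : (d.+1 * q ^ n.+1 <= y * q ^ n.+1)%N by rewrite leq_mul2r dy orbT.
  move: sumY; rewrite mulSn; have : (0 < q ^ n.+1)%N by rewrite expn_gt0 q0.
  by move: (q ^ n.+1)%N (y * _)%N (\sum_(_ | _) _)%N => A B D; lia.
have cYF : forall c1, c1 \notin Y -> exists2 x, lin w x = c1 & g x != 0.
  move=> c1; rewrite inE => /forallPn[x]; rewrite negb_imply => /andP[/eqP wx gx].
  by exists x.
have sY : size (enum Y) = y by rewrite -cardE.
case: (@full_parallels_factor _ (d - y).+1 g w (enum Y)) => //.
- exact: enum_uniq.
- by rewrite sY addnS subnKC.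
- by move=> c1 x; rewrite mem_enum; apply: fY.
move=> h ph eg.
have gh x : lin w x \notin Y -> (g x == 0) = (h x == 0).
  by move=> wx; rewrite eg mulf_eq0 (negPf (prod_neq0 _)) ?mem_enum.
have bnd c1 : c1 \notin Y -> (x_ c1 <= (d - y) * q ^ n)%N.
  move=> c1Y; rewrite -(leq_pmul2l q0) mulnCA -expnS.
  case: (cYF c1 c1Y) => x wx gx.
  have hx : h x != 0 by rewrite -gh ?wx.
  have := section_zeros w0 ph wx hx; congr (_ * _ <= _)%N; apply: eq_card => z.
  by rewrite !inE; case: eqP => // wz; rewrite gh ?wz.
have cc : #|[pred c' | (c' != c) && (c' \notin Y)]| = (q.-1 - y)%N.
  have := cardsC (c |: Y); rewrite cardsU1 cY => e.
  have -> : #|[pred c' | (c' != c) && (c' \notin Y)]| = #|~: (c |: Y)|.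
    by apply: eq_card => z; rewrite !inE negb_or.
  by move: e; rewrite -/y; move: #|~: _| => z; case: #|F| => // k; lia.
have sumle : (\sum_(c' | (c' != c) && (c' \notin Y)) x_ c' <= (q.-1 - y) * ((d - y) * q ^ n))%N.
  rewrite -cc -sum_nat_const; apply: leq_sum => c1 /andP[_]; exact: bnd.
have yd1 : (y.+1 = d)%N.
  have [k ek] : exists k, d = (y + k)%N by exists (d - y)%N; rewrite subnKC.
  have [m em] : exists m, q.-1 = (y + m)%N.
    by exists (q.-1 - y)%N; rewrite subnKC //; move: dq yd; case: #|F| => //= r; lia.
  have eq : q = (y + m).+1 by rewrite -em prednK.
  move: sumY sumle; rewrite expnS em ek !addKn.
  move: (\sum_(_ | _) _)%N (q ^ n)%N qn0 => A X X0 e1 e2.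
  have e3 : (A + (y + k) * X = k * (q * X))%N.
    by apply/eqP; rewrite -(eqn_add2l (y * (q * X))) addnA e1 -mulnDl.
  have : (q * k <= m * k + (y + k))%N.
    rewrite -(leq_pmul2r X0) mulnDl -mulnA mulnCA -e3 leq_add2r; apply: leq_trans e2 _.
    by rewrite mulnA.
  rewrite eq; move: e3; case: (k) => [|[|r]]; last by nia.
    by rewrite mul0n addn0 => /eqP; rewrite addn_eq0 muln_eq0; move: y0 X0; lia.
  by move=> _ _; rewrite addn1.
have ph2 : pd 2 h by move: ph; rewrite -yd1 subSn // subnn.
case: (pd2_affine ph2) => b [mu eh].
have xE c1 : c1 \notin Y -> x_ c1 = #|[set x | (lin w x == c1) && (lin mu x == - b)]|.
  move=> c1Y; apply: eq_card => x; rewrite !inE; case: eqP => // wx.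
  by rewrite gh ?wx // eh addrC addr_eq0.
case: (pickP (fun a => mu == a *: w)) => [a /eqP ea|/(_ _)/negbT ind]; last first.
  by move: Elt; rewrite [E](xE c cY) card_lin2 // ltnn.
have x0 c1 : c1 \notin Y -> x_ c1 = 0%N.
  move=> c1Y; case: (cYF c1 c1Y) => x wx gx; apply/eqP; rewrite xE // cards_eq0.
  apply/eqP/setP => z; rewrite !inE; case: eqP => //= wz; apply/negbTE.
  by move: gx; rewrite gh ?wx // eh ea !linZl wx wz addrC addr_eq0.
move: sumY; rewrite big1 => [|c1 /andP[_ c1Y]]; last exact: x0.
move: dq; rewrite addn0 expnS -yd1 => dq' /eqP.
rewrite [eqbRHS]mulSn [eqbRHS]addnC eqn_add2l eqn_pmul2r // => /eqP eq.
by move: dq'; rewrite -eq; lia.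
Qed.

(** The other parallels must have exactly d q^n zeros each. So there is a monic direction [v] in the
    kernel of [w], and every line along [v] off the hyperplane at [c] has d zeros. As E < q^n, some
    line along [v] inside it has none; this line and a transversal vector [u] span the plane for
    [plane_gap]. *)
Lemma hyperplane_gap : False.
Proof.
have bnd c' : (x_ c' <= d * q ^ n)%N.
  have := gap_no_full c' => /forallPn[x]; rewrite negb_imply => /andP[/eqP wx gx].
  by rewrite -(leq_pmul2l q0) mulnCA -expnS; apply: section_zeros w0 pg wx gx.
have xE c' : c' != c -> x_ c' = (d * q ^ n)%N.
  have H := @sum_eq_all _ (fun c' => if c' == c then (d * q ^ n)%N else x_ c') (fun=> (d * q ^
    n)%N).
  move=> c'c; have := H _ _ c'; rewrite (negPf c'c); apply.
    by move=> i; case: ifP.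
  rewrite sum_nat_const [leqRHS](bigD1 c) //= eqxx.
  rewrite (eq_bigr x_) => [|i /negPf->] //.
  by rewrite -(leq_add2r (d * q ^ n)) -addnA sum_x expnS mulnCA addnC.
case: (col0_unit w0) => M uM wM.
case: (pd_monic_dir_hyp (ltnW dq) pg wM) => [[v wv gv]|pc]; last first.
  have c1c : c + 1 != c by rewrite -subr_eq0 addrC addKr oner_neq0.
  have := gap_no_full (c + 1) => /forallPn[x]; rewrite negb_imply => /andP[/eqP wx gx].
  have := xE _ c1c; rewrite /x_ (card_slice (c + 1) (fun x => g x == 0) uM wM) => e.
  pose gr y := g (pt (c + 1) y *m M).
  have : (q * #|zset gr| <= d.-1 * q ^ n.+1)%N.
    apply: (@zero_bound _ _ _ _ (rsubmx (x *m invmx M))); last by rewrite prednK //; apply: pc.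
    rewrite /gr; suff -> : pt (c + 1) (rsubmx (x *m invmx M)) = x *m invmx M by rewrite mulmxKV.
    rewrite -[RHS]pt_submx; congr pt.
    by rewrite -wx -{1}[x](mulmxKV uM) -{1}[x *m _]pt_submx wM.
  rewrite (e : #|zset _| = _) mulnCA -expnS leq_pmul2r ?expn_gt0 ?q0 //.
  by move: d0; lia.
have av x t : lin w (x + t *: v) = lin w x by rewrite linD linZ wv mulr0 addr0.
have hl c' : (q * x_ c' = \sum_(x | lin w x == c') line_zeros g v x)%N.
  by apply: (@sum_line_zeros _ _ g v (fun x => lin w x == c')) => x t; rewrite av.
have nd x : lin w x != c -> line_zeros g v x = d.
  move=> wx.
  have H := @sum_eq_all _ (fun z => if lin w z == lin w x then line_zeros g v z else 0%N) (fun z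
    => if lin w z == lin w x then d else 0%N).
  have := H _ _ x; rewrite eqxx; apply; first by move=> z; case: ifP => // _; apply: line_zeros_le.
  rewrite -!big_mkcond -hl xE //= sum_nat_const mulnCA -expnS.
  rewrite -(card_lin (lin w x) w0) mulnC; apply: eq_leq; congr (_ * _)%N; apply: eq_card => z.
  by rewrite !inE.
have [x0 wx0 n0] : exists2 x0, lin w x0 = c & line_zeros g v x0 = 0%N.
  have [/existsP[x0 /andP[/eqP wx /eqP nx]]|/existsPn H] :=
    boolP [exists x0, (lin w x0 == c) && (line_zeros g v x0 == 0%N)]; first by exists x0.
  have : (q ^ n.+1 <= q * E)%N.
    rewrite -[E]/(x_ c) hl -(card_lin c w0) card_set [leqRHS]big_mkcond; apply: leq_sum => z _.
    by have := H z; case: (lin w z == c) => //=; rewrite lt0n.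
  by rewrite expnS leq_pmul2l // leqNgt Elt.
case: (lin_surj 1 w0) => u wu.
have p2 := pd_comp x0 (col_mx v u) pg.
case: (poly_of_slice p2) => a [sa ea].
have ept t y : pt t (pt y (0 : 'rV_0)) *m col_mx v u = t *: v + y *: u.
  rewrite /pt mul_row_col mul_scalar_mx; congr (_ + _).
  have -> : row_mx y%:M (0 : 'rV_0) = y%:M :> 'rV[F]_(1 + 0).
    by apply/rowP => i; rewrite [i]ord1 !mxE; case: splitP => [k _|[]//]; rewrite !mxE [k]ord1.
  by rewrite mul_scalar_mx.
case: gv => k k0 gv.
have adk y : (a d).[y] = k.
  case: (gv (x0 + y *: u)) => P sP eP.
  have : \poly_(j < d.+1) (a j).[y] - (k *: 'X^d + P) = 0; first apply: poly_fun_eq0.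
  - apply: leq_trans (size_polyD _ _) _; rewrite geq_max size_polyN.
    rewrite (leq_trans (size_poly _ _)) ?(ltnW dq) //= (leq_trans (size_polyD _ _)) // geq_max.
    rewrite (leq_trans (size_scale_leq _ _)) ?size_polyXn ?(ltnW dq) //=.
    by apply: leq_trans sP _; apply: ltnW; apply: ltnW.
  - move=> t; rewrite !hornerE -eP horner_poly -ea ept.
    by rewrite -addrA [t *: v + _]addrC subrr.
  move/polyP/(_ d); rewrite coefB coefD coefZ coefXn coef_poly ltnSn eqxx mulr1 coef0.
  by rewrite (nth_default _ sP) addr0 => /eqP; rewrite subr_eq0 => /eqP.
have ev y t : \sum_(j < d.+1) (k^-1 *: a j).[y] * t ^+ j = k^-1 * g (x0 + y *: u + t *: v).
  rewrite -addrA [_ *: u + _]addrC -ept ea mulr_sumr; apply: eq_bigr => j _.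
  by rewrite hornerZ mulrA.
apply: (@plane_gap F d (fun j => k^-1 *: a j)) => //.
- by move=> j; apply: leq_trans (size_scale_leq _ _) _.
- have : (size (a d) <= 1)%N by have := sa d; rewrite subSn // subnn.
  move=> /size1_polyC e; have := adk 0; rewrite e hornerC => ->.
  by rewrite -mul_polyC -polyCM mulVf.
- move=> y y0; rewrite -[RHS](nd (x0 + y *: u)); last first.
    by rewrite linD linZ wu wx0 mulr1 -subr_eq0 addrC addKr.
  by apply: eq_card => t; rewrite !inE ev mulf_eq0 invr_eq0 (negPf k0).
- move=> t; rewrite ev scale0r addr0 mulf_neq0 ?invr_eq0 //.
  have := n0 => /eqP; rewrite cards_eq0 => /eqP/setP/(_ t).
  by rewrite !inE => ->.
Qed.

End Gap.

(** * Classification for t = 0 *)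

Section Classification.

Variable F : finFieldType.
Local Notation q := #|F|.

Definition full n (f : 'rV[F]_n -> F) w c := forall x, lin w x = c -> f x = 0.

(** Through a point of both hyperplanes there is a line inside lin w3 = c3 that is transversal to
    the other one. There [g] vanishes at all other points, and its degree is less than q - 1, so it
    vanishes at the point as well. *)
Lemma full_factor n k (f g : 'rV[F]_n -> F) w1 c1 w3 c3 : (k.+1 < q)%N -> w1 != 0 ->
  pd k.+1 g -> (forall x, f x = (lin w1 x - c1) * g x) -> (forall a, w3 != a *: w1) ->
  full f w3 c3 -> full g w3 c3.
Proof.
move=> kq w10 pg fg ind ff x wx.
have [e|ne] := eqVneq (lin w1 x) c1; last first.
  by have := ff x wx; rewrite fg => /eqP; rewrite mulf_eq0 subr_eq0 (negPf ne) => /eqP.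
case: (lin_surj2 1 0 w10 ind) => u [u1 u3].
case: (pd_line pg) => T HT; case: (HT x u) => P sP eP.
have gt t : t != 0 -> g (x + t *: u) = 0.
  move=> t0; have := ff (x + t *: u); rewrite linD linZ u3 mulr0 addr0 => /(_ wx).
  rewrite fg linD linZ u1 e mulr1 addrC addKr => /eqP.
  by rewrite mulf_eq0 (negPf t0) => /eqP.
have : T u *: 'X^k + P = 0.
  apply: vanish_nonzero_small => [t t0|]; first by rewrite !hornerE -eP gt.
  apply: leq_ltn_trans (size_polyD _ _) _; rewrite gtn_max.
  rewrite (leq_ltn_trans (size_scale_leq _ _)) ?size_polyXn //.
  by apply: leq_ltn_trans sP _; apply: ltn_trans kq.
move/(congr1 (horner^~ 0)); rewrite !hornerE -eP scale0r addr0; exact.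
Qed.

Lemma cards_pair n (w w' : 'cV[F]_(1 + (1 + n))) (P : F -> F -> bool) :
  w != 0 -> (forall a, w' != a *: w) ->
  #|[set x | P (lin w x) (lin w' x)]| = (q ^ n * \sum_a #|[set b | P a b]|)%N.
Proof.
move=> w0 ind; rewrite (sum_card_lin w) big_distrr /=; apply: eq_bigr => a _.
rewrite (sum_card_lin w') card_set big_distrr /=; apply: eq_bigr => b _.
case Pab: (P a b); rewrite ?muln1 ?muln0.
  rewrite -(card_lin2 a b w0 ind); apply: eq_card => x; rewrite !inE.
  by case: eqP => [->|]; case: eqP => [->|]; rewrite ?Pab.
apply/eqP; rewrite cards_eq0; apply/eqP/setP => x; rewrite !inE.
by case: eqP => [->|//]; case: eqP => [->|//]; rewrite Pab.
Qed.

Variable n : nat.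
Implicit Types f g : 'rV[F]_(1 + (1 + n)) -> F.

Let q0 : (0 < q)%N. Proof. exact: ltnW (q_gt1 F). Qed.
Let Q0 : (0 < q ^ n)%N. Proof. by rewrite expn_gt0 q0. Qed.

(* The weight (q - s + 1)(q - 1) q^n, for the number of zeros and without subtraction. *)
Definition sec_word s f := (#|zset f| + s.-1 * q ^ n = s * q ^ n.+1)%N.
Definition min_wd s f := (#|zset f| = s * q ^ n.+1)%N.

Lemma sec_nonzero s f : (0 < s < q)%N -> sec_word s f -> exists x, f x != 0.
Proof.
case/andP=> s0 sq e; apply/existsP; rewrite -negb_forall; apply/negP => /forallP f0.
have cZ : #|zset f| = (q * q ^ n.+1)%N.
  by rewrite -expnS -card_rV -cardsT; apply: eq_card => x; rewrite !inE f0.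
have : (s * q ^ n.+1 < q * q ^ n.+1)%N by rewrite ltn_pmul2r // expn_gt0 q0.
by rewrite -e cZ ltnNge leq_addr.
Qed.

(** [E] is the overlap of the hyperplane with the zeros of [g]. The possible numbers of zeros of [g]
    give E = d q^n or E <= q^n, and [hyperplane_gap] excludes E < q^n. *)
Lemma split_second d f g w c : (0 < d)%N -> (d.+2 < q)%N -> w != 0 ->
  pd d.+1 g -> (forall x, f x = (lin w x - c) * g x) -> sec_word d.+1 f ->
  let E := #|[set x | (lin w x == c) && (g x == 0)]| in
  (min_wd d g /\ E = d * q ^ n)%N \/ (sec_word d g /\ E = q ^ n)%N.
Proof.
move=> d0 dq w0 pg fg sf E.
have cZ : (#|zset g| + d * q ^ n = d * q ^ n.+1 + E)%N.
  have eZ : zset f = [set x | lin w x == c] :|: zset g.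
    by apply/setP => x; rewrite !inE fg mulf_eq0 subr_eq0.
  have := cardsUI [set x | lin w x == c] (zset g); rewrite -eZ card_lin //.
  have -> : #|[set x | lin w x == c] :&: zset g| = E by apply: eq_card => x; rewrite !inE.
  move=> e; apply/eqP; rewrite -(eqn_add2l (q ^ n.+1)) !addnA -e addnAC.
  by rewrite (sf : (_ + d * _ = _)%N) mulSn addnA.
have [|x fx] := sec_nonzero _ sf; first by apply/andP; split=> //; apply: ltnW.
have gx : g x != 0 by apply: contraNneq fx => e; rewrite fg e mulr0.
have dq2 : (0 < d < q)%N by rewrite d0 /=; apply: ltn_trans dq; apply: ltnW.
case: (second_weight dq2 pg gx) => H; first by left; split=> //; move: cZ; rewrite H => /addnI.
right; have E1 : (E <= q ^ n)%N.
  rewrite -(leq_add2l (d * q ^ n.+1)) -cZ -(prednK d0) mulSn prednK //.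
  by rewrite addnCA addnC leq_add2r.
have E2 : (q ^ n <= E)%N.
  by rewrite leqNgt; apply/negP => Elt; apply: (hyperplane_gap d0 (ltnW dq) w0 pg Elt cZ).
have eE : E = (q ^ n)%N by apply/eqP; rewrite eqn_leq E1.
split=> //; rewrite /sec_word; apply/eqP; rewrite -(eqn_add2l (q ^ n)) addnCA -mulSn prednK //.
by rewrite cZ eE addnC.
Qed.

Lemma min_wd_full s f x : (s < q)%N -> pd s.+1 f -> min_wd s f -> f x = 0 ->
  exists2 w, w != 0 & full f w (lin w x).
Proof.
move=> sq pf mf fx; case: (min_word sq pf mf) => w [C [w0 _ fC]]; exists w => //.
by move=> z wz; apply/eqP; rewrite fC wz -fC fx.
Qed.

Lemma sec_word_full s f x : (0 < s)%N -> (s.+1 < q)%N -> pd s.+1 f -> sec_word s f ->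
  f x = 0 -> exists2 w, w != 0 & full f w (lin w x).
Proof.
elim: s f x => // s IH f x _ sq pf sf fx.
(* For order 1 the condition [sec_word] coincides with [min_wd], which starts the induction. *)
have [s0|s0] := posnP s.
  move: sf; rewrite /sec_word s0 addn0 => mf; rewrite s0 in pf sq.
  by apply: min_wd_full mf fx => //; apply: ltnW.
case: (second_word_hyperplane _ sq pf sf) => // w [c [w0 fw]].
case: (pd_factor w0 pf fw) => g pg fg.
have [ex|wx] := eqVneq (lin w x) c; first by exists w; rewrite ?ex.
have gx : g x = 0.
  by move: fx; rewrite fg => /eqP; rewrite mulf_eq0 subr_eq0 (negPf wx) => /eqP.
have [w' w'0 gw'] : exists2 w', w' != 0 & full g w' (lin w' x).
  case: (split_second s0 sq w0 pg fg sf) => [] [mg _].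
    by apply: min_wd_full mg gx => //; apply: ltn_trans sq; apply: ltnW.
  by apply: IH => //; apply: ltnW.
by exists w' => // z /gw' gz; rewrite fg gz mulr0.
Qed.

(** The complement of the first shape of the support: the q - s + 1 values outside [C] give its
    parallel subspaces. *)
Definition typeI s f := exists w' c' w (C : {set F}),
  [/\ w != 0, forall a, w' != a *: w, #|C| = s.-1 &
     forall x, (f x == 0) = (lin w' x == c') || (lin w x \in C)].

(** A pencil with axis lin w = c, lin w' = c'. [C] holds the slopes of the zero hyperplanes other
    than lin w = c; the q - s + 1 other slopes give the second shape of the support. *)
Definition typeII s f := exists w c w' c' (C : {set F}),
  [/\ w != 0, forall a, w' != a *: w, #|C| = s.-1 &
     forall x, (f x == 0) = (lin w x == c) ||
       [exists b in C, lin w' x - c' == b * (lin w x - c)]].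

(** If [w'] were parallel to [w], the common zeros would number q^(n+1) or 0, never d q^n. *)
Lemma min_typeI d f g w c : (0 < d < q)%N -> w != 0 ->
  pd d.+1 g -> (forall x, f x = (lin w x - c) * g x) -> min_wd d g ->
  #|[set x | (lin w x == c) && (g x == 0)]| = (d * q ^ n)%N -> typeI d.+1 f.
Proof.
case/andP=> d0 dq w0 pg fg mg E; case: (min_word dq pg mg) => w' [C [w'0 cC gC]].
exists w, c, w', C; split=> //; last first.
  by move=> x; rewrite fg mulf_eq0 subr_eq0 gC.
move=> a; apply/eqP => ew.
have a0 : a != 0 by apply: contraNneq w0 => a0; rewrite ew a0 scale0r.
have w'E x : lin w x == c -> lin w' x = c / a.
  by move=> /eqP <-; rewrite ew linZl mulrC mulKf.
have [cC'|cC'] := boolP (c / a \in C).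
  move: E; have -> : #|[set x | (lin w x == c) && (g x == 0)]| = (q ^ n.+1)%N.
    rewrite -(card_lin c w0); apply: eq_card => x; rewrite !inE.
    by case: (boolP (lin w x == c)) => // /w'E wx; rewrite gC wx.
  by rewrite expnS => /eqP; rewrite eqn_pmul2r // => /eqP qd; move: dq; rewrite qd ltnn.
move: E; have -> : #|[set x | (lin w x == c) && (g x == 0)]| = 0%N.
  apply/eqP; rewrite cards_eq0; apply/eqP/setP => x; rewrite !inE.
  by case: (boolP (lin w x == c)) => // /w'E wx; rewrite gC wx (negPf cC').
by move/esym/eqP; rewrite muln_eq0; move: d0 Q0; lia.
Qed.

Lemma pencil (w1 w2 w3 : 'cV[F]_(1 + (1 + n))) c1 c2 c3 :
  w1 != 0 -> (forall a, w2 != a *: w1) ->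
  (forall x, lin w1 x = c1 -> lin w2 x = c2 -> lin w3 x = c3) ->
  exists a b, forall x, lin w3 x - c3 = a * (lin w1 x - c1) + b * (lin w2 x - c2).
Proof.
move=> w10 ind K.
case: (lin_surj2 1 0 w10 ind) => e1 [e11 e12]; case: (lin_surj2 0 1 w10 ind) => e2 [e21 e22].
exists (lin w3 e1), (lin w3 e2) => x.
have := K (x - (lin w1 x - c1) *: e1 - (lin w2 x - c2) *: e2).
rewrite !linB !linZ e11 e12 e21 e22 !mulr1 !mulr0 !subr0 => /(_ _ _) <-.
- by ring.
- by ring.
- by ring.
Qed.

Lemma classification s f : (1 < s)%N -> (s.+1 < q)%N -> pd s.+1 f -> sec_word s f ->
  typeI s f \/ typeII s f.
Proof.
case: s => // d d0 dq pf sf; rewrite ltnS in d0.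
have ddq : (0 < d < q)%N by rewrite d0; apply: ltn_trans dq; apply: ltnW.
case: (second_word_hyperplane _ dq pf sf) => // w1 [c1 [w10 f1]].
case: (pd_factor w10 pf f1) => g1 pg1 fg1.
case: (split_second d0 dq w10 pg1 fg1 sf) => [] [sg1 E1].
  by left; apply: min_typeI fg1 sg1 E1.
have [x] : exists x, x \in [set x | (lin w1 x == c1) && (g1 x == 0)].
  by apply/card_gt0P; rewrite E1.
rewrite inE => /andP[/eqP w1x /eqP g1x].
case: (sec_word_full d0 (ltnW dq) pg1 sg1 g1x) => w2 w20 g1f.
set c2 := lin w2 x in g1f.
have ind : forall a, w2 != a *: w1.
  move=> a; apply/eqP => ew; have a0 : a != 0 by apply: contraNneq w20 => a0; rewrite ew a0 scale0r.
  have : (q ^ n.+1 <= q ^ n)%N.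
    rewrite -E1 -(card_lin c1 w10); apply: subset_leq_card; apply/subsetP => z.
    rewrite !inE => wz; rewrite wz; apply/eqP/g1f.
    by rewrite /c2 ew !linZl w1x (eqP wz).
  by rewrite leq_exp2l ?q_gt1 // ltnn.
have f2 : full f w2 c2 by move=> z wz; rewrite fg1 g1f ?mulr0.
have ind' a : w1 != a *: w2.
  apply/eqP => ew; have a0 : a != 0 by apply: contraNneq w10 => a0; rewrite ew a0 scale0r.
  by have /eqP := ind a^-1; apply; rewrite ew scalerA mulVf ?scale1r.
case: (pd_factor w20 pf f2) => g2 pg2 fg2.
case: (split_second d0 dq w20 pg2 fg2 sf) => [] [sg2 E2].
  by left; apply: min_typeI fg2 sg2 E2.
right.
have dq' : (d.+1 < q)%N := ltnW dq.
(* The axis consists of zeros of [g1] and has q^n points, which is all that [E1] allows. *)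
have K z : lin w1 z = c1 -> g1 z = 0 -> lin w2 z = c2.
  move=> w1z g1z; have : [set z | (lin w1 z == c1) && (lin w2 z == c2)] \subset
      [set z | (lin w1 z == c1) && (g1 z == 0)].
    by apply/subsetP => y; rewrite !inE => /andP[-> /eqP/g1f->]; rewrite eqxx.
  move/subset_cardP; rewrite card_lin2 // E1 => /(_ erefl)/(_ z).
  by rewrite !inE w1z g1z !eqxx /= => /eqP.
(* A second hyperplane of zeros parallel to the first would give [g2] two disjoint sets of q^n zeros
   on lin w2 = c2, against [E2]. A hyperplane of zeros that is not parallel meets the first one in
   zeros of [g1], that is, in the axis. *)
have H3 w3 c3 : w3 != 0 -> full f w3 c3 -> (exists2 a, w3 = a *: w1 & c3 = a * c1) \/
    ((forall a, w3 != a *: w1) /\ forall z, lin w1 z = c1 -> lin w2 z = c2 -> lin w3 z = c3).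
  move=> w30 f3; case: (pickP (fun a => w3 == a *: w1)) => [a /eqP ea|/(_ _)/negbT ind3].
    left; exists a => //; apply/eqP/negPn/negP => nc.
    have a0 : a != 0 by apply: contraNneq w30 => a0; rewrite ea a0 scale0r.
    have g21 : full g2 w1 c1 := full_factor dq' w20 pg2 fg2 ind' f1.
    have g23 : full g2 w3 c3.
      apply: full_factor dq' w20 pg2 fg2 _ f3 => b; apply/eqP => eb.
      have /eqP := ind' (a^-1 * b); apply.
      by rewrite -scalerA -eb ea scalerA mulVf ?scale1r.
    have : (q ^ n + q ^ n <= q ^ n)%N.
      rewrite -{3}E2 -{1}(card_lin2 c2 c1 w20 ind').
      rewrite -(card_lin2 c2 (c3 / a) w20 ind').
      rewrite -cardsUI [X in (_ + X)%N](_ : _ = 0%N) ?addn0.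
        apply: subset_leq_card; apply/subsetP => z;
          rewrite !inE -andb_orr => /andP[-> /orP[/eqP/g21->|/eqP wz]].
          by rewrite eqxx.
        by rewrite g23 ?eqxx // ea linZl wz mulrC divfK.
      apply/eqP; rewrite cards_eq0; apply/eqP/setP => z; rewrite !inE.
      apply/negbTE; apply: contra nc => /andP[/andP[_ /eqP <-] /andP[_ /eqP ->]].
      by rewrite mulrC divfK.
    by rewrite -{3}[(q ^ n)%N]addn0 leq_add2l leqNgt Q0.
  right; split=> // z w1z w2z.
  have g13 : full g1 w3 c3 := full_factor dq' w10 pg1 fg1 ind3 f3.
  have : [set z | (lin w1 z == c1) && (lin w3 z == c3)] \subset
      [set z | (lin w1 z == c1) && (lin w2 z == c2)].
    apply/subsetP => y; rewrite !inE => /andP[/eqP w1y /eqP/g13 g1y].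
    by rewrite w1y K ?eqxx.
  move/subset_cardP; rewrite !card_lin2 // => /(_ erefl)/(_ z).
  by rewrite !inE w1z w2z !eqxx /= => /eqP.
pose C := [set b | [forall z, (lin w2 z - c2 == b * (lin w1 z - c1)) ==> (f z == 0)]].
have fC z : (f z == 0) = (lin w1 z == c1) || [exists b in C, lin w2 z - c2 == b * (lin w1 z - c1)].
  apply/idP/orP => [/eqP fz|[/eqP/f1->|/existsP[b /andP[]]]]; last 2 first.
  - by rewrite eqxx.
  - by rewrite inE => /forallP/(_ z)/implyP; apply.
  case: (sec_word_full (ltn0Sn d) dq pf sf fz) => w3 w30 f3.
  case: (H3 w3 _ w30 f3) => [[a ea eca]|[ind3 Kz]].
    left; have a0 : a != 0 by apply: contraNneq w30 => a0; rewrite ea a0 scale0r.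
    by apply/eqP/(mulfI a0); rewrite -eca ea linZl.
  case: (pencil w10 ind Kz) => a [b ab].
  have b0 : b != 0.
    apply/negP => /eqP b0; have /eqP := ind3 a; apply.
    case: (lin_surj2 c1 c2 w10 ind) => y [y1 y2].
    apply/colP => i; have := ab (y + delta_mx 0 i); have := ab y.
    rewrite b0 y1 y2 !subrr !mulr0 !mul0r !addr0 => e1.
    rewrite !linD y1 addrAC e1 addrAC subrr !add0r /lin -!rowE !mxE; exact.
  (* The slope of the hyperplane a (w1 - c1) + b (w2 - c2) = 0. *)
  right; apply/existsP; exists (- a / b); rewrite inE.
  have E y : lin w2 y - c2 = - a / b * (lin w1 y - c1) <-> lin w3 y = lin w3 z.
    have := ab y; set X := lin w1 y - c1; set Y := lin w2 y - c2 => e.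
    split=> [eY|/eqP]; first by apply/eqP; rewrite -subr_eq0 e eY; apply/eqP; field.
    rewrite -subr_eq0 e addrC addr_eq0 => /eqP e'.
    by apply: (mulfI b0); rewrite e'; field.
  apply/andP; split; last by apply/eqP/E.
  by apply/forallP => y; apply/implyP => /eqP/E/f3->.
exists w1, c1, w2, c2, C; split=> //=.
have := sf; rewrite /sec_word.
(* Among the pairs of values of [w1] and [w2], the line at c1 contributes q and each of the q - 1
   others |C|; the second weight then determines |C|. *)
have -> : #|zset f| = (q ^ n * (q + q.-1 * #|C|))%N.
  pose P a b := (a == c1) || [exists c in C, b - c2 == c * (a - c1)].
  rewrite -[zset f]/[set z | f z == 0].
  have -> : #|[set z | f z == 0]| = #|[set z | P (lin w1 z) (lin w2 z)]|.
    by apply: eq_card => z; rewrite !inE fC.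
  rewrite (cards_pair P w10 ind); congr (_ * _)%N.
  rewrite (bigD1 c1) //=; congr (_ + _)%N.
    by apply: eq_card => b; rewrite inE /P eqxx.
  rewrite (eq_bigr (fun=> #|C|)) => [|a ac].
    by rewrite sum_nat_const cardC1.
  have ac0 : a - c1 != 0 by rewrite subr_eq0.
  have inj : injective (fun c => c * (a - c1) + c2) by move=> c c' /addIr/(mulIf ac0).
  rewrite -(card_imset (mem C) inj); apply: eq_card => b; rewrite inE /P (negPf ac) /=.
  apply/existsP/imsetP => [[c /andP[cC]]|[c cC ->]].
    by rewrite subr_eq => /eqP->; exists c.
  by exists c; rewrite addrK eqxx andbT.
rewrite expnS => /eqP; rewrite mulnC -mulnDl mulnA eqn_pmul2r // => /eqP.
move: (q_gt1 F); case: #|F| => [|[|k]] // _ /= e.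
by apply/eqP; rewrite -(eqn_pmul2l (ltn0Sn k)); apply/eqP; move: e; move: #|C| => z; nia.
Qed.

End Classification.

(** * Reduction to a flat of codimension t *)

Section Flats.

Variable F : finFieldType.
Local Notation q := #|F|.
Variable n : nat.
Local Notation N := (1 + (1 + n))%N.

Let q0 : (0 < q)%N. Proof. exact: ltnW (q_gt1 F). Qed.
Let Q0 : (0 < q ^ n)%N. Proof. by rewrite expn_gt0 q0. Qed.

(** Up to a constant [f] is the product of the forms lin w - c for c in [C], and each of these also
    divides [f1]. *)
Lemma div_min s (f f1 : 'rV[F]_N -> F) : (s < q)%N -> pd s.+1 f -> min_wd s f ->
  pd s.+2 f1 -> (forall x, f x = 0 -> f1 x = 0) ->
  exists2 a, pd 2 a & forall x, f1 x = f x * a x.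
Proof.
move=> sq pf mf pf1 f10; case: (min_word sq pf mf) => w [C [w0 cC fC]].
have fc (c : F) x : c \in enum C -> lin w x = c -> f x = 0.
  by rewrite mem_enum => cC' wx; apply/eqP; rewrite fC wx.
have sC : size (enum C) = s by rewrite -cardE.
case: (@full_parallels_factor _ _ 1 f w (enum C) w0 (enum_uniq _) _ fc) => [|h ph eh].
  by rewrite sC addn1.
case: (@full_parallels_factor _ _ 2 f1 w (enum C) w0 (enum_uniq _)) => [||a pa ea].
- by rewrite sC addn2.
- by move=> c x cC' wx; apply: f10; apply: fc wx.
case: (pd1_const ph) => k hk.
have [|k0] := eqVneq k 0.
  move=> k0; exists a => // x; rewrite f10 ?eh ?hk ?k0 ?mulr0 ?mul0r //.
exists (fun x => k^-1 * a x) => [|x]; first exact: pd_scale.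
by rewrite ea eh hk -mulrA mulVKf.
Qed.

(** A hyperplane of zeros is divided out of both functions, and the induction needs [g1] to vanish
    where [g] does. Off that hyperplane this is clear; on it, a zero of [g] lies on a hyperplane of
    zeros of [g] that is not parallel to it, and [full_factor] applies to [g1]. *)
Lemma div_sec s (f f1 : 'rV[F]_N -> F) : (0 < s)%N -> (s.+1 < q)%N -> pd s.+1 f ->
  sec_word s f -> pd s.+2 f1 -> (forall x, f x = 0 -> f1 x = 0) ->
  exists2 a, pd 2 a & forall x, f1 x = f x * a x.
Proof.
elim: s f f1 => // d IH f f1 _ dq pf sf pf1 f10.
have [d0|d0] := posnP d.
  move: sf; rewrite /sec_word d0 addn0 => mf; rewrite d0 in pf dq pf1.
  by apply: (div_min _ pf mf pf1 f10); apply: ltnW.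
case: (second_word_hyperplane _ dq pf sf) => // w [c [w0 fw]].
case: (pd_factor w0 pf fw) => g pg fg.
have f1w : full f1 w c by move=> x /fw/f10.
case: (pd_factor w0 pf1 f1w) => g1 pg1 fg1.
have sp := split_second d0 dq w0 pg fg sf.
have g10 x : g x = 0 -> g1 x = 0.
  move=> gx; have [w' w'0 gw'] : exists2 w', w' != 0 & full g w' (lin w' x).
    case: sp => [] [mg _].
      by apply: min_wd_full mg gx => //; apply: ltn_trans dq; apply: ltnW.
    by apply: (sec_word_full d0 (ltnW dq) pg mg gx).
  have f1x : f1 x = 0 by apply: f10; rewrite fg gx mulr0.
  have [wx|wx] := eqVneq (lin w x) c; last first.
    by move/eqP: f1x; rewrite fg1 mulf_eq0 subr_eq0 (negPf wx) => /eqP.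
  case: (pickP (fun a => w' == a *: w)) => [a /eqP ea|/(_ _)/negbT ind].
    have E : #|[set x | (lin w x == c) && (g x == 0)]| = (q ^ n.+1)%N.
      rewrite -(card_lin c w0); apply: eq_card => z; rewrite !inE.
      by case: eqP => // wz; rewrite gw' ?eqxx // ea !linZl wz wx.
    move: sp; rewrite /= E expnS => -[] [_ /eqP].
      by rewrite eqn_pmul2r // => /eqP qd; move: dq; rewrite qd; lia.
    by rewrite -[eqbRHS]mul1n eqn_pmul2r // => /eqP qd; move: dq; rewrite qd; lia.
  apply: (full_factor dq w0 pg1 fg1 ind (c3 := lin w' x)) => // z wz.
  by apply: f10; rewrite fg gw' ?mulr0.
have [a pa ea] : exists2 a, pd 2 a & forall x, g1 x = g x * a x.
  case: sp => [] [mg _].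
    by apply: div_min mg pg1 g10 => //; apply: ltn_trans dq; apply: ltnW.
  by apply: IH => //; apply: ltnW.
by exists a => // x; rewrite fg1 fg ea mulrA.
Qed.

(* [f] lives on an affine subspace of dimension [N], and has degree [<= s] there. *)
Definition flat_word s m (f : 'rV[F]_m -> F) := exists p (M : 'M[F]_(N, m)),
  [/\ row_free M, forall x, f x != 0 -> exists y, x = p + y *m M &
      pd s.+1 (fun y => f (p + y *m M))].

Lemma pt_lin m (w : 'cV[F]_(1 + m)) (M : 'M[F]_(1 + m)) x : M \in unitmx ->
  (forall t y, lin w (pt t y *m M) = t) -> x = pt (lin w x) (rsubmx (x *m invmx M)) *m M.
Proof.
move=> uM wM; have {1}-> : lin w x = lsubmx (x *m invmx M) 0 0.
  by rewrite -{1}[x](mulmxKV uM) -{1}[x *m invmx M]pt_submx wM.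
by rewrite pt_submx mulmxKV.
Qed.

Lemma flat_aff s m (f : 'rV[F]_m -> F) p (M : 'M[F]_m) : M \in unitmx ->
  flat_word s (fun z => f (p + z *m M)) -> flat_word s f.
Proof.
move=> uM [p' [M' [rM' sM' pM']]]; exists (p + p' *m M), (M' *m M); split.
- by rewrite /row_free mxrankMfree // row_free_unit.
- move=> x fx; case: (sM' ((x - p) *m invmx M)) => [|y ey].
    by rewrite mulmxKV // addrC subrK.
  by exists y; rewrite mulmxA -addrA -mulmxDl -ey mulmxKV // addrC subrK.
- by apply: pd_ext pM' _ => y; rewrite mulmxDl addrA mulmxA.
Qed.

Lemma flat_hyper s m (h : 'rV[F]_(1 + m) -> F) (M : 'M[F]_(1 + m)) w b :
  M \in unitmx -> (forall t y, lin w (pt t y *m M) = t) -> (forall z, lin w z != b -> h z = 0) ->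
  flat_word s (fun y => h (pt b y *m M)) -> flat_word s h.
Proof.
move=> uM wM hw [p [M' [rM' sM' pM']]].
exists (pt b p *m M), (row_mx 0 M' *m M).
have e y : pt b p *m M + y *m (row_mx 0 M' *m M) = pt b (p + y *m M') *m M.
  by rewrite mulmxA mul_mx_row mulmx0 -mulmxDl /pt add_row_mx addr0.
split.
- rewrite /row_free mxrankMfree ?row_free_unit //.
  by rewrite rank_row_0mx.
- move=> x hx; have wx : lin w x = b by apply/eqP; apply: contraR hx => /hw->; rewrite eqxx.
  have xE : x = pt b (rsubmx (x *m invmx M)) *m M by rewrite -wx; apply: pt_lin.
  have [y ey] : exists y, rsubmx (x *m invmx M) = p + y *m M' by apply: sM'; rewrite -xE.
  by exists y; rewrite e -ey.
by apply: pd_ext pM' _ => y; rewrite e.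
Qed.

Lemma push_fiber m (h : 'rV[F]_(1 + m) -> F) y : push h y != 0 ->
  (0 < #|[set t | (h (pt t y) != 0)%R]|)%N.
Proof.
move=> hy; rewrite card_gt0; apply: contraNneq hy => h0.
apply/eqP; apply: big1 => t _; apply/eqP; have : t \notin set0 by rewrite inE.
by rewrite -h0 inE negbK.
Qed.

(** A fibre with nonzero sum has at least one point in the support of [h] and none in that of the
    product. *)
Lemma push_split m (h l : 'rV[F]_(1 + m) -> F) :
  (forall t y, push h y != 0 -> l (pt t y) = 0) ->
  (#|supp (fun z => h z * l z)%R| + #|supp (push h)| <= #|supp h|)%N.
Proof.
move=> hl; rewrite !card_pt_supp card_set -big_split /=; apply: leq_sum => y _.
have [hy|hy] := boolP (push h y != 0).
  rewrite (_ : [set t | _] = set0) ?cards0 ?push_fiber //.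
  by apply/setP => t; rewrite !inE hl ?mulr0 ?eqxx.
rewrite addn0; apply: subset_leq_card; apply/subsetP => t; rewrite !inE.
by rewrite mulf_eq0 negb_or => /andP[].
Qed.

Variable s : nat.
Hypotheses (s1 : (1 < s)%N) (sq : (s.+1 < q)%N).
(** The second weight, written as the minimum weight plus (s - 1) q^n. *)
Let W := ((q - s) * q ^ n.+1 + s.-1 * q ^ n)%N.

Lemma flat_graph m (h : 'rV[F]_(1 + m) -> F) b mu :
  (forall t y, h (pt t y) != 0 -> t = b + lin mu y) ->
  exists w (M : 'M[F]_(1 + m)), [/\ M \in unitmx, w != 0,
     forall t y, lin w (pt t y *m M) = t & forall z, lin w z != b -> h z = 0].
Proof.
move=> hg; pose w : 'cV[F]_(1 + m) := col_mx 1%:M (- mu).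
have lw t y : lin w (pt t y) = t - lin mu y.
  by rewrite lin_pt col_mxKu col_mxKd mxE eqxx mul1r -[- mu]scaleN1r linZl mulN1r.
have w0 : w != 0.
  apply/eqP => w0; have := lw 1 0; rewrite w0 lin0l lin0 subr0 => /eqP.
  by rewrite eq_sym oner_eq0.
case: (col0_unit w0) => M uM wM; exists w, M; split=> // z wz.
apply/eqP; apply: contraR wz; rewrite -[z]pt_submx => /hg ->.
by rewrite lw addrK.
Qed.

Lemma flat_one (h : 'rV[F]_(1 + N) -> F) y0 : pd (q.-1 + s).+1 h ->
  push h y0 != 0 -> (#|supp h| <= W)%N -> flat_word s h.
Proof.
move=> ph hy0 cW.
have s0 : (0 < s)%N := ltnW s1.
have sq' : (s < q)%N := ltnW sq.
have ph' : pd s.+1 (push h) by have := pd_push ph; rewrite -addnS addKn.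
have cS := card_zset_supp (push h).
have le := push_supp h.
have s0q : (0 < s < q)%N by rewrite s0.
have qE : (s * q ^ n.+1 + (q - s) * q ^ n.+1 = q ^ N)%N.
  by rewrite -mulnDl subnKC // ltnW.
have typ : min_wd s (push h) \/ (sec_word s (push h) /\ #|supp (push h)| = W).
  case: (second_weight s0q ph' hy0) => H; [by left|right].
  have WS : (W <= #|supp (push h)|)%N.
    rewrite -(leq_add2l #|zset (push h)|) cS -qE /W.
    by rewrite [((q - s) * _ + _)%N]addnC (addnA #|zset _|) leq_add2r.
  have e : #|supp (push h)| = W.
    by apply/eqP; rewrite eqn_leq WS andbT (leq_trans le).
  split=> //; rewrite /sec_word; apply/eqP.
  rewrite -(eqn_add2r ((q - s) * q ^ n.+1)) qE -cS e /W.
  by rewrite [((q - s) * _ + _)%N]addnC (addnA #|zset _|).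
(* Equality means at most one nonzero value per fibre. Multiplying [h] by the fibre coordinate
   before summing multiplies the sum at y by the position of that point; by divisibility this
   position is an affine function of y. *)
have [e|ne] := eqVneq #|supp (push h)| #|supp h|.
  have Ny y : #|[set t | (h (pt t y) != 0)%R]| = (push h y != 0)%R.
    have := @sum_eq_all _ (fun y => (push h y != 0)%R : nat) (fun y => #|[set t | (h (pt t y) !=
      0)%R]|).
    move=> H; rewrite -H // => [z|]; last by rewrite -card_pt_supp -card_set -/(supp _) e.
    by case: (boolP (push h z != 0)) => // /push_fiber.
  pose h1 (z : 'rV[F]_(1 + N)) := lin (col_mx 1%:M 0) z * h z.
  have l1 t y : lin (col_mx 1%:M 0 : 'cV_(1 + N)) (pt t y) = t.
    by rewrite lin_pt col_mxKu col_mxKd lin0l addr0 mxE eqxx mul1r.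
  have ph1 : pd s.+2 (push h1).
    have := pd_push (pd_affM (b := 0) (w := col_mx 1%:M 0) ph (g := h1) _).
    have -> : ((q.-1 + s).+2 - q.-1 = s.+2)%N by rewrite -!addnS addKn.
    by apply=> z; rewrite add0r.
  have h10 y : push h y = 0 -> push h1 y = 0.
    move=> hy; rewrite /push big1 // => t _; have := Ny y; rewrite hy eqxx /= => /eqP.
    by rewrite cards_eq0 => /eqP/setP/(_ t); rewrite !inE /h1 => /negbFE/eqP->; rewrite mulr0.
  have [a pa ea] : exists2 a, pd 2 a & forall x, push h1 x = push h x * a x.
    case: typ => [mh|[sh _]]; first exact: div_min ph' mh ph1 h10.
    exact: div_sec s0 sq ph' sh ph1 h10.
  case: (pd2_affine pa) => b [mu eb].
  have hg t y : h (pt t y) != 0 -> t = b + lin mu y.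
    move=> ht; have Ny1 : #|[set t | (h (pt t y) != 0)%R]| = 1%N.
      have := Ny y; case: (push h y != 0) => // /eqP; rewrite cards_eq0 => /eqP/setP/(_ t).
      by rewrite !inE ht.
    have hu u : u != t -> h (pt u y) = 0.
      move=> ut; apply/eqP; apply: contraNT ut => hu.
      by apply/eqP; apply: (card_le1_eqP (eq_leq Ny1)); rewrite inE.
    have p1 : push h y = h (pt t y) by rewrite /push (bigD1 t) //= big1 ?addr0 // => u /hu.
    have p2 : push h1 y = t * h (pt t y).
      by rewrite /push (bigD1 t) //= big1 ?addr0 ?/h1 ?l1 // => u /hu; rewrite /h1 => ->;
        rewrite mulr0.
    by have := ea y; rewrite p1 p2 mulrC eb => /(mulfI ht).
  case: (flat_graph hg) => w [M [uM w0 wM hw]].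
  apply: (flat_hyper uM wM hw); exists 0, 1%:M; split.
  - by rewrite row_free_unit unitmx1.
  - by move=> x _; exists x; rewrite mulmx1 add0r.
  - have ph2 : pd s.+1 (fun y => h (pt b y *m M)).
      by have := pd_supp wM ph hw; apply: pd_le; lia.
    by apply: pd_ext ph2 _ => y; rewrite mulmx1 add0r.
exfalso.
have lt : (#|supp (push h)| < #|supp h|)%N by rewrite ltn_neqAle ne.
have mh : min_wd s (push h).
  case: typ => // -[_ e]; by move: lt; rewrite e ltnNge cW.
have cS' : #|supp (push h)| = ((q - s) * q ^ n.+1)%N.
  by apply/eqP; rewrite -(eqn_add2l #|zset (push h)|) cS -qE mh.
case: (min_word sq' ph' mh) => w [C [w0 cC hC]].
pose w' : 'cV[F]_(1 + N) := col_mx 0 w.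
have lw t y : lin w' (pt t y) = lin w y.
  by rewrite lin_pt col_mxKu col_mxKd mxE mul0r add0r.
have w'0 : w' != 0.
  apply: contraNneq w0 => e; case: (eqVneq w 0) => // w00.
  by case: (lin_surj 1 w00) => y ey; have := lw 0 y; rewrite e lin0l ey => /eqP;
    rewrite eq_sym oner_eq0.
pose psi (r : seq F) (z : 'rV[F]_(1 + N)) := \prod_(c <- r) (lin w' z - c).
have ppsi r : pd (size r).+1 (psi r).
  apply: pd_ext (pd_prod r (fun c => - c) (fun=> w')) _ => z.
  by apply: eq_bigr => c _; rewrite addrC.
have psi0 r z : lin w' z \in r -> psi r z = 0.
  by move=> zr; apply/eqP; rewrite /psi prodf_seq_eq0; apply/hasP; exists (lin w' z);
    rewrite //= subrr.
have cCc : #|~: C| = (q - s)%N.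
  have : (#|C| + #|~: C| = q)%N by rewrite cardsC.
  by rewrite cC; move: #|~: C| => k; lia.
pose r := enum (~: C); have sr : size r = (q - s)%N by rewrite -cCc cardE.
(* The factors kill every fibre with nonzero sum. A nonzero product, of degree at most 2 (q - 1) +
   1, would have weight at least (q - 1) q^n, but [push_split] leaves at most (s - 1) q^n. *)
have hpsi z : h z * psi r z = 0.
  apply/eqP/negPn/negP => hz.
  have pd2 : pd (2 * q.-1 + 1).+1 (fun z => h z * psi r z).
    have := pd_mul ph (ppsi r); rewrite sr; apply: pd_le; move: q0 sq'; move: #|F| => k; lia.
  have H1 := @min_distance F 2 (1 + n) 1 (fun z => h z * psi r z) z hz pd2.
  have H2 : (#|supp (fun z => h z * psi r z)%R| <= s.-1 * q ^ n)%N.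
    rewrite -(leq_add2r #|supp (push h)|); apply: leq_trans (push_split _) _.
      move=> t y; rewrite hC => wy; apply: psi0.
      by rewrite lw mem_enum inE.
    by apply: leq_trans cW _; rewrite /W cS' addnC.
  have := leq_trans H1 (leq_mul (leqnn q) H2).
  rewrite -[(1 + n)%N]/n.+1 expnS mulnCA leq_pmul2l // leq_pmul2r //.
  by move: sq' s0; move: #|F| => k; lia.
pose S c := #|[set z | (lin w' z == c) && (h z != 0)]|.
have hC0 z : lin w' z \in C -> h z = 0.
  move=> zC; have /eqP := hpsi z; rewrite mulf_eq0 => /orP[/eqP //|].
  by rewrite (negPf (prod_neq0 _)) // mem_enum inE zC.
have sumS : #|supp h| = (\sum_(c in ~: C) S c)%N.
  rewrite [LHS](sum_card_lin w') [RHS]big_mkcond; apply: eq_bigr => c _.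
  rewrite inE; case: ifP => // /negbFE cC'; apply/eqP; rewrite cards_eq0.
  by apply/eqP/setP => z; rewrite !inE; case: eqP => // wz; rewrite hC0 ?eqxx ?wz.
case: (col0_unit w'0) => M uM wM.
(* All factors but one isolate the section at [c]. The product has degree at most 2 (q - 1) and
   lives on a hyperplane, where its degree is at most q - 1; its weight is the minimum q^(n+1) or at
   least the second weight 2 (q - 1) q^n. *)
have dich c : c \in ~: C -> S c = (q ^ n.+1)%N \/ (q ^ n.+1 + q.-2 * q ^ n <= S c)%N.
  move=> cC'; pose hc z := h z * psi (rem c r) z.
  have cr : c \in r by rewrite mem_enum.
  have phc : pd (q.-1 + q.-1).+1 hc.
    have := pd_mul ph (ppsi (rem c r)); rewrite size_rem // sr; apply: pd_le.
    by move: q0 sq'; move: #|F| => k; lia.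
  have hc0 z : lin w' z != c -> hc z = 0.
    move=> wz; have [zC|zC] := boolP (lin w' z \in C); first by rewrite /hc hC0 ?mul0r.
    rewrite /hc psi0 ?mulr0 // mem_rem_uniq ?enum_uniq //.
    by rewrite !inE wz mem_enum inE.
  have psic z : lin w' z = c -> psi (rem c r) z != 0.
    by move=> wz; rewrite /psi wz; apply: prod_neq0; rewrite mem_rem_uniq ?enum_uniq // !inE eqxx.
  pose rc y := hc (pt c y *m M).
  have prc : pd q.-1.+1 rc by have := pd_supp wM phc hc0; apply: pd_le; lia.
  have cSc : #|supp rc| = S c.
    rewrite /S -(card_slice c (fun z => hc z != 0) uM wM); apply: eq_card => z; rewrite !inE.
    case: eqP => // wz; by rewrite /hc mulf_eq0 negb_or psic // andbT.
  have [y ry] : exists y, rc y != 0.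
    have : (0 < S c)%N.
      case: (lin_surj c w0) => y ey; have : push h y != 0.
        by rewrite hC ey; move: cC'; rewrite inE.
      move/push_fiber/card_gt0P=> [t]; rewrite inE => ht; apply/card_gt0P; exists (pt t y).
      by rewrite inE lw ey eqxx.
    by rewrite -cSc => /card_gt0P[y]; rewrite inE; exists y.
  have qq : (0 < q.-1 < q)%N by move: sq s1; move: #|F| => k; lia.
  have := card_zset_supp rc; rewrite cSc.
  have -> : (q ^ (1 + (1 + n)) = q.-1 * q ^ n.+1 + q ^ n.+1)%N by rewrite -mulSnr prednK // -expnS.
  case: (second_weight qq prc ry) => [-> /addnI|H e]; [by left|right].
  rewrite -(leq_add2l #|zset rc|) e addnCA addnC leq_add2r //.
have [/exists_inP[c0 c0C Sc0]|] := boolP [exists c0 in ~: C, S c0 != (q ^ n.+1)%N]; last first.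
  move/exists_inPn => H; move: lt; rewrite cS' sumS (eq_bigr (fun=> (q ^ n.+1)%N)).
    by rewrite sum_nat_const cCc ltnn.
  by move=> c cC'; have := H c cC'; rewrite negbK => /eqP.
have Sge c : c \in ~: C -> (q ^ n.+1 <= S c)%N.
  by move=> /dich[->//|]; apply: leq_trans; apply: leq_addr.
(* One section above the minimum adds (q - 2) q^n, more than the (s - 1) q^n left by [W]. *)
have : ((q - s) * q ^ n.+1 + q.-2 * q ^ n <= #|supp h|)%N.
  rewrite sumS (bigD1 c0) //= -cCc -sum_nat_const (bigD1 c0) //= addnAC.
  apply: leq_add; last by apply: leq_sum => c /andP[cC' _]; apply: Sge.
  by case: (dich c0 c0C) Sc0 => [->|//]; rewrite eqxx.
move=> H; have := leq_trans H cW; rewrite /W leq_add2l leq_pmul2r //.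
by move: sq s1; move: #|F| => k; lia.
Qed.

Lemma W_le t : (W <= q ^ (t + N))%N.
Proof.
apply: leq_trans (_ : q ^ N <= _)%N; last by rewrite leq_exp2l ?q_gt1 // leq_addl.
have -> : (q ^ N = (q - s) * q ^ n.+1 + s * q ^ n.+1)%N.
  by rewrite -mulnDl subnK // ltnW // ltnW.
rewrite leq_add2l; apply: leq_mul; first exact: leq_pred.
by rewrite leq_exp2l ?q_gt1.
Qed.

Lemma annihilator m (M : 'M[F]_(N, m)) : (N < m)%N -> exists2 c : 'cV[F]_m, c != 0 & M *m c = 0.
Proof.
move=> Nm; have : \rank M^T != m.
  by rewrite mxrank_tr; apply/eqP => e; move: Nm; rewrite ltnNge -{1}e rank_leq_row.
move=> rM; have : kermx M^T != 0 by rewrite kermx_eq0.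
case/matrix0Pn=> i [j kij]; exists (row i (kermx M^T))^T.
  by apply/cV0Pn; exists j; rewrite 2!mxE.
apply: trmx_inj; rewrite trmx_mul trmxK trmx0 -row_mul mulmx_ker.
by apply/rowP => k; rewrite !mxE.
Qed.

Lemma card_supp_flat m (f : 'rV[F]_m -> F) p (M : 'M[F]_(N, m)) : row_free M ->
  (forall x, f x != 0 -> exists y, x = p + y *m M) ->
  #|supp (fun y => f (p + y *m M))| = #|supp f|.
Proof.
move=> rM sM; have inj : injective (fun y => p + y *m M).
  by move=> y z /addrI/(row_free_inj rM).
rewrite -(card_imset _ inj); apply: eq_card => x; rewrite inE.
apply/imsetP/idP => [[y]|fx]; first by rewrite inE => fy ->.
by case: (sM x fx) => y ey; exists y; rewrite // inE -ey.
Qed.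

Lemma flat_reduction t (f : 'rV[F]_(t + N) -> F) x : pd (t * q.-1 + s).+1 f -> f x != 0 ->
  (#|supp f| <= W)%N -> flat_word s f.
Proof.
elim: t f x => [|t IH] f x pf fx cf.
  exists 0, 1%:M; split; first by rewrite row_free_unit unitmx1.
    by move=> z _; exists z; rewrite mulmx1 add0r.
  by apply: pd_ext pf _ => y; rewrite mulmx1 add0r.
case: (@tangent_push F (t + N) f x fx (leq_trans cf (W_le t))) => M uM hx.
apply: (flat_aff (m := 1 + (t + N)) uM (p := x)); set h := fun z => f (x + z *m M) in hx *.
have ph : pd (t.+1 * q.-1 + s).+1 h by apply: pd_comp.
have ch : #|supp h| = #|supp f| := card_supp_aff f x uM.
have hy0 : push h 0 != 0 by rewrite hx.
have ph' : pd (t * q.-1 + s).+1 (push h) by have := pd_push ph; apply: pd_le;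
  rewrite mulSn -addnA -addnS addKn.
have cW : (#|supp h| <= W)%N by rewrite ch.
have [p' [M' [rM' sM' pM']]] := IH _ 0 ph' hy0 (leq_trans (push_supp h) cW).
have [t0|tpos] := posnP t.
  subst t; apply: (flat_one (y0 := 0)) => //; by rewrite mul1n in ph.
have [c c0 Mc] : exists2 c : 'cV[F]_(t + N), c != 0 & M' *m c = 0.
  by apply: annihilator; rewrite -[X in (X < _)%N]add0n ltn_add2r.
pose w : 'cV[F]_(1 + (t + N)) := col_mx 0 c; pose b := lin c p'.
have lw u y : lin w (pt u y) = lin c y.
  by rewrite lin_pt col_mxKu col_mxKd mxE mul0r add0r.
have w0 : w != 0.
  case/cV0Pn: c0 => i ci; apply/eqP => e; case/eqP: ci.
  by have := lw 0 (delta_mx 0 i); rewrite e lin0l /lin -rowE mxE.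
have lb y : push h y != 0 -> lin c y = b.
  by move=> /sM'[z ->]; rewrite linD linM Mc lin0l addr0.
have hw z : lin w z != b -> h z = 0.
  move=> wz; apply/eqP/negPn/negP => hz.
  pose l z := - b + lin w z.
  have hlz : h z * l z != 0 by rewrite mulf_neq0 // /l addrC subr_eq0.
  have phl : pd (t.+1 * q.-1 + s.+1).+1 (fun z => h z * l z).
    by rewrite addnS; apply: pd_affM ph _ => y; rewrite mulrC.
  (* The product has at least (q - s - 1) q^(n+1) nonzeros and the projection (q - s) q^(n+1). If
     they add up to at most [W], then (q - s - 1) q <= s - 1, impossible for s + 1 < q. *)
  have H1 := @min_distance F t.+1 N s.+1 (fun z => h z * l z) z hlz phl.
  have H2 : (#|supp (fun z => h z * l z)%R| + #|supp (push h)| <= W)%N.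
    apply: leq_trans (push_split _) cW => u y hy.
    by rewrite /l lw lb // addNr.
  have [y' hy'] : exists y', push h (p' + y' *m M') != 0.
    by case: (sM' 0 hy0) => y' ey; exists y'; rewrite -ey.
  have := @schwartz_zippel F N s (fun y => push h (p' + y *m M')) y' hy' pM'.
  rewrite (card_supp_flat rM' sM') => H3.
  have : ((q - s.+1) * q ^ N + (q - s) * q ^ N <= q * W)%N.
    by apply: leq_trans (leq_add H1 H3) _; rewrite -mulnDr leq_mul2l H2 orbT.
  rewrite /W mulnDr addnC (_ : (q * _ = (q - s) * q ^ N)%N) ?leq_add2l; last first.
    by rewrite mulnCA -expnS.
  rewrite (mulnCA q s.-1) -expnS; apply/negP; rewrite -ltnNge.
  apply: (@leq_trans (q * q ^ n.+1));
    first by rewrite ltn_pmul2r ?expn_gt0 ?q0 // prednK // ltnW // ltnW.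
  by rewrite -expnS -[X in (X <= _)%N]mul1n leq_pmul2r ?expn_gt0 ?q0 // subn_gt0.
case: (col0_unit w0) => M2 uM2 wM2.
apply: (flat_hyper uM2 wM2 hw).
have e2 : #|supp (fun y => h (pt b y *m M2))| = #|supp h|.
  rewrite -(card_slice b (fun z => h z != 0) uM2 wM2); apply: eq_card => z; rewrite !inE.
  by case: (altP (lin w z =P b)) => // /hw->; rewrite eqxx.
have hx0 : h 0 != 0.
  by rewrite /h mul0mx addr0.
have b0 : b = lin w 0.
  by apply/eqP; rewrite eq_sym; apply: contraR hx0 => /hw->; rewrite eqxx.
have e0 := pt_lin 0 uM2 wM2.
apply: (IH _ (rsubmx (0 *m invmx M2))).
- have := pd_supp wM2 ph hw; apply: pd_le; rewrite mulSn -addnA -addnS addKn //.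
- by rewrite b0 -e0.
by rewrite e2.
Qed.

End Flats.

(** * Affine subspaces and the codewords *)

Section CodeWords.

Variable F : finFieldType.
Local Notation q := #|F|.

Lemma pd_coord_pow n (i : 'I_n) a : pd a.+1 (fun x : 'rV[F]_n => x 0 i ^+ a).
Proof.
elim: a => [|a IH]; first by apply: (pd_const 0 (c := 1)) => x; rewrite expr0.
apply: (pd_affM (b := 0) (w := delta_mx i 0) IH) => x.
by rewrite add0r /lin -colE mxE exprS.
Qed.

Lemma pd_monomial n (a : 'I_n -> nat) (r : seq 'I_n) :
  pd (\sum_(i <- r) a i).+1 (fun x : 'rV[F]_n => \prod_(i <- r) x 0 i ^+ a i).
Proof.
elim: r => [|i r IH]; first by rewrite big_nil; apply: (pd_const 0 (c := 1)) => x; rewrite big_nil.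
rewrite big_cons -addnS; apply: pd_ext (pd_mul (pd_coord_pow i (a i)) IH) _ => x.
by rewrite big_cons.
Qed.

Lemma reed_muller_pd m r (f : {ffun 'rV[F]_m -> F}) : reed_muller r f -> pd r.+1 (fun x => f x).
Proof.
case=> p [_ fp] pr.
have: pd r.+1 (fun x : 'rV[F]_m => \sum_(e <- msupp p) if e \in msupp p then
   p@_e * \prod_i x 0 i ^+ e i else 0).
  apply: pd_sum => e _; case: (boolP (e \in msupp p)) => [ep|_]; last exact: pd_zero.
  apply: pd_scale; apply: pd_le (pd_monomial e (index_enum _)); rewrite ltnS -mdegE.
  by apply: leq_trans pr; have := msize_mdeg_lt ep; case: (msize p).
move/pd_ext; apply=> x; rewrite fp mevalE big_seq [RHS]big_seq.
by apply: eq_bigr => e ->.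
Qed.

Definition hyp n (w : 'cV[F]_n) : {vspace 'rV[F]_n} := lker (linfun (mulmxr w)).

Lemma mem_hyp n (w : 'cV[F]_n) x : (x \in hyp w) = (lin w x == 0).
Proof.
rewrite memv_ker lfunE /=; apply/eqP/eqP => [e|e]; first by rewrite /lin e mxE.
by apply/matrixP => i j; rewrite !ord1 [RHS]mxE; apply: e.
Qed.

Lemma dim_hyp n (w : 'cV[F]_(1 + n)) : w != 0 -> \dim (hyp w) = n.
Proof.
move=> w0; apply/eqP; rewrite -(eqn_exp2l _ _ (q_gt1 F)); apply/eqP.
rewrite -(card_lin 0 w0) -card_vspace; apply: eq_card => x.
by rewrite inE mem_hyp.
Qed.

Lemma dim_hyp2 n (w w' : 'cV[F]_(1 + (1 + n))) : w != 0 -> (forall a, w' != a *: w) ->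
  \dim (hyp w :&: hyp w') = n.
Proof.
move=> w0 i; apply/eqP; rewrite -(eqn_exp2l _ _ (q_gt1 F)); apply/eqP.
rewrite -(card_lin2 0 0 w0 i) -card_vspace; apply: eq_card => x.
by rewrite inE memv_cap !mem_hyp.
Qed.

Lemma translate_dir m a b (V V' : {vspace 'rV[F]_m}) :
  translate a V = translate b V' -> V = V'.
Proof.
move/setP=> e; have := e a; rewrite !inE subrr mem0v => /esym ab.
apply/vspaceP => v; have := e (a + v); rewrite !inE addrAC subrr add0r => ->.
by rewrite addrAC rpredDl.
Qed.

Section Flat.

Variables (m N : nat) (p : 'rV[F]_m) (M : 'M[F]_(N, m)).
Hypothesis rM : row_free M.

Definition emb (y : 'rV[F]_N) := p + y *m M.

Lemma emb_inj : injective emb.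
Proof. by move=> y z /addrI/(row_free_inj rM). Qed.

Lemma ker_emb : lker (linfun (mulmxr M) : 'Hom('rV[F]_N, 'rV[F]_m)) == 0%VS.
Proof. by apply/lker0P => y z; rewrite !lfunE /=; apply: row_free_inj. Qed.

Lemma emb_translate a (V : {vspace 'rV[F]_N}) :
  emb @: translate a V = translate (emb a) (linfun (mulmxr M) @: V).
Proof.
apply/setP => x; rewrite inE; apply/imsetP/memv_imgP => [[y]|[y yV e]].
  rewrite inE => yV ->; exists (y - a) => //; rewrite lfunE /= /emb mulmxBl.
  by rewrite opprD addrACA subrr add0r.
exists (a + y); first by rewrite inE addrC addrA addNr add0r.
apply/eqP; rewrite -(subr_eq0) /emb mulmxDl addrA opprD addrA e lfunE /=.
by rewrite subrr.
Qed.

Lemma emb_codim t k a (V : {vspace 'rV[F]_N}) : (t + N = m)%N -> (\dim V + k = N)%N ->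
  affine_codim (t + k) (emb @: translate a V).
Proof.
move=> tN dV; exists (emb a), (linfun (mulmxr M) @: V)%VS; split; first exact: emb_translate.
rewrite limg_dim_eq ?(eqP ker_emb) ?capv0 // addnCA dV //.
Qed.

Lemma emb_parallel a b (V : {vspace 'rV[F]_N}) :
  parallel (emb @: translate a V) (emb @: translate b V).
Proof. by exists (emb a), (emb b), (linfun (mulmxr M) @: V)%VS; rewrite !emb_translate. Qed.

Lemma emb_parallelE a b (V V' : {vspace 'rV[F]_N}) :
  parallel (emb @: translate a V) (emb @: translate b V') -> V = V'.
Proof.
case=> a' [b' [U [e1 e2]]]; move: e1 e2; rewrite !emb_translate.
move=> /translate_dir e1 /translate_dir e2.
have {e1 e2} e : (linfun (mulmxr M) @: V = linfun (mulmxr M) @: V')%VS by rewrite e1 e2.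
have i : injective (linfun (mulmxr M) : 'Hom('rV[F]_N, 'rV[F]_m)) := lker0P ker_emb.
apply/vspaceP => v; have H W : (linfun (mulmxr M) v \in (linfun (mulmxr M) @: W)%VS) = (v \in W).
  by apply/memv_imgP/idP => [[u uW /i ->]|vW] //; exists v.
by rewrite -H e H.
Qed.

End Flat.

Lemma hyp_translate n (w : 'cV[F]_n) c : w != 0 ->
  exists a, [set y | lin w y == c] = translate a (hyp w).
Proof.
move=> w0; case: (lin_surj c w0) => a ea; exists a.
by apply/setP => y; rewrite !inE mem_hyp linB ea subr_eq0.
Qed.

Lemma hyp2_translate n (w w' : 'cV[F]_n) c c' : w != 0 -> (forall a, w' != a *: w) ->
  exists a, [set y | (lin w y == c) && (lin w' y == c')] = translate a (hyp w :&: hyp w').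
Proof.
move=> w0 i; case: (lin_surj2 c c' w0 i) => a [ea eb]; exists a.
by apply/setP => y; rewrite !inE memv_cap !mem_hyp !linB ea eb !subr_eq0.
Qed.

Section SecondWords.

Variables (m t n s : nat).
Local Notation N := (1 + (1 + n))%N.
Hypothesis tN : (t + N = m)%N.
Hypotheses (s1 : (1 < s)%N) (sq : (s.+1 < q)%N).
Variables (f : {ffun 'rV[F]_m -> F}) (p : 'rV[F]_m) (M : 'M[F]_(N, m)).
Hypothesis rM : row_free M.
Let g y := f (emb p M y).
Hypothesis fg : fsupport f = emb p M @: supp g.
Let G := emb p M @: [set: 'rV[F]_N].

Lemma emb_full_codim : affine_codim t G.
Proof.
have := @emb_codim m N p M rM t 0 0 fullv tN.
rewrite !addn0 dimvf /dim /= mul1n => /(_ erefl).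
have -> : translate 0 fullv = [set: 'rV[F]_N] by apply/setP => x; rewrite !inE memvf.
by [].
Qed.

Lemma emb_hyp_codim w c : w != 0 ->
  affine_codim t.+1 (emb p M @: [set y | lin w y == c]) /\
  emb p M @: [set y | lin w y == c] \subset G.
Proof.
move=> w0; split; last by apply/imsetS/subsetT.
case: (hyp_translate c w0) => a ->; rewrite -addn1.
by apply: emb_codim => //; rewrite dim_hyp // addn1.
Qed.

Lemma card_compl (C : {set F}) : #|C| = s.-1 -> #|~: C| = (q - s + 1)%N.
Proof.
by move=> cC; rewrite cardsCs setCK cC; move: s1 sq; move: #|F| => k; lia.
Qed.

Lemma typeI_support : typeI s g ->
  exists (P : {set {set 'rV[F]_m}}) (H : {set 'rV[F]_m}),
           [/\ #|P| = (q - s + 1)%N,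
               forall A, A \in P -> affine_codim t.+1 A /\ A \subset G,
               forall A B, A \in P -> B \in P -> parallel A B,
               affine_codim t.+1 H /\ (forall A, A \in P -> ~ parallel A H)
             & fsupport f = cover P :\: (cover P :&: H)].
Proof.
case=> w' [c' [w [C [w0 ind cC gE]]]].
have w'0 : w' != 0 by apply/eqP => e; have := ind 0; rewrite e scale0r eqxx.
pose h c := emb p M @: [set y | lin w y == c].
have memh c y : (emb p M y \in h c) = (lin w y == c).
  by rewrite (mem_imset _ _ (emb_inj rM)) inE.
have hP A : A \in [set h c | c in ~: C] -> exists2 c, c \notin C & A = h c.
  by case/imsetP=> c; rewrite inE; exists c.
exists [set h c | c in ~: C], (emb p M @: [set y | lin w' y == c']); split.
- rewrite card_in_imset ?card_compl // => c d _ _ /setP e.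
  case: (lin_surj c w0) => y ey; have := e (emb p M y).
  by rewrite !memh ey eqxx => /esym/eqP.
- by move=> A /hP[c _ ->]; apply: emb_hyp_codim.
- move=> A B /hP[c _ ->] /hP[d _ ->].
  case: (hyp_translate c w0) (hyp_translate d w0) => a ea [b eb].
  by rewrite /h ea eb; apply: emb_parallel.
- split; first by case: (emb_hyp_codim c' w'0).
  move=> A /hP[c _ ->]; rewrite /h.
  case: (hyp_translate c w0) (hyp_translate c' w'0) => a -> [b ->].
  move/(emb_parallelE rM)/vspaceP.
  case: (lin_surj2 0 1 w0 ind) => v [e1 e2] /(_ v).
  by rewrite !mem_hyp e1 e2 eqxx oner_eq0.
rewrite fg; apply/setP => x; rewrite in_setD in_setI.
apply/imsetP/andP => [[y]|[]].
  rewrite inE gE negb_or => /andP[y' yC] ->.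
  rewrite (mem_imset _ _ (emb_inj rM)) inE (negbTE y') andbF; split=> //.
  apply/bigcupP; exists (h (lin w y)); last by rewrite memh.
  by apply/imsetP; exists (lin w y); rewrite // inE.
rewrite negb_and => xH /bigcupP[A AP xA]; move: xH.
have -> : x \in cover [set h c | c in ~: C] by apply/bigcupP; exists A.
case/hP: AP xA => c cC' -> /imsetP[y]; rewrite inE => /eqP yc -> /=.
rewrite (mem_imset _ _ (emb_inj rM)) inE => y'.
by exists y; rewrite // inE gE (negbTE y') yc (negbTE cC').
Qed.

(** Off lin w = c a point lies on exactly one [h b], and is a zero exactly when that slope is in
    [C]; on lin w = c every [h b] reduces to the axis [K]. *)
Lemma typeII_support : typeII s g ->
  exists (P : {set {set 'rV[F]_m}}) (K : {set 'rV[F]_m}),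
           [/\ #|P| = (q - s + 1)%N,
               forall A, A \in P -> affine_codim t.+1 A /\ A \subset G,
               affine_codim t.+2 K,
               \bigcap_(A in P) A = K
             & fsupport f = cover P :\: K].
Proof.
case=> w [c [w' [c' [C [w0 ind cC gE]]]]].
pose h b := emb p M @: [set y | lin (w' - b *: w) y == c' - b * c].
have memh b y : (emb p M y \in h b) = (lin w' y - c' == b * (lin w y - c)).
  rewrite (mem_imset _ _ (emb_inj rM)) inE linDl -scaleNr linZl.
  by rewrite -subr_eq0 -[RHS]subr_eq0; congr (_ == 0); ring.
have wb b : w' - b *: w != 0 by rewrite subr_eq0.
have hP A : A \in [set h c | c in ~: C] -> exists2 c, c \notin C & A = h c.
  by case/imsetP=> b; rewrite inE; exists b.
pose K := emb p M @: [set y | (lin w y == c) && (lin w' y == c')].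
have memK y : (emb p M y \in K) = (lin w y == c) && (lin w' y == c').
  by rewrite (mem_imset _ _ (emb_inj rM)) inE.
have hK b y : lin w y = c -> (emb p M y \in h b) = (emb p M y \in K).
  by move=> e; rewrite memh memK e subrr mulr0 eqxx subr_eq0.
exists [set h b | b in ~: C], K; split.
- rewrite card_in_imset ?card_compl // => b d _ _ /setP e.
  (* A point at which the slope is b, so that it lies on [h b] and on no other member. *)
  case: (lin_surj2 (c + 1) (c' + b) w0 ind) => y [e1 e2]; have := e (emb p M y).
  by rewrite !memh e1 e2 !(addrC _ 1) (addrC c') !addrK !mulr1 eqxx => /esym/eqP.
- by move=> A /hP[b _ ->]; apply: emb_hyp_codim.
- rewrite /K; case: (hyp2_translate c c' w0 ind) => a ->; rewrite -addn2.
  by apply: emb_codim => //; rewrite dim_hyp2 // addn2.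
(* Two members already cut out the axis. *)
- have : (1 < #|~: C|)%N by rewrite card_compl //; move: s1 sq; move: #|F| => k; lia.
  case/card_gt1P => b [d []] bC dC bd.
  apply/setP => x; apply/bigcapP/idP => [H|/imsetP[y]].
    have := H (h b) (imset_f _ bC); case/imsetP => y _ xE;
    move: (H (h b) (imset_f _ bC)) (H (h d) (imset_f _ dC)).
    rewrite xE !memh memK => /eqP e; rewrite e -subr_eq0 -mulrBl mulf_eq0 !subr_eq0 (negbTE bd).
    by move=> /eqP yc; move: e; rewrite yc subrr mulr0 eqxx => /eqP; rewrite subr_eq0.
  rewrite inE => /andP[/eqP yc /eqP yc'] -> A /hP[b' _ ->].
  by rewrite hK // memK yc yc' !eqxx.
rewrite fg; apply/setP => x; rewrite in_setD.
apply/imsetP/andP => [[y]|[]].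
  rewrite inE gE negb_or => /andP[yc H] ->.
  rewrite memK (negbTE yc); split=> //.
  pose b := (lin w' y - c') / (lin w y - c).
  have yb : lin w' y - c' == b * (lin w y - c) by rewrite /b divfK // subr_eq0.
  apply/bigcupP; exists (h b); last by rewrite memh.
  apply: imset_f; rewrite inE; apply: contra H => bC.
  by apply/exists_inP; exists b.
move=> xK /bigcupP[A /hP[b bC ->]] xA; case/imsetP: (xA) => y _ xE; exists y => //.
move: xA xK; rewrite xE memh memK inE gE => /eqP yb.
case: (altP (lin w y =P c)) yb => [->|yc] yb.
  by move: yb; rewrite subrr mulr0 => /eqP; rewrite subr_eq0 => ->.
move=> _; apply: contra bC => /exists_inP[b' b'C]; rewrite yb => /eqP /mulIf -> //.
by rewrite subr_eq0.
Qed.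

End SecondWords.

End CodeWords.

Lemma weight_factor k s : (0 < s)%N -> (s <= k)%N ->
  ((k - s + 1) * (k - 1) = (k - s) * k + s.-1)%N.
Proof.
case: s => // a _ /subnK <-; rewrite addnK; move: (k - a.+1)%N => b.
by rewrite addn1 addnS subn1 mulSn mulnS /= addnAC.
Qed.

Theorem theorem2p3 (F : finFieldType) (q m t s : nat)
    (f : {ffun 'rV[F]_m -> F}) :
  #|F| = q -> (4 <= q)%N -> (2 <= m)%N -> (t <= m - 2)%N ->
  (2 <= s)%N -> (s <= q - 2)%N ->
  reed_muller (t * (q - 1) + s) f ->
  hamming_weight f = ((q - s + 1) * (q - 1) * q ^ (m - t - 2))%N ->
  exists G : {set 'rV[F]_m},
    [/\ affine_codim t G,
        fsupport f \subset G
      & (exists (P : {set {set 'rV[F]_m}}) (H : {set 'rV[F]_m}),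
           [/\ #|P| = (q - s + 1)%N,
               forall A, A \in P -> affine_codim t.+1 A /\ A \subset G,
               forall A B, A \in P -> B \in P -> parallel A B,
               affine_codim t.+1 H /\ (forall A, A \in P -> ~ parallel A H)
             & fsupport f = cover P :\: (cover P :&: H)])
        \/
        (exists (P : {set {set 'rV[F]_m}}) (K : {set 'rV[F]_m}),
           [/\ #|P| = (q - s + 1)%N,
               forall A, A \in P -> affine_codim t.+1 A /\ A \subset G,
               affine_codim t.+2 K,
               \bigcap_(A in P) A = K
             & fsupport f = cover P :\: K])].
Proof.
move=> qE q4 m2 tm s2 sq pf wf.
have s1 : (1 < s)%N by [].
have sq' : (s.+1 < #|F|)%N by rewrite qE; lia.
pose n := (m - t - 2)%N.
have tN : (t + (1 + (1 + n)) = m)%N by rewrite /n; lia.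
have {pf} : pd (t * #|F|.-1 + s).+1 (fun x => f x).
  by move/reed_muller_pd: pf; rewrite -qE subn1.
have {wf} : #|supp (fun x => f x)| = ((#|F| - s) * #|F| ^ n.+1 + s.-1 * #|F| ^ n)%N.
  rewrite qE [LHS]wf -/n expnS mulnA -mulnDl; congr (_ * _)%N.
  by rewrite weight_factor // ltnW // ltnW // -qE.
move=> cf pf.
have [x fx] : exists x, f x != 0.
  have : (0 < #|supp (fun x => f x)|)%N.
    by rewrite cf addn_gt0 muln_gt0 subn_gt0 expn_gt0 (ltnW sq') (ltnW (q_gt1 F)).
  by case/card_gt0P => x; rewrite inE; exists x.
move: f x fx pf cf; rewrite -tN => f x fx pf cf.
have [p [M [rM sM pM]]] := flat_reduction s1 sq' pf fx (eq_leq cf).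
have cg := card_supp_flat rM sM; rewrite cf in cg.
have wg : sec_word s (fun y => f (p + y *m M)).
  have qN : (#|F| ^ (1 + (1 + n)) = (#|F| - s) * #|F| ^ n.+1 + s * #|F| ^ n.+1)%N.
    by rewrite -mulnDl subnK ?expnS // ltnW // ltnW.
  have := card_zset_supp (fun y => f (p + y *m M)); rewrite cg /sec_word qN.
  by rewrite addnCA => /addnI.
have fg : fsupport f = emb p M @: supp (fun y => f (p + y *m M)).
  apply/setP => z; rewrite inE; apply/idP/imsetP => [fz|[y]].
    by case: (sM z fz) => y ey; exists y; rewrite // inE -ey.
  by rewrite inE => fy ->.
exists (emb p M @: setT); split.
- exact: emb_full_codim.
- by rewrite fg; apply/imsetS/subsetT.
rewrite -qE.
case: (classification s1 sq' pM wg) => H; [left|right].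
  exact: typeI_support H.
exact: typeII_support H.
Qed.
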